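(* Up to isomorphism, there is exactly one 6-vertex-critical ($P_6$, diamond)-free graph with clique number $3$.
   Context: All graphs are finite and simple. $P_n$ and $K_n$ denote the path and the complete graph on $n$ vertices. The diamond is the graph obtained from $K_4$ by removing an edge. A graph $G$ contains a graph $H$ if some induced subgraph of $G$ is isomorphic to $H$; $G$ is $(H_1,\ldots,H_n)$-free if it contains none of $H_1,\ldots,H_n$. The clique number of $G$ is the size of a largest clique in $G$, and $\chi(G)$ is the chromatic number. A graph $G$ is $k$-vertex-critical if $\chi(G)=k$ and every proper induced subgraph of $G$ has chromatic number smaller than $k$. *)

(* Defs.v *)
From Stdlib Require List.
From mathcomp Require Import all_boot.

Set Implicit Arguments.
Unset Strict Implicit.
Unset Printing Implicit Defensive.

Record sgraph := SGraph {
  vertex :> finType;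
  edge : rel vertex;
  edge_sym : symmetric edge;
  edge_irr : irreflexive edge }.

Definition isomorphic (G H : sgraph) : Prop :=
  exists2 f : G -> H, bijective f & forall x y, edge (f x) (f y) = edge x y.

Lemma induced_sym (G : sgraph) (S : {set G}) :
  symmetric (fun x y : {x : G | x \in S} => edge (val x) (val y)).
Proof. by move=> x y; rewrite edge_sym. Qed.

Lemma induced_irr (G : sgraph) (S : {set G}) :
  irreflexive (fun x y : {x : G | x \in S} => edge (val x) (val y)).
Proof. by move=> x; rewrite edge_irr. Qed.

Definition induced (G : sgraph) (S : {set G}) : sgraph :=
  SGraph (@induced_sym G S) (@induced_irr G S).

Lemma path_sym n :
  symmetric (fun i j : 'I_n => (i.+1 == j :> nat) || (j.+1 == i :> nat)).
Proof. by move=> i j; rewrite orbC. Qed.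

Lemma path_irr n :
  irreflexive (fun i j : 'I_n => (i.+1 == j :> nat) || (j.+1 == i :> nat)).
Proof. by move=> i; rewrite orbb gtn_eqF. Qed.

Definition path_graph n : sgraph := SGraph (@path_sym n) (@path_irr n).

Lemma complete_sym n : symmetric (fun i j : 'I_n => i != j).
Proof. by move=> i j; rewrite eq_sym. Qed.

Lemma complete_irr n : irreflexive (fun i j : 'I_n => i != j).
Proof. by move=> i; rewrite eqxx. Qed.

Definition complete_graph n : sgraph :=
  SGraph (@complete_sym n) (@complete_irr n).

Lemma del_edge_sym (G : sgraph) (u v : G) :
  symmetric (fun x y : G => edge x y && ([set x; y] != [set u; v])).
Proof. by move=> x y; rewrite edge_sym setUC. Qed.

Lemma del_edge_irr (G : sgraph) (u v : G) :
  irreflexive (fun x y : G => edge x y && ([set x; y] != [set u; v])).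
Proof. by move=> x; rewrite edge_irr. Qed.

Definition del_edge (G : sgraph) (u v : G) : sgraph :=
  SGraph (del_edge_sym u v) (del_edge_irr u v).

Definition diamond : sgraph :=
  del_edge (ord0 : complete_graph 4) (ord_max : complete_graph 4).

Definition contains (G H : sgraph) : Prop :=
  exists S : {set G}, isomorphic (induced S) H.

Definition free_of (Hs : seq sgraph) (G : sgraph) : Prop :=
  List.Forall (fun H => ~ contains G H) Hs.

Definition clique (G : sgraph) (S : {set G}) : bool :=
  [forall x in S, forall y in S, (x != y) ==> edge x y].

Definition clique_number (G : sgraph) : nat :=
  \max_(S : {set G} | clique S) #|S|.

Definition colorable (G : sgraph) (k : nat) : bool :=
  [exists c : {ffun G -> 'I_k}, forall x, forall y, edge x y ==> (c x != c y)].

Lemma colorable_ex (G : sgraph) : exists k, colorable G k.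
Proof.
exists #|G|; apply/existsP; exists [ffun x => enum_rank x].
apply/forallP=> x; apply/forallP=> y; apply/implyP=> exy; rewrite !ffunE.
by apply: contraTneq exy => /enum_rank_inj->; rewrite edge_irr.
Qed.

Definition chromatic_number (G : sgraph) : nat := ex_minn (colorable_ex G).

Definition vertex_critical (k : nat) (G : sgraph) : Prop :=
  chromatic_number G = k /\
  forall S : {set G}, S \proper [set: G] -> chromatic_number (induced S) < k.

(* Main.v *)
Require Import Defs.
From mathcomp Require Import all_boot.
From Stdlib Require Import BinPosDef.

(* The graph consists of 25 of the 27 lines on a smooth cubic surface, two meeting lines being left out; adjacent
   vertices are meeting lines. In the graph H of all 27 lines every edge uv lies in a triangle uvw such that every
   other vertex is adjacent to exactly one of u, v, w, which excludes K4, the diamond and P6. Removing two disjoint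
   lines, or a triangle, from H leaves a 5-colourable graph, but removing two meeting lines does not. As the
   automorphisms of H are transitive on edges, H minus an edge is the only 6-vertex-critical induced subgraph of H.

   Conversely, let G be 6-vertex-critical. Then G is connected, has minimum degree at least 5, and admits no
   homomorphism into a proper subgraph. Fix an induced subgraph F of G and consider the possible adjacencies of the
   other vertices to F. Forbidden subgraphs rule out most of them, and criticality forces some of the remaining ones
   to occur. Branching over these, one reaches a contradiction or an F inside H for which adjacency to F identifies
   every other vertex of G with a line, so that G embeds into H. In this way one excludes from G, if G is not the
   25-vertex graph, first a 5-cycle with a vertex adjacent to exactly two consecutive vertices of it, then a 5-cycle
   with a vertex adjacent to two consecutive vertices and to the opposite one (with, and then without, a further
   vertex), and at last a triangle. *)

Set Implicit Arguments.
Unset Strict Implicit.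
Unset Printing Implicit Defensive.

(** The order of a critical graph is not bounded in advance, so the branching runs over adjacency
    rows and not over vertices: it keeps the set of rows over [F] that may still occur, however many
    vertices share one. Both uses of criticality can be read off from this set. If no remaining row
    is adjacent to a vertex, its degree is its degree in [F]; and a map of [F] into itself that
    respects the edges of [F] and the remaining rows extends by the identity to an endomorphism of
    [G].

    The 25-vertex graph itself contains the 5-cycle with the vertex adjacent to three of its
    vertices, and also the further vertex. Excluding these configurations therefore has to use that
    [G] is another graph. This happens at the leaves, where the rows determine the lines and [G]
    would become an induced subgraph of H.

    Each excluded configuration joins the list of forbidden graphs of the later certificates. How
    the certificates were found does not matter; only their checking is proved sound. *)

(** * Induced subgraphs as codes *)

Definition row (T : Type) (e : rel T) (x : T) (s : seq T) : seq bool :=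
  [seq e x y | y <- s].

(* The code of the subgraph induced on [x :: s] starts with the adjacencies of [x] to [s]. *)
Fixpoint rows (T : Type) (e : rel T) (s : seq T) : seq (seq bool) :=
  if s is x :: s' then row e x s' :: rows e s' else [::].

Fixpoint adj (c : seq (seq bool)) (i j : nat) : bool :=
  if c is r :: c' then
    match i, j with
    | 0, 0 => false
    | 0, j'.+1 => nth false r j'
    | i'.+1, 0 => nth false r i'
    | i'.+1, j'.+1 => adj c' i' j'
    end
  else false.

Lemma eq_rows (T : eqType) (e e' : rel T) (s : seq T) :
  {in s &, e =2 e'} -> rows e s = rows e' s.
Proof.
elim: s => //= x s IH eq_e; congr (_ :: _).
  by apply/eq_in_map => y ys; rewrite eq_e // !inE ?eqxx ?ys ?orbT.
by apply: IH => y z ys zs; rewrite eq_e // inE ?ys ?zs orbT.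
Qed.

Lemma rows_map (T U : Type) (e : rel U) (f : T -> U) (s : seq T) :
  rows e (map f s) = rows (fun x y => e (f x) (f y)) s.
Proof. by elim: s => //= x s ->; rewrite /row -map_comp. Qed.

Lemma size_rows (T : Type) (e : rel T) (s : seq T) : size (rows e s) = size s.
Proof. by elim: s => //= x s ->. Qed.

Lemma nth_row (T : Type) (e : rel T) x x0 (s : seq T) i :
  i < size s -> nth false (row e x s) i = e x (nth x0 s i).
Proof. by move=> lt_i; rewrite (nth_map x0). Qed.

Lemma adjE (T : Type) (e : rel T) x0 (s : seq T) i j :
  symmetric e -> irreflexive e -> i < size s -> j < size s ->
  adj (rows e s) i j = e (nth x0 s i) (nth x0 s j).
Proof.
move=> sym_e irr_e; elim: s i j => [|x s IH] // [|i] [|j] /= lt_i lt_j.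
- by rewrite irr_e.
- exact: nth_row.
- by rewrite (nth_row _ _ x0) // sym_e.
- exact: IH.
Qed.

(** With this the checker gets the code of any selection of vertices from the code of [F] alone,
    without access to the graph. *)
Lemma rows_adj (T : eqType) (e : rel T) x0 (s : seq T) (ps : seq nat) :
  symmetric e -> irreflexive e -> all (gtn (size s)) ps ->
  rows (adj (rows e s)) ps = rows e [seq nth x0 s p | p <- ps].
Proof.
move=> sym_e irr_e /allP lt_ps; rewrite rows_map; apply: eq_rows => p q ps_p ps_q.
by apply: adjE => //; [have := lt_ps _ ps_p | have := lt_ps _ ps_q].
Qed.

(** As [s] runs over all orderings, a single code of a graph excludes all its induced copies. *)
Definition avoids (G : sgraph) (c : seq (seq bool)) : Prop :=
  forall s : seq G, uniq s -> rows (@edge G) s <> c.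

(** * The line graph of the cubic surface *)

(* In Schlaefli's notation [(i, 6)], [(i, 7)] and [(i, j)] are the lines a_i, b_i and c_ij. The meeting lines a_0
   and b_1 come last, so that the other 25 are an initial segment. *)
Definition lines : seq (nat * nat) :=
  [seq l <- [seq (i, j) | i <- iota 0 8, j <- iota i.+1 (7 - i)]
     | l \notin [:: (0, 6); (1, 7); (6, 7)]] ++ [:: (0, 6); (1, 7)].

(** Pairs of an 8-set, adjacent when disjoint, form a graph on 28 vertices. Switching it with
    respect to the pairs disjoint from {6, 7}, which are those with second entry below 6, isolates
    {6, 7}; the other 27 pairs then form the graph of the lines. *)
Definition meet (l m : nat * nat) : bool :=
  let: (i, j) := l in let: (i', j') := m in
  [&& i != i', i != j', j != i' & j != j'] (+) (j < 6) (+) (j' < 6).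

Definition line_table : seq (seq bool) :=
  Eval vm_compute in [seq [seq meet l m | m <- lines] | l <- lines].

(** The default values make every index from 27 on meet nothing, so that 27 can stand for a missing
    line. *)
Definition line_adj (x y : nat) : bool := nth false (nth [::] line_table x) y.

(** * Certificates *)

(* A certificate refutes a pair [(F, L)], where [F] is the code of an induced subgraph and [L] lists the rows that
   the vertices outside may have over it. [Cut i] asks whether some vertex has the row number [i] of [L];
   [Deg i] uses that vertex [i] has too few neighbours, and [Fold ab] that [a |-> b] for [(a, b)] in [ab] extends to
   a retraction. [Leaf m tr] maps [F] to the lines [m]; then [tr], a list built by [And], refutes every pair of
   outside vertices that are not adjacent as the lines with the same rows are. *)
Inductive tree :=
  | Prune of positive & tree
  | Cut of nat & tree & tree
  | Deg of nat
  | Fold of seq (nat * nat)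
  | Clash of positive
  | Leaf of seq nat & tree
  | And of tree & tree
  | End.

Fixpoint pbits (p : positive) : seq bool :=
  match p with xH => [::] | xO q => false :: pbits q | xI q => true :: pbits q end.

(** The bits come least significant first; the accumulator reverses the digits, so that the most
    significant one leads. *)
Fixpoint chunks (l : bitseq) (acc : seq nat) : seq nat :=
  if l is [:: a, b, c, d, e & l'] then
    chunks l' (a + (b + (c + (d + e.*2).*2).*2).*2 :: acc)
  else acc.

(* A leading 1 protects the digit 0. *)
Definition digits (p : positive) : seq nat := chunks (pbits p) [::].

Fixpoint eqbits (s t : bitseq) : bool :=
  match s, t with
  | [::], [::] => true
  | a :: s', b :: t' => if a then b && eqbits s' t' else ~~ b && eqbits s' t'
  | _, _ => false
  end.

Fixpoint eqcode (s t : seq bitseq) : bool :=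
  match s, t with
  | [::], [::] => true
  | a :: s', b :: t' => eqbits a b && eqcode s' t'
  | _, _ => false
  end.

Lemma eqbitsP s t : eqbits s t -> s = t.
Proof. by elim: s t => [|[] s IH] [|[] t] //= /IH ->. Qed.

Lemma eqcodeP s t : eqcode s t -> s = t.
Proof. by elim: s t => [|a s IH] [|b t] //= /andP[/eqbitsP-> /IH->]. Qed.

(* The base 32 digits [k :: j :: qs] of [w] say that a new vertex, as vertex [j], and the vertices [qs] of [F] form
   the forbidden graph number [k]; the result is the condition on the row of the new vertex. *)
Definition witness (fs : seq (seq bitseq)) (F : seq bitseq) (w : positive) :
    option (seq nat * bitseq) :=
  if digits w is [:: k, j & qs] then
    let P := nth [::] fs k in
    let m := size qs - j in
    let bs := [seq adj P j i | i <- iota 0 j ++ iota j.+1 m] in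
    if [&& k < size fs, j <= size qs, uniq qs, all (gtn (size F)) qs
         (* In the code [bs :: rows (adj F) qs] the new vertex has index 0 and [qs] the indices from
            1 on; the list of indices moves the new vertex to place [j]. *)
         & eqcode (rows (adj (bs :: rows (adj F) qs)) (iota 1 j ++ 0 :: iota j.+1 m)) P]
    then Some (qs, bs) else None
  else None.

Definition matches (r : seq nat * bitseq) (t : bitseq) : bool :=
  eqbits [seq nth false t q | q <- r.1] r.2.

Definition prune (fs : seq (seq bitseq)) (F : seq bitseq) (w : positive) (L : seq bitseq) :=
  if witness fs F w is Some r then [seq t <- L | ~~ matches r t] else L.

(** When a vertex joins [F] at the front, an outside vertex keeps its old row and may or may not be
    adjacent to the new one. *)
Definition ext (L : seq bitseq) : seq bitseq :=
  flatten [seq [:: false :: t; true :: t] | t <- L].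

Fixpoint lookup (ab : seq (nat * nat)) (i : nat) : nat :=
  if ab is (a, b) :: ab' then if i == a then b else lookup ab' i else i.

Definition deg_ok (F : seq bitseq) (L : seq bitseq) (i : nat) : bool :=
  [&& i < size F, count (adj F i) (iota 0 (size F)) < 5 & all (fun t => ~~ nth false t i) L].

(** The first entry of [ab] singles out the vertex [a] that the map has to miss; vertices not listed
    are fixed. *)
Definition fold_ok (F : seq bitseq) (L : seq bitseq) (ab : seq (nat * nat)) : bool :=
  let n := size F in
  let h := lookup ab in
  if ab is (a, _) :: _ then
    [&& a < n, all (fun i => (h i < n) && (h i != a)) (iota 0 n),
        all (fun i => all (fun j => adj F i j ==> adj F (h i) (h j)) (iota 0 n)) (iota 0 n)
      & all (fun t => all (fun i => nth false t i ==> nth false t (h i)) (iota 0 n)) L]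
  else false.

(** The value 27, the length of the list searched, means that no line has the row [t]. *)
Definition line_of_row (m : seq nat) (t : bitseq) : nat :=
  find (fun h => (h \notin m) && eqbits (row line_adj h m) t) (iota 0 27).

(** The diagonal is included because two outside vertices may share a row. Of two different entries
    only one order occurs. *)
Fixpoint pairs (T : Type) (s : seq T) : seq (T * T) :=
  if s is x :: s' then [seq (x, y) | y <- s] ++ pairs s' else [::].

(** Two outside vertices with the given rows and the wrong mutual adjacency are put in front of [F].
    A pair of rows that both lack a line has no prescribed adjacency; connectedness takes care of
    it. *)
Definition leaf_codes (F : seq bitseq) (L : seq bitseq) (m : seq nat) : seq (seq bitseq) :=
  [seq [:: ~~ line_adj p.1.2 p.2.2 :: p.2.1, p.1.1 & F]
     | p <- pairs [seq (t, line_of_row m t) | t <- L] & (p.1.2 < 27) || (p.2.2 < 27)].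

(** A row without a line has to be zero, so that the vertices with such rows are cut off from
    [F]. *)
Definition leaf_ok (F : seq bitseq) (L : seq bitseq) (m : seq nat) : bool :=
  [&& 0 < size F, uniq m, all (gtn 27) m, eqcode (rows line_adj m) F
    & all (fun t => (line_of_row m t < 27) || ~~ has id t) L].

Fixpoint check (fs : seq (seq bitseq)) (tr : tree) (F : seq bitseq) (L : seq bitseq) : bool :=
  match tr with
  | Prune w tr' => check fs tr' F (prune fs F w L)
  | Cut i tr1 tr2 =>
      check fs tr1 (nth [::] L i :: F) (ext L) && check fs tr2 F (take i L ++ drop i.+1 L)
  | Deg i => deg_ok F L i
  | Fold ab => fold_ok F L ab
  | Clash w => if F is t :: F' then
                 if witness fs F' w is Some r then matches r t else false else false
  | Leaf m tr' => leaf_ok F L m && checks fs tr' (ext (ext L)) (leaf_codes F L m)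
  | And _ _ | End => false
  end
with checks fs (tr : tree) (L : seq bitseq) (Fs : seq (seq bitseq)) : bool :=
  match Fs, tr with
  | [::], _ => true
  | F :: Fs', And tr1 tr2 => check fs tr1 F L && checks fs tr2 L Fs'
  | _, _ => false
  end.

Definition path6 := rows (fun i j => (i.+1 == j) || (j.+1 == i)) (iota 0 6).
(** The missing edge joins 0 and 3, as it joins [ord0] and [ord_max] in [diamond]. *)
Definition diamond4 :=
  rows (fun i j => [&& i != j, (i, j) != (0, 3) & (i, j) != (3, 0)]) (iota 0 4).
Definition clique_code n := rows (fun i j : nat => i != j) (iota 0 n).

(** The order is reversed because certificates add vertices at the front: vertex 0 of [es] has the
    last place in the code. *)
Definition code_of (n : nat) (es : seq (nat * nat)) : seq bitseq :=
  rows (fun i j => ((i, j) \in es) || ((j, i) \in es)) (rev (iota 0 n)).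

Definition c5_edges := [:: (0, 1); (1, 2); (2, 3); (3, 4); (4, 0)].
Definition c5_cap := Eval vm_compute in code_of 6 (c5_edges ++ [:: (5, 0); (5, 1)]).
Definition c5_roof := Eval vm_compute in code_of 6 (c5_edges ++ [:: (5, 0); (5, 1); (5, 3)]).
(** This graph occurs in the 25-vertex graph: its vertices 0 to 6 can be taken as the lines c_01,
    b_0, c_02, c_13, c_24, a_1 and c_34. *)
Definition c5_roof_ear :=
  Eval vm_compute in code_of 7 (c5_edges ++ [:: (5, 0); (5, 1); (5, 3); (6, 0); (6, 2)]).
Definition base_codes := Eval vm_compute in [:: path6; diamond4; clique_code 4].
Definition all_types n := iter n ext [:: [::]].

(** * Computations with the 27 lines *)

Lemma line_adj_sym : symmetric line_adj.
Proof.
have oob x y : (27 <= x) || (27 <= y) -> line_adj x y = false.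
  rewrite /line_adj => /orP[le_x|le_y]; first by rewrite (nth_default [::]) ?nth_nil.
  rewrite nth_default //; case: (ltnP x 27) => lt_x; last by rewrite nth_default.
  have /allP/(_ _ (mem_nth [::] _))/eqP-> // : all (fun r => size r == 27) line_table by vm_compute.
move=> x y; case: (leqP 27 x) => [le_x|lt_x]; first by rewrite !oob ?le_x ?orbT.
case: (leqP 27 y) => [le_y|lt_y]; first by rewrite !oob ?le_y ?orbT.
have /allP/(_ x) : all (fun x => all (fun y => line_adj x y == line_adj y x) (iota 0 27)) (iota 0 27).
  by vm_compute.
by rewrite mem_iota => /(_ lt_x)/allP/(_ y); rewrite mem_iota => /(_ lt_y)/eqP.
Qed.

Lemma line_adj_irr : irreflexive line_adj.
Proof.
move=> x; case: (ltnP x 27) => lt_x; last by rewrite /line_adj (nth_default [::]) ?nth_nil.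
have /allP/(_ x) : all (fun x => ~~ line_adj x x) (iota 0 27) by vm_compute.
by rewrite mem_iota => /(_ lt_x)/negPf.
Qed.

Lemma line_adj_out x y : 27 <= y -> line_adj x y = false.
Proof. by move=> le_y; rewrite line_adj_sym /line_adj (nth_default [::]) ?nth_nil. Qed.

Definition all_lines := iota 0 27.

Definition third_ok (u v w z : nat) : bool :=
  if z \in [:: u; v; w] then true else line_adj z u + line_adj z v + line_adj z w == 1.

Definition third (u v : nat) : nat :=
  find (fun w => if line_adj u w then line_adj v w else false) all_lines.

(** This is the axiom of the generalized quadrangle of order (2, 4), whose points are the 27 lines
    and whose 45 blocks are the triangles, that is the tritangent planes. *)
Definition line_gq_ok : bool :=
  all (fun u => all (fun v => if line_adj u v then
    if third u v < 27 then all (third_ok u v (third u v)) all_lines else false else true) all_lines) all_lines.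

Fixpoint indep_seqs (k : nat) (cand : seq nat) : seq (seq nat) :=
  if k is k'.+1 then
    (fix loop cand := if cand is x :: c then
       [seq x :: t | t <- indep_seqs k' [seq y <- c | ~~ line_adj x y]] ++ loop c else [::]) cand
  else [:: [::]].

(** These are the 72 halves of Schlaefli's 36 double-sixes, each listed once in increasing order. *)
Definition sixes := Eval vm_compute in indep_seqs 6 all_lines.

(* Six disjoint lines can be taken as a_0, ..., a_5: then b_i is the line that meets all of them but a_i, and c_ij the
   third line of the triangle on a_i and b_j. *)
Definition blowdown (t : seq nat) : seq nat :=
  let b := [seq find (fun x => all (fun y => line_adj x y == (y != z)) t) all_lines | z <- t] in
  let im (l : nat * nat) :=
    if l.2 == 6 then nth 27 t l.1 else if l.2 == 7 then nth 27 b l.1 else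
    find (fun x => line_adj x (nth 27 t l.1) && line_adj x (nth 27 b l.2)) all_lines in
  map im lines.

(** If [u] and [v] meet, they are to become a_0 and b_1. As b_1 meets every a_i except a_1, a six is
    chosen that contains [u] and has exactly one member [w] not meeting [v], and [w] becomes a_1. If
    they do not meet, they become a_0 and a_1 in a six through both. *)
Definition six_through (u v : nat) : seq nat :=
  if line_adj u v then
    let six t := [&& u \in t, v \notin t & count (fun x => ~~ line_adj v x) t == 1] in
    let t := nth [::] sixes (find six sixes) in
    let w := nth 0 t (find (fun x => ~~ line_adj v x) t) in
    [:: u, w & [seq x <- t | (x != u) && (x != w)]]
  else
    let t := nth [::] sixes (find (fun t => (u \in t) && (v \in t)) sixes) in
    [:: u, v & [seq x <- t | (x != u) && (x != v)]].

Definition a0 := Eval vm_compute in index (0, 6) lines.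
Definition a1 := Eval vm_compute in index (1, 6) lines.
Definition b1 := Eval vm_compute in index (1, 7) lines.
Definition c01 := Eval vm_compute in index (0, 1) lines.

Definition auto_ok (f : seq nat) : bool :=
  [&& size f == 27, all (gtn 27) f, uniq f &
   all (fun i => all (fun j => line_adj (nth 27 f i) (nth 27 f j) == line_adj i j) (iota 0 i)) all_lines].

(** Automorphisms carry the pair a_0, b_1 to all meeting pairs, and the pair a_0, a_1 to all
    disjoint ones. So a statement about an arbitrary pair of lines reduces to a single
    computation. *)
Definition trans_ok : bool :=
  all (fun u => all (fun v => let f := blowdown (six_through u v) in
     [&& auto_ok f, nth 27 f a0 == u & nth 27 f (if line_adj u v then b1 else a1) == v])
     (iota u.+1 (26 - u))) all_lines.

Fixpoint has_clique (k : nat) (s : seq nat) : bool :=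
  if k is k'.+1 then
    (fix loop s := if s is x :: s' then
       if has_clique k' [seq y <- s' | line_adj x y] then true else loop s' else false) s
  else true.

(* Searches for a colouring whose class number [k] is under construction: [cand] may still join it, the vertices of
   [out] and [ob] have colours below [k], and those of [ob] must get a neighbour in the class, since otherwise they
   could be moved into it. Conditionals replace [&&] and [||], whose second argument [vm_compute] would evaluate. *)
Fixpoint no_coloring (n k : nat) (cand out ob : seq nat) : bool :=
  if n is n'.+1 then
    (* The vertices of [ob ++ out] have only the [k] colours below [k]. For [k = 0] the test
       succeeds as soon as one of them is left, and this closes a branch that has used up the
       colours. *)
    if (if k < 3 then has_clique k.+1 (ob ++ out) else false) then true else
    match cand with
    | p :: c =>
        if no_coloring n' k [seq q <- c | ~~ line_adj p q]
             ([seq q <- c | line_adj p q] ++ [seq q <- ob | line_adj p q] ++ out)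
             [seq q <- ob | ~~ line_adj p q]
        then if has (line_adj p) c then no_coloring n' k c out (p :: ob) else true
        else false
    | [::] =>
        if ob is _ :: _ then true else
        match k, out with
        | k'.+1, v :: r => no_coloring n' k' [seq q <- r | ~~ line_adj v q] [seq q <- r | line_adj v q] [::]
        | _, _ => false
        end
    end
  else false.

Definition colorable_off (R : seq nat) : Prop := exists c : nat -> nat,
  forall x, x < 27 -> x \notin R ->
    c x < 5 /\ forall y, y < 27 -> y \notin R -> line_adj x y -> c x != c y.

Definition colorable_off_check (R : seq nat) (c : seq nat) : bool :=
  all (fun x => if x \in R then true else
    if nth 5 c x < 5 then
      all (fun y => if y \in R then true else if line_adj x y then nth 5 c x != nth 5 c y else true) all_lines
    else false) all_lines.

Lemma colorable_off_checkP R c : colorable_off_check R c -> colorable_off R.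
Proof.
move=> /allP ok; exists (nth 5 c) => x lt_x /negPf xR.
have := ok x; rewrite mem_iota lt_x xR => /(_ isT); case: ifP => // _ /allP okx.
split=> // y lt_y /negPf yR xy.
by have := okx y; rewrite mem_iota lt_y yR xy; apply.
Qed.

(** The entry 5 is no colour and marks the omitted lines. By transitivity this colouring serves all
    pairs of disjoint lines, and the next one all triangles. *)
Lemma colorable_off_a0a1 : colorable_off [:: a0; a1].
Proof.
by apply: (@colorable_off_checkP _
  [:: 0; 4; 2; 3; 0; 1; 4; 2; 3; 0; 5; 4; 4; 1; 0; 2; 2; 2; 0; 3; 3; 0; 1; 4; 4; 5; 1]); vm_compute.
Qed.

Lemma colorable_off_a0b1c01 : colorable_off [:: a0; b1; c01].
Proof.
by apply: (@colorable_off_checkP _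
  [:: 5; 0; 0; 4; 4; 3; 1; 3; 1; 2; 0; 0; 1; 2; 4; 4; 3; 2; 1; 1; 4; 0; 2; 0; 3; 5; 5]); vm_compute.
Qed.

Lemma trans_okP : trans_ok. Proof. by vm_compute. Qed.
Lemma line_gq_okP : line_gq_ok. Proof. by vm_compute. Qed.
(** Class number 5 has no candidates, so all 25 lines have colours below 5. The number 100 bounds
    the depth of the recursion; a search that exceeds it answers [false]. *)
Lemma no_coloring_25 : no_coloring 100 5 [::] (iota 0 25) [::]. Proof. by vm_compute. Qed.

Lemma line_adj_neighbour u : u < 27 -> exists2 v, v < 27 & line_adj u v.
Proof.
have /allP/(_ u) : all (fun u => has (line_adj u) all_lines) all_lines by vm_compute.
by rewrite mem_iota => ok /ok/hasP[v]; rewrite mem_iota; exists v.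
Qed.

(** The third line of the triangle on a_0 and b_1 is the only one to meet both. Hence every vertex
    of the 25-vertex graph forms a disjoint pair with a_0 or b_1, or a triangle with both. *)
Lemma line_adj_a0_b1 (i : 'I_25) : [|| val i == c01, ~~ line_adj i a0 | ~~ line_adj i b1].
Proof.
have /allP/(_ i) : all (fun i => [|| i == c01, ~~ line_adj i a0 | ~~ line_adj i b1]) (iota 0 25).
  by vm_compute.
by rewrite mem_iota ltn_ord; apply.
Qed.

Lemma line_adj_a0b1c01 : [/\ line_adj a0 b1, line_adj a0 c01 & line_adj b1 c01]. Proof. by []. Qed.

Lemma line_of_rowP m t : line_of_row m t < 27 -> line_of_row m t \notin m /\ row line_adj (line_of_row m t) m = t.
Proof.
move=> lt_h; have lt_h' := lt_h; rewrite /line_of_row -[X in _ < X](size_iota 0) -has_find in lt_h'.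
by have := nth_find 0 lt_h'; rewrite nth_iota // add0n => /andP[hm /eqbitsP].
Qed.

(** * Certificates for the four graphs *)

Section Trees.

Local Notation P := Prune.
Local Notation C := Cut.
Local Notation D := Deg.
Local Notation F := Fold.
Local Notation L := Leaf.
Local Notation X := Clash.
Local Notation A := And.
Local Notation E := End.

(** The first digit of a literal is the number of the forbidden graph: 0, 1 and 2 are the path, the
    diamond and K4. *)
Definition c5_cap_tree : tree :=
  P 0x80a110c80(P 0x80a020c41(P 0x80a028443(P 0x2110c41(P 0x2119480(P 0x2111062(P 0x21190a0(P
  0x2111422(P 0x21180a4(P 0x2219480(C 16(P 0x80a4188c0(P 0x80a3214c0(P 0x80a031483(P 0x806130064(P
  0x806030483(P 0x806130083(P 0x808129060(P 0x21108c0(C 8(P 0x80a4004e6(P 0x80a238c80(P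
  0x806238c05(P 0x8064004c2(P 0x80a238404(P 0x2119480(P 0x21190a0(D 6))))))))(C 12(P 0x2110c01(P
  0x808019c45(P 0x808238405(P 0x80a230064(P 0x2111803(P 0x808238404(P 0x80a520c01(P 0x2111c20(P
  0x806009ca4(P 0x2111c60(C 4(P 0x80a63a040(P 0x80a628041(P 0x2110c02(P 0x8068384a0(P 0x80a300824(
  P 0x21118a0(P 0x80a428067(P 0x80a122060(P 0x21110a0(P 0x80a628048(P 0x80a409c60(P 0x80a200ce6(C
  4(P 0x80a131440(P 0x80a301cc5(P 0x2118860(P 0x80a03a125(P 0x2118062(P 0x2111c02(P 0x808940801(P
  0x2118c40(P 0x8060220a6(P 0x80a9180e6(P 0x21120e0(P 0x80a838061(C 2(P 0x80a501066(P 0x80a701423(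
  F[::(2,0)])))(C 6(P 0x80a900482(P 0x80a901c44(F[::(8,0)])))(C 6(P 0x80a702881(P 0x80aa00c28(F[::
  (6,0)])))(D 6))))))))))))))))(C 6(P 0x80a448c40(P 0x80a102125(P 0x80a740023(P 0x2118102(P
  0x2110801(P 0x80a408045(P 0x2118900(P 0x211a040(P 0x80a608109(C 14(P 0x80a928880(P 0x80a801066(P
  0x211a880(P 0x80a042466(P 0x80a548c80(P 0x806052447(P 0x80a308107(P 0x2112500(P 0x80a940082(P
  0x2119140(P 0x2118144(P 0x221a880(C 2(P 0x80a600887(P 0x80a6020e4(F[::(3,0)])))(C 5(P
  0x80aa004a3(P 0x80aa02065(F[::(9,0)])))(C 5(P 0x80a8010a1(P 0x80a402c29(F[::(7,0)])))(D 7)))))))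
  )))))))))(F[::(9,2);(4,0)])))))))))))(F[::(1,8)])))))))))))))))(C 4(P 0x80a63a040(P 0x2118041(P
  0x2111401(P 0x80a838405(P 0x2118440(P 0x2218820(P 0x80a200ce6(P 0x80a740805(P 0x80a500907(P
  0x2118820(P 0x808200ce4(P 0x21110a0(P 0x80a628048(P 0x80a5004e8(C 12(P 0x80a839820(P 0x80821a407
  (P 0x80a9004c7(P 0x80a731520(P 0x80a608128(P 0x8083114c0(P 0x2112401(P 0x80a741020(C 8(P
  0x80a322820(P 0x80a00a883(P 0x808551060(P 0x2110cc0(P 0x2111801(P 0x2118041(P 0x2118440(P
  0x80a5480c7(C 11(P 0x80a800546(P 0x80a208109(P 0x806041d46(F[::(7,0)]))))(D 3))))))))))(F[::(0,3
  )]))))))))))(C 12(P 0x806031488(P 0x80a3100c7(P 0x806031504(F[::(5,0)]))))(D 8)))))))))))))))))(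
  C 5(P 0x80a522040(P 0x80a600904(P 0x2118820(P 0x80a031d04(P 0x2118440(P 0x2118041(P 0x2218820(P
  0x806718085(P 0x80a012085(P 0x806019c85(P 0x2111cc0(P 0x80a530048(C 4(P 0x80a2180e6(P
  0x80a1180a6(F[::(6,0)])))(C 12(P 0x2118123(P 0x221a460(D 3)))(D 2)))))))))))))))(C 8(P
  0x80a7410a0(P 0x80a600904(P 0x2118820(P 0x80a838405(P 0x2118440(P 0x80a7180a4(P 0x21194c0(P
  0x21180c5(P 0x2218820(P 0x80a500907(P 0x80a600d04(P 0x21198a0(P 0x80a5004e8(C 3(P 0x80a638062(P
  0x2111404(P 0x80a9280e1(P 0x80a2180e6(P 0x80a638069(P 0x80a8200a6(C 8(P 0x80a411520(P
  0x80a311c01(P 0x80aa480e2(P 0x8083228a0(P 0x80a901c44(P 0x2112401(P 0x80a4198e0(P 0x80a23812a(C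
  2(P 0x80a101864(P 0x806008864(P 0x80a428028(F[::(2,0)]))))(D 8))))))))))(C 10(P 0x806051848(P
  0x80a700d25(F[::(6,0)])))(D 6)))))))))(D 2)))))))))))))))(C 19(P 0x80a520440(P 0x80a530041(P
  0x80a600824(P 0x80a031c24(P 0x211a040(P 0x80a338440(P 0x808041c25(P 0x21114c0(P 0x80a1100c5(P
  0x2111cc0(P 0x2118900(P 0x2118102(P 0x221a040(C 5(P 0x80a2180e6(P 0x80a1180a6(F[::(6,0)])))(C 8(
  P 0x80a638460(P 0x80a628061(P 0x21108a0(P 0x8084484e0(P 0x2110900(P 0x2112005(P 0x808448c06(P
  0x80a1180a6(P 0x80a500c27(C 4(P 0x80a02a881(P 0x2119860(P 0x21180c3(P 0x2219860(P 0x80a500881(D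
  3))))))(F[::(2,0)])))))))))))(D 2))))))))))))))))(F[::(1,3)]))))))))))))))))(C 16(P 0x80a520ce0(
  P 0x806520c01(P 0x80a0398a4(P 0x2119c20(P 0x806321420(P 0x806231401(P 0x8060388a4(P 0x806238085(
  P 0x8062380a4(P 0x21184e0(P 0x21180e1(P 0x2219c20(C 6(P 0x80a110067(P 0x806141c05(P 0x21198a0(D
  7))))(D 1))))))))))))))(C 18(P 0x80a101483(P 0x2119c20(P 0x808628023(P 0x21110a0(P 0x80a2380a4(P
  0x21118a0(P 0x21184e0(P 0x21180e1(P 0x2219c20(C 1(P 0x80a429820(P 0x808531c60(P 0x80a00a085(P
  0x8087410a0(P 0x806008867(P 0x80a522020(P 0x806208085(P 0x2111820(P 0x8084298e0(P 0x8082410a0(P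
  0x8062080a4(C 6(P 0x80a9180e6(P 0x80a2080a6(F[::(6,0)])))(D 2)))))))))))))(C 1(P 0x80a531c60(P
  0x2111001(P 0x808740405(P 0x80a0220e6(P 0x808240c06(P 0x2111003(P 0x80a208067(P 0x80a520067(P
  0x808240c05(P 0x80a208085(P 0x80601a0c5(P 0x2112080(C 2(P 0x80a838860(P 0x806848806(P 0x2111003(
  P 0x80a301025(P 0x80a3018a1(P 0x80a712480(P 0x80a12a460(P 0x21114c0(P 0x80a730069(P 0x80a400c47(
  P 0x2111cc0(C 2(P 0x80a401446(P 0x80a401cc2(F[::(1,0)])))(C 7(P 0x80a901cc2(P 0x80a900c46(F[::(
  8,0)])))(C 7(P 0x806039864(P 0x80a202928(F[::(6,0)])))(D 6)))))))))))))))(C 2(P 0x80a848820(P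
  0x80a700d25(P 0x2118480(P 0x2118081(P 0x2111c01(P 0x80a820062(P 0x21108e0(P 0x80a218088(P
  0x2119020(P 0x80a9180e6(P 0x80a638069(C 2(P 0x80aa20107(P 0x80a1200c7(F[::(7,0)])))(D 4)))))))))
  ))))(C 4(P 0x80a9180e6(P 0x80a2180a6(F[::(6,0)])))(D 2))))))))))))))))(C 4(P 0x806008867(P
  0x808740405(P 0x21184c0(P 0x80a241006(D 3)))))(F[::(1,2);(0,6)])))))))))))))(C 20(P 0x808029843(P
  0x2119c20(P 0x806400446(P 0x21190a0(P 0x21180a4(P 0x2219480(P 0x8063200c2(P 0x8081014c3(P
  0x8061010c2(P 0x2119480(P 0x808101066(P 0x21184e0(C 3(P 0x80a730440(P 0x80a718041(P 0x80a63a040(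
  P 0x2110c02(P 0x80a300826(P 0x80a7404a0(P 0x80a2014c7(P 0x80a60a060(P 0x80a628048(C 2(P
  0x80a3018e8(P 0x80a400c47(F[::(1,0)])))(D 2)))))))))))(D 1))))))))))))))(F[::(0,1)])))))))))))))
  )(C 16(P 0x80a129060(P 0x806018825(P 0x2110860(P 0x806218025(P 0x80a130064(P 0x2111060(P
  0x8062180a1(P 0x8060188a1(P 0x2111803(P 0x21108c0(C 6(P 0x806530860(P 0x2119060(P 0x2118083(P
  0x2219060(P 0x806231460(P 0x806020446(P 0x8060204c2(D 3))))))))(C 6(P 0x80a531c60(P 0x2119060(P
  0x2118083(P 0x2219060(P 0x80a019cc5(P 0x8081398a0(P 0x80a610081(P 0x80a120046(P 0x2118c80(P
  0x8083008c1(P 0x80a710085(P 0x80a3008c5(C 1(P 0x80a63a080(P 0x2111002(P 0x80a718085(P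
  0x80a510067(P 0x8068180a6(P 0x80601a0c5(P 0x2112040(P 0x2112080(C 3(P 0x80a228460(P 0x2119860(P
  0x21180c3(P 0x2219860(P 0x80a730081(P 0x2118cc0(P 0x80a301107(C 4(P 0x80a651020(P 0x80a900ce4(P
  0x80aa48027(P 0x2110801(P 0x80a019544(P 0x80a30048a(P 0x8065480e4(C 6(P 0x80a848061(P 0x2110c02(
  P 0x80a118128(C 6(P 0x80a802ce3(F[::(12,0);(7,2)]))(F[::(1,6)])))))(D 10)))))))))(F[::(1,9)])))))
  ))))(F[::(2,4)]))))))))))(C 3(P 0x80a7408a0(P 0x21108a0(P 0x2111403(P 0x80a228067(P 0x808241020(
  P 0x808018482(P 0x8061280e8(P 0x8081220e0(P 0x806028507(P 0x80a7180a4(P 0x806128107(C 8(P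
  0x806041ca2(P 0x806031d24(F[::(7,0)])))(D 7)))))))))))))(C 3(P 0x80a122040(P 0x21180a2(P
  0x2219440(P 0x2119440(P 0x80a428067(P 0x21188a0(P 0x80a200ce6(P 0x806028507(P 0x806128107(C 2(
  F[::(5,3);(2,1)])(D 3)))))))))))(C 3(P 0x80a718085(P 0x2111440(P 0x2111002(P 0x80a510067(P
  0x80a8180c5(P 0x2112040(P 0x2112080(C 3(P 0x80a820066(P 0x2111403(P 0x80a618088(P 0x80a9200e6(P
  0x21104e0(P 0x2112460(P 0x21124a0(C 2(P 0x80a719440(P 0x808951020(P 0x808451460(P 0x808a28ce0(P
  0x808928ce0(P 0x80a0110e3(P 0x808409460(P 0x808928480(C 3(P 0x2118061(P 0x2218c20(P 0x806441420(
  P 0x2118c20(P 0x80a019504(D 1))))))(F[::(0,8)]))))))))))(C 11(P 0x80a409460(P 0x80a302881(P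
  0x211a040(P 0x2118900(P 0x80a718149(P 0x80a120803(P 0x2118102(P 0x221a040(C 7(P 0x808058462(P
  0x80874140a(P 0x80a82016a(P 0x211aca0(D 10)))))(F[::(4,6)]))))))))))(F[::(1,0)]))))))))))(D 3)))
  ))))))(D 2)))))))))))))))))(C 15(P 0x80a238480(P 0x808530061(P 0x2119060(P 0x2118c80(P
  0x808301841(P 0x808019c45(P 0x808138c05(P 0x80a230081(P 0x806021447(P 0x2118083(P 0x2219060(P
  0x8060214e2(C 3(P 0x80a122060(P 0x2111403(P 0x80a228067(P 0x80a8180a6(P 0x80a409c60(P
  0x80a7180a2(C 3(P 0x8060204a2(P 0x806020445(F[::(1,0)])))(D 3))))))))(D 2))))))))))))))(C 19(P
  0x808029841(P 0x2119c60(P 0x80a2380a4(P 0x808231401(P 0x806019046(P 0x808120c02(P 0x21110a0(P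
  0x808120c06(P 0x2118ce0(P 0x21180e3(P 0x2219c60(C 4(P 0x80a63a040(P 0x21180a2(P 0x2111401(P
  0x80a0120e6(P 0x808441cc0(P 0x80a8180a6(P 0x2119440(P 0x80a500507(P 0x21188a0(P 0x80a200ce6(C 4(
  P 0x80a8200a2(P 0x2111c03(P 0x80a618088(P 0x80a9200e6(P 0x80a820066(C 7(P 0x80a651040(P
  0x80aa18801(P 0x80aa48047(P 0x80a900866(P 0x2110801(P 0x80a61a120(P 0x80a71012a(P 0x808331c80(C
  2(P 0x80a101564(P 0x80ab38023(P 0x806008964(F[::(2,0)]))))(D 6))))))))))(C 7(P 0x80a900c44(P
  0x80604a044(F[::(8,0)])))(D 8))))))))(D 4))))))))))))(C 11(P 0x80a3410a0(P 0x21188a0(P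
  0x80a500503(P 0x808440806(P 0x80a338024(P 0x2119440(P 0x80a340405(P 0x21180a2(P 0x2219440(P
  0x806029903(C 3(P 0x80a30a080(P 0x2111802(P 0x80a600928(P 0x80a11a480(C 3(P 0x80a500c44(P
  0x806028444(F[::(1,0)])))(D 4))))))(D 3))))))))))))(C 14(P 0x80a011481(P 0x80a3400c5(P
  0x80a2018e3(F[::(4,2);(1,0)]))))(F[::(1,3)])))))))))))))))(F[::(2,0)])))))))))))))))(C 16(P
  0x808021422(P 0x80a130083(P 0x808129002(P 0x2110c80(P 0x2111480(P 0x2111804(C 22(P 0x808029843(P
  0x80a2380a4(P 0x21104a0(P 0x21110a0(P 0x21118a0(P 0x2111c05(C 2(P 0x80a522040(P 0x808429820(P
  0x80863a080(P 0x8087410a0(P 0x80a012085(P 0x2111840(P 0x8083404c0(P 0x8084298e0(P 0x80a0118a4(P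
  0x808131480(P 0x8083410a0(C 3(P 0x2118061(P 0x2218c20(P 0x806441c20(P 0x2118c20(P 0x806849420(P
  0x80a019cc5(D 1)))))))(C 25(P 0x80a448c20(P 0x80a628023(P 0x2111402(P 0x80a1020e6(P 0x80a308104(
  P 0x2111c40(P 0x80a440023(P 0x2111401(P 0x80a100924(P 0x2112002(P 0x2112005(P 0x80a500467(P
  0x21124a0(P 0x80a4400a6(C 5(P 0x8060398a9(P 0x2118460(P 0x8063010a9(P 0x2118c20(P 0x2118061(P
  0x2218c20(P 0x80a700d45(P 0x808950c02(D 5)))))))))(C 5(P 0x80a3518e0(P 0x80a701543(P 0x806950c07
  (P 0x2111c04(P 0x806950ce0(P 0x80a500468(P 0x80a9280e6(P 0x2111820(P 0x80a2200e6(P 0x80a701143(P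
  0x80a6380a9(P 0x806352407(P 0x2110880(P 0x80aa28022(P 0x80a928082(P 0x2110820(P 0x21120e0(C 2(P
  0x80a252ca0(P 0x80a142480(P 0x2111404(P 0x2111805(P 0x80a03ad49(P 0x80a3280ca(P 0x2111c04(P
  0x806032d28(P 0x2112ce0(P 0x80a3280e8(C 6(P 0x80a910c80(P 0x80a801c46(P 0x2112807(P 0x80a51ace0(
  P 0x80a701065(P 0x2112004(P 0x2112500(P 0x80a911880(P 0x80a8010c2(P 0x80a620109(P 0x2112540(C 3(
  P 0x806038d21(P 0x806050c25(P 0x80ac200e2(F[::(3,0)]))))(C 3(P 0x80ab30900(P 0x2118500(P
  0x2118101(P 0x2111c01(P 0x806040d66(P 0x80a350025(P 0x80a802966(P 0x211a020(P 0x806508046(C 9(P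
  0x80ad00943(P 0x80ad01c6a(F[::(12,0)])))(D 10)))))))))))(C 12(P 0x80ac02922(P 0x80ac01849(F[::(
  11,0)])))(D 9)))))))))))))))(F[::(3,1)]))))))))))))(F[::(3,9)])))))))))))))))))))(C 5(P
  0x80a9518e0(P 0x2118061(P 0x2118460(P 0x2111001(P 0x80a9280e6(P 0x80a2200e6(P 0x2118c20(P
  0x808301cc2(P 0x808950c02(P 0x80a6380a9(P 0x80aa28022(P 0x80a700d49(P 0x80a928082(C 7(P
  0x80a301828(P 0x211a480(P 0x2119120(D 8))))(F[::(2,0)])))))))))))))))(C 22(P 0x80603a022(P
  0x8060220c1(P 0x80a548082(P 0x806022026(F[::(8,0)])))))(C 22(P 0x806838022(P 0x2119cc0(P
  0x80603a022(P 0x2112080(P 0x80a548082(P 0x80a702422(P 0x2112403(P 0x21180e6(P 0x80603a145(P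
  0x21198e0(C 22(P 0x2118128(P 0x221a500(D 8)))(D 7))))))))))))(C 22(P 0x80a838041(P 0x2118880(P
  0x80603a0aa(P 0x80a1100e8(P 0x2119cc0(P 0x2112403(P 0x2118082(P 0x80603a145(P 0x2119040(P
  0x808201948(P 0x21198e0(C 15(P 0x2118062(P 0x2218c40(D 8)))(D 7)))))))))))))(C 28(P 0x2118107(P
  0x221a0e0(D 7)))(C 28(P 0x2118041(P 0x2218820(D 7)))(D 6)))))))))))))))))))))))(C 27(P 0x2118460
  (P 0x80a1020e6(P 0x80a100924(P 0x80a1014c7(P 0x2111c40(P 0x2118c20(P 0x2112002(P 0x2118061(P
  0x2111d00(P 0x21124a0(P 0x80a4400a6(C 24(P 0x80a5518e0(P 0x2111003(P 0x2112404(F[::(0,8)]))))(C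
  24(P 0x806838022(P 0x2111003(P 0x80a701145(P 0x2119cc0(P 0x80603a022(P 0x80a548082(P 0x2112403(P
  0x2112404(P 0x21180e6(P 0x80603a145(P 0x21198e0(C 25(P 0x2118128(P 0x221a500(D 8)))(D 7)))))))))
  ))))(C 29(P 0x2118107(P 0x221a0e0(D 7)))(D 6)))))))))))))))(C 29(P 0x2118460(P 0x80a100924(P
  0x80a101524(P 0x21180c5(P 0x2111c40(P 0x21198a0(P 0x80a600d24(P 0x2112002(P 0x806031d24(P
  0x2118c20(P 0x808101527(P 0x21194c0(C 11(P 0x80a202125(P 0x211a060(P 0x80a200d45(P 0x2118d00(D 5
  )))))(C 22(P 0x2118107(P 0x221a0e0(D 2)))(D 1)))))))))))))))(F[::(0,6)]))))))))))))))))(C 7(P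
  0x80a7410a0(P 0x80a500d01(P 0x2110c02(P 0x8067404a0(P 0x2111402(P 0x80a140805(P 0x2111403(P
  0x80a500901(P 0x80a7180a4(P 0x806740405(P 0x2111840(P 0x21118a0(P 0x80a500907(P 0x806141c05(P
  0x80a428067(C 9(P 0x80a929820(P 0x8060410a6(P 0x808202083(P 0x8064400a6(P 0x2111020(P 0x2112002(
  P 0x80a009125(P 0x80a408047(P 0x8064400c5(C 2(P 0x806028903(P 0x80a501d03(F[::(2,0)])))(C 11(P
  0x80a301c45(P 0x80a3024a2(P 0x80a638061(F[::(8,0)]))))(D 6))))))))))))(C 10(P 0x80a3398a0(P
  0x2111402(P 0x808202083(P 0x80a500467(P 0x2111401(P 0x80a0298e3(P 0x2112002(P 0x2112005(C 1(P
  0x80a14a880(P 0x2111804(P 0x2111404(P 0x80a022921(P 0x80a032928(P 0x21104c0(P 0x2111803(P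
  0x2111003(P 0x80a601528(P 0x80601a847(P 0x21128c0(C 3(P 0x80a901967(P 0x80a330124(F[::(11,1);(
  10,0)])))(F[::(0,10)])))))))))))))(F[::(2,8)]))))))))))(F[::(1,2)]))))))))))))))))))(C 11(P
  0x80a522060(P 0x808718041(P 0x80a031d04(P 0x2119840(P 0x80a012085(P 0x8087410a0(P 0x21188c0(P
  0x21180c2(P 0x2219840(P 0x806200c85(P 0x808200ce1(P 0x80a600d04(P 0x80a8180c5(P 0x808200ce4(C 10
  (P 0x80a248c20(P 0x80a101522(P 0x80a3398a0(P 0x80a628024(P 0x80a102122(P 0x808448ce0(P
  0x80a628023(P 0x80a249020(P 0x2111401(P 0x8063388a0(P 0x21124a0(P 0x80a3080a6(C 6(P 0x80a201943(
  P 0x806030503(F[::(1,0)])))(D 1))))))))))))))(C 10(P 0x80a3398a0(P 0x80a5020e3(P 0x80a628024(P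
  0x2111c40(P 0x808448ce0(P 0x80a628023(P 0x2112002(P 0x21124a0(P 0x80a3080a6(C 8(P 0x806030488(P
  0x2110460(P 0x2110520(D 4))))(D 1)))))))))))(D 0)))))))))))))))))(C 13(P 0x80a3404c0(P
  0x808520041(P 0x2119840(P 0x806021467(P 0x808740805(P 0x806031468(P 0x21188c0(P 0x21180c2(P
  0x2219840(P 0x806201067(P 0x80a341006(P 0x8065200e3(P 0x8064008e3(P 0x8062010e3(C 2(P
  0x806100888(P 0x80a941c20(P 0x80a100924(P 0x80a848c20(D 4)))))(C 10(P 0x21180a1(P 0x2219420(D 1)
  ))(D 0)))))))))))))))))(C 15(P 0x808718041(P 0x2119840(P 0x808740805(P 0x8082010a1(P 0x21188c0(P
  0x808520061(P 0x808718081(P 0x21180c2(P 0x2219840(P 0x80a718085(P 0x80a520067(P 0x808200ce1(P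
  0x80a8180c5(C 5(P 0x80a71a480(P 0x80a4018e2(P 0x8088384a0(P 0x2111804(P 0x8068488c0(P
  0x80a3094c0(P 0x80a8200c5(P 0x80811a440(P 0x80a530088(P 0x80a601023(P 0x80624a006(P 0x80a9200c7(
  P 0x80611a406(C 8(P 0x80a01a882(P 0x808951040(P 0x21108c0(D 2))))(F[::(2,3)])))))))))))))))(C 5(
  P 0x80a8494c0(P 0x80a2018a1(P 0x80a508c02(P 0x2110c02(P 0x80a200c25(P 0x2111c40(P 0x80a848806(P
  0x2111cc0(P 0x80a600d28(P 0x80a201025(C 3(P 0x8060184c2(P 0x80a701149(P 0x806038549(F[::(1,0)]))
  ))(C 3(P 0x21180e6(P 0x2219cc0(D 7)))(D 6)))))))))))))(C 5(P 0x21180c5(P 0x2111804(P 0x80a848806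
  (D 6))))(C 9(P 0x21180e6(P 0x2219cc0(D 6)))(D 5))))))))))))))))))(C 19(P 0x80a522040(P
  0x808338041(P 0x808429820(P 0x806038c85(P 0x8083410a0(P 0x80a03a085(P 0x8081410a0(P 0x808039824(
  P 0x808201c61(P 0x806338085(P 0x2111c02(P 0x806201c85(P 0x808131480(P 0x21118e0(P 0x8063380a4(C
  2(P 0x80a7424a0(P 0x2118061(P 0x2111402(P 0x80a500507(P 0x8069200e6(P 0x2118c20(P 0x80a628028(P
  0x2118460(P 0x8060224e6(P 0x21124a0(C 2(P 0x80a651040(P 0x2110c02(P 0x80a201546(P 0x2112060(P
  0x2111402(P 0x80a838041(P 0x2111c03(P 0x80a500888(P 0x21120e0(C 2(P 0x80a301967(P 0x80a600ca9(
  F[::(1,0)])))(C 9(P 0x80a502026(P 0x80a5028c1(F[::(9,0)])))(D 7))))))))))))(C 5(P 0x80a110107(P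
  0x80a4100c7(F[::(7,0)])))(C 5(P 0x80a110107(P 0x211a060(P 0x80a4100c7(P 0x2118d00(D 7)))))(C 7(P
  0x2118122(P 0x221a440(D 2)))(D 1)))))))))))))))(C 3(P 0x80a54a020(P 0x80a848c06(P 0x2118c20(P
  0x2118061(P 0x2110c02(P 0x80a101125(P 0x2111c40(P 0x80a530028(P 0x2118460(P 0x80a600d28(P
  0x808101127(P 0x2111cc0(C 8(P 0x80a701145(P 0x80a2200e6(P 0x80603a145(F[::(8,0)]))))(D 6))))))))
  ))))))(C 3(P 0x80a7424a0(P 0x80a848c06(P 0x21180c5(P 0x2111402(P 0x80a500507(P 0x80a9200c7(P
  0x21198a0(P 0x80a600928(P 0x80a600d28(P 0x2118460(P 0x80a501107(P 0x2118c20(P 0x80a600509(P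
  0x21194c0(C 9(P 0x80a701145(P 0x80603a145(F[::(8,0)])))(D 6))))))))))))))))(F[::(2,7)]))))))))))
  )))))))))(C 22(P 0x80a60a080(P 0x80a401cc1(P 0x2111002(P 0x8082010a3(P 0x80803a025(P 0x80a5200e3
  (P 0x8083404c0(P 0x808338081(P 0x808201c61(P 0x80a338085(P 0x808140805(P 0x80a0214c1(P 0x2111c02
  (P 0x80a130804(P 0x2111c04(P 0x2112080(C 2(P 0x80a62a460(P 0x2118061(P 0x2110c02(P 0x806300888(P
  0x2118c20(P 0x8063008a6(P 0x80a200504(P 0x806300904(P 0x80a710025(P 0x2118460(P 0x80a508047(C 11
  (P 0x80a700c22(P 0x80a301046(P 0x80a638061(P 0x80601a046(F[::(8,0)])))))(C 11(P 0x806838041(P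
  0x2119cc0(P 0x80a700c22(P 0x80603a022(P 0x21180e6(P 0x2219cc0(P 0x80603a145(P 0x21198e0(C 13(P
  0x2118128(P 0x221a500(D 8)))(D 7))))))))))(C 17(P 0x2118107(P 0x221a0e0(D 7)))(D 6))))))))))))))
  )(C 2(P 0x80a7424a0(P 0x2111402(P 0x80a8200a6(P 0x80a012501(P 0x80a02a507(P 0x2111c40(P
  0x80a142440(P 0x21104a0(P 0x80a628088(P 0x2111403(P 0x2110c02(P 0x80a200c28(P 0x8069200e6(P
  0x8060224e6(P 0x21124a0(C 5(P 0x80a951020(P 0x80a910023(P 0x21184a0(P 0x21180a1(P 0x2110801(P
  0x2119420(P 0x80a201543(P 0x80a340046(C 8(P 0x80a849440(P 0x80aa008e8(P 0x8085484c0(P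
  0x808132ce0(P 0x8060518e8(P 0x8085184c0(P 0x2112802(P 0x80a849040(P 0x808b30808(P 0x80a838d40(P
  0x808132808(C 2(P 0x80ac40c20(P 0x21180c4(P 0x2111404(P 0x80a101d88(P 0x80aa48023(P 0x21190c0(P
  0x80a101c4a(P 0x2119880(C 7(P 0x80a303041(P 0x80a301c22(F[::(11,0)])))(D 9))))))))))(C 4(P
  0x80a308149(P 0x211a8a0(P 0x80ab08109(P 0x211a080(D 9)))))(D 6))))))))))))))(C 8(P 0x80a849440(P
  0x80ab30803(P 0x80aa008e8(P 0x2118880(P 0x80ab30460(P 0x8060518e8(P 0x2118082(P 0x2110c02(P
  0x80ab20061(P 0x2118d40(P 0x80a718089(P 0x2119040(C 2(P 0x80a308149(P 0x80a508109(F[::(9,0)])))(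
  D 6))))))))))))))(F[::(10,1);(9,0)])))))))))))(C 9(P 0x80a741020(P 0x8060494c7(P 0x80a9004c7(P
  0x8088228a0(P 0x808551100(P 0x8082228a0(P 0x2112401(P 0x80a740c20(P 0x808a28407(P 0x80a730920(P
  0x8065480e6(C 2(P 0x80a83802a(P 0x80a701949(F[::(2,0)])))(C 2(P 0x80ab38820(P 0x21180a3(P
  0x2111003(P 0x80a101967(P 0x80a940022(P 0x2118ca0(P 0x808101969(P 0x2119460(C 7(P 0x80a901862(P
  0x21128a0(D 7)))(D 8))))))))))(C 4(P 0x80a208128(P 0x211a480(P 0x80aa080e8(P 0x2119c60(D 8)))))(
  D 5)))))))))))))))(C 9(P 0x80a741020(P 0x80aa28402(P 0x8060494c7(P 0x2118460(P 0x80a9004c7(P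
  0x80a551040(P 0x2118061(P 0x2110801(P 0x80a818046(P 0x2118920(P 0x80a610068(P 0x2118c20(C 2(P
  0x80a208128(P 0x80a4080e8(F[::(8,0)])))(D 5))))))))))))))(F[::(0,9)])))))))))))))))))))(C 2(P
  0x80a4494c0(P 0x2118061(P 0x2110801(P 0x806300888(P 0x80a600924(P 0x2118c20(P 0x80a600d28(P
  0x806600d04(P 0x2118460(P 0x806031d24(C 5(P 0x80aa28022(P 0x80a951020(P 0x80a928027(P 0x2111d00(
  D 2)))))(D 4))))))))))))(C 3(P 0x80a8494c0(P 0x80a848c06(P 0x2118c20(P 0x2118061(P 0x2110c02(P
  0x808400ce5(P 0x80a600d28(P 0x80a710025(P 0x2118460(P 0x80a508047(C 12(P 0x80a701145(P
  0x80a301046(P 0x80603a145(P 0x80601a046(F[::(8,0)])))))(C 12(P 0x80aa284e0(P 0x80a701145(P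
  0x2112060(P 0x80aa480e1(P 0x2119cc0(P 0x80a0328a1(P 0x21180e6(P 0x2219cc0(P 0x80603a145(P
  0x21198e0(C 2(P 0x80a7408c0(P 0x2112401(P 0x2112120(F[::(0,10)]))))(D 5))))))))))))(C 16(P
  0x2118107(P 0x221a0e0(D 7)))(D 6))))))))))))))(F[::(2,7)])))))))))))))))))))))(F[::(1,0)])))))))
  )))))))(C 22(P 0x80a4280e2(P 0x2119c60(P 0x80a2380a4(P 0x806019046(P 0x806418046(P 0x21110a0(P
  0x8064180c2(P 0x21180e3(P 0x2219c60(C 7(P 0x80a63a080(P 0x80a718081(P 0x80a740805(P 0x8067404a0(
  P 0x21180a4(P 0x2111002(P 0x80a0220e6(P 0x2111840(P 0x80a8180a6(P 0x2119480(P 0x21190a0(P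
  0x80a120067(P 0x80a60a060(P 0x80a500907(P 0x80a301026(C 6(P 0x80a600924(F[::(7,0)]))(D 5))))))))
  )))))))))(C 13(P 0x80a029107(P 0x806141c05(P 0x8060290e3(P 0x8063404a0(P 0x21198a0(D 7))))))(C
  19(P 0x808121402(P 0x808029022(P 0x21198a0(P 0x21194c0(P 0x806029067(P 0x808121407(P 0x8060290e3
  (P 0x21180c5(P 0x22198a0(C 7(P 0x80a600923(P 0x806848c06(P 0x80a0220e3(P 0x2111802(P 0x806138c80
  (F[::(3,8)]))))))(C 7(P 0x80a8494c0(P 0x80a8200c1(P 0x80a70a480(P 0x2110c02(P 0x80a820045(P
  0x80a8484c0(P 0x80a600928(C 3(P 0x80a9508e0(P 0x2111003(F[::(0,1)])))(C 3(P 0x80a500d02(F[::(1,0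
  )]))(C 7(P 0x80a618125(P 0x808650900(D 5)))(D 6)))))))))))(C 7(P 0x80a9200e6(P 0x80a5484e0(D 6))
  )(C 7(P 0x80a9200e6(P 0x2119c60(D 6)))(D 3))))))))))))))(F[::(4,0)])))))))))))))(C 22(P
  0x806020c46(P 0x2119480(P 0x808029843(P 0x21190a0(P 0x21180a4(P 0x2219480(P 0x8063200c2(P
  0x806020cc2(C 8(P 0x80a4404c0(P 0x80a522060(P 0x80a031d04(P 0x80a8180c5(P 0x2111803(P
  0x80a50a060(P 0x80a3018a4(C 4(P 0x80a941c20(P 0x2118081(P 0x2111401(P 0x80a928027(P 0x2118480(P
  0x8069200e6(P 0x80a610088(C 8(P 0x80a900467(P 0x8083408a0(D 5)))(C 8(P 0x80a900467(P 0x8083408a0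
  (D 5)))(F[::(9,0);(8,1)]))))))))))(F[::(0,7)])))))))))(C 8(P 0x80a4404c0(P 0x80a522060(P
  0x806300825(P 0x80a031d04(P 0x2119840(P 0x80a8180c5(P 0x80a012025(P 0x21180c2(P 0x2219840(P
  0x21188c0(P 0x80a3018a4(C 4(P 0x80a501c24(P 0x8088488c0(D 6)))(F[::(4,1)])))))))))))))(C 8(P
  0x80a3404c0(P 0x80a3408c0(P 0x808021422(P 0x806530068(P 0x80a4018e3(P 0x8087404a0(P 0x2111804(P
  0x8060214e3(C 5(P 0x80a031d04(P 0x80a941cc0(D 4)))(C 12(P 0x21180c5(P 0x22198a0(D 6)))(D 5))))))
  )))))(C 8(P 0x80a3404c0(P 0x80a2010a1(P 0x80a129002(P 0x2119840(P 0x80a4018e3(P 0x8087404a0(P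
  0x21180c2(P 0x2219840(P 0x8062010e3(P 0x8064008e3(C 4(P 0x80a031d04(P 0x80a941cc0(D 4)))(C 7(P
  0x21180c5(P 0x22198a0(D 6)))(D 5)))))))))))))(D 5)))))))))))))(D 6))))))))))(C 16(P 0x80a3200c1(
  P 0x2119840(P 0x80a130083(P 0x806010c25(P 0x806310025(P 0x2110c80(P 0x8063100a1(P 0x21180c2(P
  0x2219840(C 13(P 0x2119480(P 0x808028462(P 0x21190a0(P 0x806020c46(P 0x21180a4(P 0x2219480(P
  0x808119006(P 0x806020cc2(C 6(P 0x80a441cc0(P 0x2111803(P 0x80a50a060(F[::(0,7)]))))(C 6(P
  0x80a4018e3(P 0x8087404a0(D 3)))(D 5)))))))))))(D 6)))))))))))(C 16(P 0x2118083(P 0x2219060(D 6)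
  ))(D 5))))))))))))))).

(** Forbidden graph number 3, cited by the literals that begin with [0x8c], is [c5_cap]. After four
    cuts have removed rows, a leaf is reached while [F] is still the given graph on seven vertices,
    placed on c_34, a_1, c_24, c_13, c_02, b_0 and c_01. The bulk of the tree refutes the wrong
    adjacencies at this leaf. *)
Definition c5_roof_ear_tree : tree :=
  P 0x808508c40(P 0x808021422(P 0x8c45180c1(P 0x8c0601061(P 0x8c0601062(P 0x2110861(P 0x8c0610c80(
  P 0x8c41208c5(P 0x8c0230083(P 0x2110c80(P 0x8082184a0(P 0x21198a1(P 0x8c03118a4(P 0x2111480(P
  0x2111483(P 0x8c04188c0(P 0x21194c1(P 0x8c03200c2(P 0x2111843(P 0x2111804(P 0x21184c5(P
  0x22198a1(C 1(P 0x80a411c20(P 0x80a009482(P 0x8c6608047(P 0x806320820(P 0x8ca0118a1(P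
  0x80a009483(P 0x80a009c44(P 0x80a231420(P 0x2111420(P 0x806220c20(P 0x8ca0190a1(P 0x8c62080c7(P
  0x8ca0208e1(P 0x806611020(P 0x2111c20(P 0x808611060(P 0x806611001(C 2(P 0x2118041(P 0x2218820(P
  0x806329820(P 0x2118820(D 1)))))(F[::(0,7)])))))))))))))))))))(C 3(P 0x80a509c60(P 0x80a0190a1(P
  0x8c6618047(P 0x806628460(P 0x8ca009483(P 0x80a019c25(P 0x80a611060(P 0x8ca0284e3(P 0x8ca0298e3(
  P 0x80a019046(P 0x806129860(P 0x8ca030883(P 0x8c62180c7(P 0x2111060(P 0x808231420(P 0x806231460(
  P 0x2111c60(P 0x806231403(C 3(P 0x2118081(P 0x2219020(P 0x806719420(P 0x2119020(D 1)))))(F[::(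
  0,7)]))))))))))))))))))))(C 4(P 0x80a138880(P 0x80a638c80(P 0x80a020ce1(P 0x806638404(P
  0x806638480(P 0x8ca009c64(P 0x80a020ce6(P 0x80a0208e1(P 0x8c67200c2(P 0x806139880(P 0x8ca031c64(
  P 0x8ca009c44(P 0x80a021427(P 0x8c66200e2(P 0x8ca0398a4(P 0x2111480(C 4(P 0x21180a1(P 0x2219420(
  P 0x806240c20(P 0x2119420(D 1)))))(F[::(0,5)]))))))))))))))))))(C 5(P 0x80a2384a0(P 0x80a0284e2(
  P 0x8c6728046(P 0x80a0298e3(P 0x8063388a0(P 0x8ca011c25(P 0x8ca019cc5(P 0x80a0284e3(P
  0x806238c05(P 0x806238ca0(P 0x8ca019c25(P 0x80a029047(P 0x8c62280e6(P 0x8ca038885(P 0x21110a0(C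
  4(P 0x21180c1(P 0x2219820(P 0x806340820(P 0x2119820(D 1)))))(F[::(0,6)])))))))))))))))))(L[::16;
  10;12;7;1;5;0](A(X 0x808129040)(A(X 0x808321420)(A(X 0x808629060)(A(X 0x808638c80)(A(X
  0x8083384a0)(A(P 0x80a240c01(P 0x8c0612060(P 0x80a741001(P 0x80a101102(P 0x806740801(P 0x2110c01
  (P 0x806740820(P 0x2111803(P 0x80a101107(P 0x806241c01(P 0x8ca13a080(P 0x2111001(P 0x80a100d02(P
  0x8c68004e3(P 0x2111480(P 0x80a1018e8(P 0x8c6700503(P 0x8ca141cc0(P 0x2111801(P 0x2112080(P
  0x21114c0(C 2(P 0x2118041(P 0x2218820(P 0x806349040(P 0x2118440(D 2)))))(F[::(1,6)])))))))))))))
  ))))))))))(A(P 0x80a741001(P 0x2110c01(P 0x2119840(P 0x80a839801(P 0x21188c0(P 0x80a740801(P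
  0x21180c2(P 0x2219840(P 0x80a100907(P 0x8c68004e3(P 0x8ca13a040(P 0x80a101107(P 0x80a1018e8(P
  0x8c6700503(P 0x8ca141cc0(P 0x808100905(C 2(P 0x2118041(P 0x2218820(D 2)))(D 1))))))))))))))))))
  (A(X 0x8083208c0)(A(X 0x808129060)(A(X 0x808221420)(A(X 0x808138880)(A(P 0x80a340801(P
  0x80a100903(P 0x806440c01(P 0x8c6800467(P 0x8ca11a040(P 0x2110801(P 0x80a101d04(P 0x2111840(P
  0x8c05220e0(P 0x80a100904(P 0x806341001(P 0x2111c01(P 0x806341020(P 0x2111c05(P 0x80a101468(P
  0x8c6300507(P 0x8ca140ca0(P 0x2111401(P 0x2112040(P 0x21118a0(C 2(P 0x2118041(P 0x2218820(P
  0x806448c40(P 0x2118440(D 2)))))(F[::(1,7)]))))))))))))))))))))))(A(P 0x80a340801(P 0x80a101103(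
  P 0x8c6800467(P 0x8ca11a080(P 0x2119480(P 0x21190a0(P 0x80a100903(P 0x2111c01(P 0x80a819401(P
  0x80a341001(P 0x21180a4(P 0x2219480(P 0x80a101468(P 0x8c6300507(P 0x8ca140ca0(P 0x808101106(C 2(
  P 0x2118041(P 0x2218820(D 2)))(D 1))))))))))))))))))(A(X 0x8082384a0)(A(X 0x8084284e0)(A(P
  0x80a231401(P 0x806638c01(P 0x808231c60(P 0x80a1014c2(P 0x8c6700468(P 0x8ca1118a0(P 0x2111401(P
  0x80a102046(P 0x8ca130900(P 0x8c08014c2(P 0x8ca131d00(P 0x80a101467(P 0x806231c01(P 0x8ca138ca0(
  P 0x8c63004e8(P 0x21110a0(P 0x8c0530900(P 0x2112005(P 0x806730820(P 0x806339801(P 0x806339820(P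
  0x2112001(C 2(P 0x2118041(P 0x2218820(P 0x806821840(P 0x2118440(D 2)))))(F[::(1,8)])))))))))))))
  )))))))))))(A(X 0x808231420)(A(P 0x80a329801(P 0x80a1018e3(P 0x806428c01(P 0x8c6700468(P
  0x8ca119cc0(P 0x2111801(P 0x21108c0(P 0x806519c01(P 0x808428ce0(P 0x8081018e4(P 0x8ca1214c0(P
  0x80a102065(P 0x8c63004e8(P 0x8ca128d00(P 0x8c0628d00(P 0x806719401(P 0x806719420(P 0x2112001(P
  0x2112006(P 0x806329020(C 2(P 0x2118041(P 0x2218820(P 0x806431c40(P 0x2118440(D 2)))))(F[::(1,8)
  ]))))))))))))))))))))))(A(X 0x808611060)(A(P 0x80a719401(P 0x80a1018e3(P 0x8c6700468(P
  0x8ca119cc0(P 0x21198a0(P 0x21194c0(P 0x808101482(P 0x80a101467(P 0x8c63004e8(P 0x8ca138ca0(P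
  0x808101844(P 0x2112001(P 0x80a339801(P 0x21180c5(P 0x22198a0(C 2(P 0x2118041(P 0x2218820(D 2)))
  (D 1)))))))))))))))))(A(P 0x80a231461(P 0x2118061(P 0x2218c20(P 0x8c6040823(P 0x2118c20(P
  0x806231420(P 0x8c6029823(P 0x80a019cc2(P 0x8c6039823(D 1))))))))))(A(X 0x8ca009482)(A(X
  0x8ca009482)(A(X 0x2111040)(A(X 0x8ca0284e2)(A(X 0x8ca0284e2)(A(P 0x80a231461(P 0x2110460(P
  0x2119840(P 0x8ca1118e3(P 0x21188c0(P 0x8ca130903(P 0x21180c2(P 0x2219840(P 0x8c4221cc0(P
  0x80a1194c2(P 0x8c6618440(P 0x8082010a7(P 0x80a612061(P 0x80a11a046(P 0x8c62184c0(P 0x8c40414c2(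
  P 0x80a231c61(P 0x80a119cc2(P 0x808119cc4(C 4(P 0x2118082(P 0x2219040(D 2)))(D 1))))))))))))))))
  )))))(A(X 0x80a129040)(A(X 0x80a129040)(A(X 0x80a0110a1)(A(X 0x80a509c40)(A(P 0x80a11a040(P
  0x80a231461(P 0x806610061(P 0x808441c01(P 0x8c0522040(P 0x8ca1100e3(P 0x8ca1118a3(P 0x2111402(P
  0x806011861(P 0x8ca130903(P 0x2111840(P 0x80a1194c2(P 0x8ca208ca0(P 0x80a012061(P 0x806610023(P
  0x80a11a046(P 0x21118e0(P 0x80a201c61(P 0x80a119c02(P 0x808119cc4(P 0x21118a0(C 2(P 0x2118082(P
  0x2219040(P 0x8c6048c44(P 0x2119040(P 0x80a022023(P 0x8c6030444(D 2)))))))(C 21(P 0x8ca720803(P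
  0x806141c02(P 0x80a410067(F[::(7,1)]))))(C 23(P 0x80a531040(P 0x80a308044(P 0x80a2004c5(P
  0x808201c65(P 0x2110c20(P 0x80a2024a6(P 0x2111c01(P 0x2110ce0(P 0x8ca229820(P 0x8ca231520(P
  0x8ca500886(P 0x8ca610125(P 0x8c0410026(P 0x8c0222020(P 0x8c04100e6(P 0x8c02220e0(C 19(P
  0x80a518500(P 0x80a712540(P 0x8060410a3(P 0x80a0518e2(P 0x8ca028c28(P 0x80a239540(P 0x80a8028a3(
  P 0x80a051047(P 0x80a23a00a(P 0x8ca03888a(P 0x2112808(C 11(P 0x80a149460(P 0x8c0b00d06(P
  0x8ca348560(P 0x80a019521(P 0x80a158068(P 0x80a302cc4(P 0x2112c03(P 0x8cab4a060(C 10(P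
  0x80a861ca0(P 0x80a200483(P 0x2110801(P 0x80a201464(P 0x8ca960ca0(P 0x80a40804a(P 0x8ca562120(P
  0x8cac28128(C 6(P 0x80ab39440(P 0x2112802(P 0x808400829(P 0x8ca438440(P 0x80ab20041(P
  0x80a520061(P 0x80a118085(C 2(P 0x80ac68460(P 0x2118169(P 0x2112c03(P 0x808800c2a(P 0x211ad20(P
  0x80a800c2d(P 0x8ca868460(P 0x8c4070569(P 0x8c4070969(C 6(P 0x806073424(F[::(13,0)]))(C 13(P
  0x80606a482(F[::(9,0)]))(F[::(12,1);(8,3)]))))))))))))(F[::(7,12)])))))))))(F[::(2,6)]))))))))))(
  F[::(5,2)]))))))))))(F[::(2,8)])))))))))))))(F[::(7,1)]))))))))))))))))))(C 23(P 0x80a8218a0(P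
  0x80a500504(P 0x211a4a0(P 0x8ca320801(P 0x8c4509120(P 0x2111c01(P 0x8ca320807(P 0x80a500888(P
  0x8c49118a0(P 0x8c04100a6(P 0x2119520(P 0x8c0410026(P 0x2118125(P 0x8c04100e6(C 16(P 0x80a518500
  (P 0x80a239940(P 0x8060410a3(P 0x80a710540(P 0x8ca028c28(P 0x80a8028a3(P 0x80a051047(P
  0x80a23a00a(P 0x2112808(C 9(P 0x808400523(P 0x80a620029(F[::(9,0)])))(C 9(P 0x2118107(P
  0x221a0e0(D 4)))(D 3))))))))))))(F[::(7,1)]))))))))))))))))(F[::(1,7)]))))))))))))))))))))))))))
  (A(P 0x80a11a040(P 0x80a231461(P 0x806610061(P 0x8ca101103(P 0x8c4410ca0(P 0x2119480(P
  0x8ca1100e3(P 0x806400861(P 0x21190a0(P 0x8084008c3(P 0x806201061(P 0x8ca1200e3(P 0x80a119402(P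
  0x8c6018485(P 0x80a022061(P 0x21180a4(P 0x2219480(P 0x80a11a046(P 0x80a401c61(P 0x80a119c02(P
  0x8c40418a4(P 0x8c6418405(P 0x80a119c04(C 2(P 0x2118082(P 0x2219040(D 2)))(D 1))))))))))))))))))
  )))))))(A(X 0x80a011c25)(A(X 0x80a129040)(A(X 0x80a129840)(A(X 0x80a0118a1)(A(P 0x80a1194c0(P
  0x80a231461(P 0x806230061(P 0x8ca1018e3(P 0x806030861(P 0x8ca1118e3(P 0x8c08214c0(P 0x8ca130103(
  P 0x8ca130903(P 0x21108c0(P 0x80a1194c2(P 0x80a602061(P 0x806230023(P 0x8c08018a4(P 0x80a11a046(
  P 0x8ca008ca6(P 0x80a119cc0(P 0x80a031c61(P 0x80a119cc2(P 0x2110900(P 0x2112006(P 0x808119cc4(C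
  9(P 0x8c432a0e0(P 0x8c070a4a0(P 0x8c6720860(P 0x2119c60(P 0x80a2200e1(P 0x8c63208e0(P 0x2118ce0(
  F[::(5,4)]))))))))(C 14(P 0x80a222460(P 0x80a1494c0(P 0x80a602121(P 0x8c062a460(P 0x2111803(P
  0x806019c82(P 0x80a031121(P 0x8ca3110c0(P 0x80a148c06(P 0x806019c44(P 0x2111d00(P 0x80a031c29(P
  0x8ca0484e6(P 0x2111cc0(C 3(P 0x80a941cc0(P 0x2118081(P 0x2111002(P 0x2119020(P 0x80a600909(P
  0x8c4432420(P 0x8ca64a040(P 0x8c4411c20(P 0x2118480(P 0x8c6128c80(P 0x8c403a881(P 0x80a601528(P
  0x8c6428c20(C 2(P 0x21180c4(P 0x2219880(D 4)))(D 3)))))))))))))))(C 3(P 0x80a14a040(P 0x21180e5(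
  P 0x2111c02(P 0x808201026(P 0x2119ca0(P 0x80a201029(P 0x21194e0(P 0x808328046(P 0x8c40504e5(P
  0x80a328048(C 11(P 0x80a349440(P 0x8ca910023(P 0x80a011523(P 0x80a358048(P 0x80a2004c4(P
  0x2112c01(C 8(P 0x8ca1200c3(P 0x80605a841(F[::(10,0)])))(C 13(P 0x8ca350041(P 0x806051023(F[::(
  4,0)])))(F[::(9,2);(3,0)])))))))))(F[::(1,8)]))))))))))))(F[::(3,8)])))))))))))))))))(F[::(2,0)])
  ))))))))))))))))))))))))(A(X 0x8080118a3)(A(P 0x80a119cc0(P 0x80a231461(P 0x806230061(P
  0x8ca1018e3(P 0x8c40188c5(P 0x806030861(P 0x21198a0(P 0x8ca1118e3(P 0x21194c0(P 0x8ca130103(P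
  0x8c4021cc5(P 0x808119402(P 0x8c6618405(P 0x80a602061(P 0x80a11a006(P 0x8c60184c5(P 0x80a031c61(
  P 0x80a119cc2(P 0x808119cc4(P 0x21180c5(P 0x22198a0(C 2(P 0x2118082(P 0x2219040(D 2)))(D 1))))))
  )))))))))))))))))(A(X 0x2110801)(A(X 0x2110801)(A(X 0x2111040)(A(X 0x80a419c20)(A(P 0x80a112080(
  P 0x80a429841(P 0x806520041(P 0x2110c22(P 0x2111003(P 0x806021441(P 0x2111460(P 0x80a022041(P
  0x806520022(P 0x80a208ca4(P 0x8ca008904(P 0x8ca410460(P 0x8c0301841(P 0x8ca221461(P 0x80a112085(
  P 0x8ca101102(P 0x8ca410465(P 0x2111480(P 0x806021422(P 0x8c0339841(P 0x8c03088c0(P 0x2112080(P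
  0x8c03088c5(P 0x21114c0(C 16(P 0x80a3110c0(P 0x80a13a120(P 0x806031462(P 0x80a049427(P
  0x806031443(P 0x80a709120(P 0x80a048ce1(P 0x8ca010ce6(P 0x8ca018886(P 0x80a139809(P 0x2112406(P
  0x8ca038489(C 11(P 0x80a139840(P 0x80a0118e1(P 0x80a150048(P 0x80a202883(P 0x8c0a00904(P
  0x8ca020ca2(P 0x2112802(P 0x8caa3a040(C 3(P 0x80a838c20(P 0x2112401(P 0x8ca238c20(P 0x80a101885(
  P 0x80a810023(P 0x80a308048(P 0x80a1024a4(C 11(P 0x80a938440(P 0x80a800827(P 0x211ad40(P
  0x80a8014e1(P 0x211a960(P 0x211816a(P 0x221ad40(P 0x8c402316a(C 9(P 0x80a730580(P 0x80a63ad80(P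
  0x80a312d80(P 0x80a0634e6(P 0x80a0604c7(P 0x80a062ce6(P 0x80a0620c7(P 0x80a218580(C 5(P
  0x80604ac44(F[::(11,0)]))(C 12(P 0x80605a883(F[::(10,0)]))(F[::(10,2);(9,3)])))))))))))(D 11)))))
  )))))(F[::(7,6)])))))))))(F[::(1,6)]))))))))))(F[::(1,6)]))))))))))))))(F[::(5,0)]))))))))))))))
  ))))))))))))(A(X 0x2111420)(A(X 0x80a321420)(A(X 0x80a100883)(A(X 0x8ca119040)(A(X 0x80a009c64)(
  A(X 0x8ca020ce1)(A(X 0x8ca308044)(A(X 0x8c01008c5)(A(X 0x80a321420)(A(P 0x80a208ca0(P
  0x80a429841(P 0x80a1118a0(P 0x806428041(P 0x2110c22(P 0x806029041(P 0x8c08398a0(P 0x80a502041(P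
  0x806428022(P 0x80a208ca4(P 0x8ca221461(P 0x80a112085(P 0x8ca0088c5(P 0x8ca010465(P 0x8ca128102(
  P 0x8ca129102(P 0x8ca410465(P 0x21110a0(P 0x2112005(P 0x8c0339841(P 0x806029022(P 0x2111100(P
  0x8c03088c5(C 7(P 0x80a21a4a0(P 0x80a14a0e0(P 0x80a03a121(P 0x2111404(P 0x806029862(P
  0x80a149407(P 0x80a701121(P 0x8ca010d25(P 0x8ca518880(P 0x806029843(P 0x80a148ce0(P 0x80a039829(
  P 0x8ca0484c7(P 0x21118e0(C 3(P 0x80a131c40(P 0x2112002(P 0x8ca832840(P 0x80a201464(P
  0x80a011cc1(P 0x80a14004a(P 0x80a202083(C 10(P 0x80a230460(P 0x80a700c26(P 0x211a920(P
  0x80a7010c1(P 0x211a540(P 0x2118149(P 0x221a920(P 0x8c4012d49(C 8(P 0x80a629d60(P 0x80a533160(P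
  0x80a412960(P 0x80a05b0c5(P 0x80a0584a6(P 0x80a05a8c5(P 0x80a059ca6(P 0x80a220560(C 10(P
  0x80a951460(P 0x80a920065(P 0x80a510088(P 0x80a300981(P 0x2113402(C 5(P 0x80604ac61(F[::(11,0)])
  )(C 12(P 0x80605a824(F[::(10,0)]))(F[::(10,3);(9,0)]))))))))(F[::(3,9)]))))))))))(D 10))))))))))(
  F[::(6,5)])))))))))(F[::(1,5)]))))))))))))))))(F[::(4,0)])))))))))))))))))))))))))(A(X 0x2111c20
  )(A(P 0x80a428c20(P 0x80a429841(P 0x2110c22(P 0x80a1018a4(P 0x80a102085(P 0x8c08214c0(P
  0x80a522001(P 0x806208085(P 0x2111801(P 0x806008885(P 0x21108c0(P 0x8ca1214c0(P 0x8ca221461(P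
  0x8062080a4(P 0x8ca129100(P 0x8ca129102(P 0x8c08018a4(P 0x8ca400465(P 0x2110820(P 0x80a008ca4(P
  0x8c0638c20(P 0x8060088a4(P 0x2110900(P 0x8c0339841(P 0x8c03080c5(C 3(P 0x80a531c60(P
  0x80a138c04(P 0x2111003(P 0x8ca038524(P 0x8060188a6(P 0x80a70a480(P 0x80a0218e1(P 0x8ca329880(P
  0x8060188c5(P 0x8ca031523(P 0x80a13a080(P 0x80a020827(C 1(P 0x80a120c40(P 0x2111402(P
  0x8ca522040(P 0x8ca2204a0(P 0x80a2014e6(P 0x80a010c81(P 0x80a128048(P 0x8c0500907(C 13(P
  0x80a520c20(P 0x80a510023(P 0x80a308045(P 0x80a102507(P 0x80a102ce8(P 0x2112401(P 0x8ca220c20(C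
  11(P 0x80a660440(P 0x8c4009d6a(P 0x80a302184(P 0x211a960(P 0x211816a(P 0x2112802(P 0x80a50082c(P
  0x8ca560440(C 9(P 0x80aa48580(P 0x80a952d80(P 0x80a062d49(P 0x80a06352a(P 0x80a218580(P
  0x80a21a180(P 0x80a062149(P 0x80a06052a(C 3(P 0x806049d83(F[::(7,0)]))(C 14(P 0x806072044(F[::(
  8,0)]))(F[::(7,2);(6,3)])))))))))))(D 11))))))))))(F[::(4,11)])))))))))(F[::(1,3)]))))))))))(F[::
  (1,3)]))))))))))))))(F[::(2,0)])))))))))))))))))))))))))))(A(X 0x80a100883)(A(X 0x8c02004a4)(A(X
  0x2110801)(A(X 0x2111040)(A(X 0x80a019cc5)(A(X 0x2110c02)(A(X 0x2111420)(A(X 0x80a3004a6)(A(X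
  0x8ca331420)(A(X 0x2110c01)(A(X 0x80a3004a6)(A(P 0x80a1220e6(P 0x806039824(P 0x806039881(P
  0x8c0201481(P 0x8ca131d04(P 0x8ca720446(P 0x80a408ce6(F[::(6,0)]))))))))(A(X 0x2111060)(A(X
  0x8ca618025)(A(X 0x80a629060)(A(P 0x80a730820(P 0x80a731481(P 0x2111022(P 0x8c08398a0(P
  0x2111461(P 0x80a1020e6(P 0x8064080c7(P 0x8ca131d00(P 0x8ca131d04(P 0x80a4088c7(P 0x8ca039841(P
  0x8060090e6(P 0x8ca439841(P 0x8064080e6(P 0x2111401(P 0x21110a0(P 0x8c05020e6(P 0x8ca700446(P
  0x2111020(P 0x2110900(P 0x8c0339841(P 0x80a008ce6(P 0x8ca031c61(P 0x2111100(P 0x8ca431c61(C 4(P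
  0x80a8398a0(P 0x80a131403(P 0x2111003(P 0x8060288e8(P 0x80a60a460(P 0x8ca03a125(P 0x806028907(P
  0x80a3010c1(P 0x8ca041cc5(P 0x8ca030443(P 0x8ca030523(P 0x80a018826(C 8(P 0x80a128c40(P
  0x80a201825(P 0x2111002(P 0x8ca429c40(P 0x8ca228480(P 0x80a0128a1(P 0x80a2024a1(P 0x80a848043(C
  2(P 0x80a239060(P 0x2111403(P 0x8ca038546(P 0x8c0301941(P 0x80a0310e1(P 0x80a230061(P
  0x80a301949(C 12(P 0x80a829020(P 0x80a818024(P 0x80a448066(P 0x80a10096a(P 0x80a718044(P
  0x2110801(P 0x8ca329020(C 10(P 0x80a968440(P 0x8c400a183(P 0x8c402a183(P 0x80a830061(P 0x2118d80
  (P 0x2118183(P 0x2110c02(P 0x80a60082d(P 0x8ca668440(C 4(P 0x806049c82(F[::(7,0)]))(C 12(P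
  0x806072823(F[::(10,0)]))(F[::(9,1);(6,2)]))))))))))))(F[::(5,12)])))))))))(F[::(2,4)])))))))))(
  F[::(2,6)]))))))))))(F[::(5,4)]))))))))))))))(F[::(4,0)])))))))))))))))))))))))))))(A(X
  0x2111c20)(A(X 0x80a3008c5)(A(X 0x2111c60)(A(X 0x8c02004a4)(A(X 0x2219040)(A(X 0x2119040)(A(X
  0x2119040)(A(X 0x2119040)(A(X 0x80a4004e6)(A(X 0x8c4030c82)(A(X 0x8c4409840)(A(X 0x2118880)(A(X
  0x2118880)(A(X 0x2118880)(A(X 0x8c4030c82)(A(X 0x80a0214c7)(A(X 0x2118880)(A(X 0x2118880)(A(X
  0x8c4039482)(A(X 0x8c4039482)(A(X 0x2118880)(A(X 0x2111402)(A(X 0x2111402)(A(X 0x21104a0)(A(X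
  0x80a3384a0)(A(X 0x80a5008e3)(A(X 0x80a5008e3)(A(X 0x80a3384a0)(A(P 0x80a440c20(P 0x80a4408c1(P
  0x8c0522040(P 0x80a441c01(P 0x80a101d04(P 0x806608088(P 0x2110801(P 0x2111402(P 0x2111820(P
  0x8ca122046(P 0x2111840(P 0x8ca1220e6(P 0x80a008d04(P 0x8ca122040(P 0x21118e0(P 0x80a101488(P
  0x806608104(P 0x8ca1410a0(P 0x2111401(P 0x8c0308048(P 0x8ca1410a6(P 0x8c0500904(P 0x8ca400468(P
  0x806009904(P 0x21118a0(P 0x21114c1(C 6(P 0x80a548ce0(P 0x80a119c04(P 0x8ca018504(P 0x8060388a9(
  P 0x2111c04(P 0x80a309880(P 0x80a020823(P 0x806038925(P 0x80a30a080(P 0x8ca0494c7(C 1(P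
  0x80a140c40(P 0x2111402(P 0x8ca541040(P 0x80a201546(P 0x80a010d01(P 0x80a128044(P 0x8c0201544(P
  0x8ca2404a0(C 10(P 0x80a920c20(P 0x80a910023(P 0x80a328046(P 0x80a101567(P 0x2111401(P
  0x8ca220c20(P 0x80a6100a3(C 17(P 0x80aa58440(P 0x8c4009d86(P 0x8c4021d86(P 0x80a50082b(P
  0x211b0c0(P 0x2118186(P 0x221b0c0(P 0x80a7280c1(P 0x2119980(C 9(P 0x80ab50860(P 0x80ac02541(P
  0x80a600c4a(P 0x2113007(C 5(P 0x806049d03(F[::(7,0)]))(C 13(P 0x80606b044(F[::(12,0)]))(F[::(
  11,2);(6,3)])))))))(F[::(5,9)])))))))))))(F[::(4,10)])))))))))(F[::(1,3)]))))))))))(F[::(1,7)])))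
  )))))))))(F[::(6,0)]))))))))))))))))))))))))))))(A(X 0x80a5008e3)(A(X 0x21118a0)(A(X 0x80a029067
  )(A(P 0x80a131d04(P 0x806041026(P 0x8060410c1(P 0x8ca122046(P 0x8c08014c2(P 0x80a608d04(P
  0x8ca430468(P 0x8ca1400a6(F[::(4,0)])))))))))(A(X 0x8c05008e1)(A(X 0x8ca038c85)(A(X 0x8ca328047)
  (A(X 0x21110a0)(A(X 0x2110c02)(A(X 0x21104a0)(A(P 0x80a4298e0(P 0x80a03a081(P 0x80a0398a4(P
  0x2111023(P 0x80a03a085(P 0x806121407(P 0x2111461(P 0x80a5220e0(P 0x8065204e0(P 0x808240c20(P
  0x8ca020467(P 0x8c0612081(P 0x8ca021467(P 0x8061214e0(P 0x8ca029107(P 0x2111481(P 0x2111824(P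
  0x808038ca2(P 0x80a428ce0(P 0x80a038c24(P 0x21114c1(C 10(P 0x8c6049428(P 0x211a020(P 0x2118101(P
  0x221a020(P 0x8c6020828(P 0x80a041045(D 1)))))))(C 21(P 0x80a33a020(P 0x80a1008e3(P 0x8ca019d01(
  P 0x80a102467(P 0x8ca138d20(P 0x8c09008e3(P 0x8ca300507(P 0x80a510028(P 0x8ca540402(P 0x2111440(
  P 0x2111802(P 0x21114c0(P 0x8c0808047(P 0x8c0141040(P 0x8c0222020(P 0x8c08080c7(P 0x8c01410c0(C
  17(P 0x80a9104e0(P 0x80a819940(P 0x806039849(P 0x80a818540(P 0x80a051868(P 0x806039922(P
  0x80a819540(P 0x80a051103(P 0x8ca048827(P 0x80a341c0a(P 0x2112807(P 0x8ca040caa(C 11(P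
  0x80a141c80(P 0x80a021d01(P 0x80a158089(P 0x80a402d43(P 0x8ca440560(P 0x8c0402d49(P 0x2112c04(P
  0x8cab42480(C 7(P 0x80a662c80(P 0x80a2004a3(P 0x2110801(P 0x80a201065(P 0x80a508049(P
  0x8ca461940(P 0x8cac20146(P 0x8caa60c80(C 11(P 0x80aa41840(P 0x80a3008c8(P 0x211b160(P
  0x808400827(P 0x211ad80(P 0x211818b(P 0x221b160(P 0x8c400b58b(P 0x8c403158b(C 3(P 0x80ab51c60(P
  0x2113009(P 0x80ab48061(P 0x80a748081(P 0x80a3025a6(C 5(P 0x806053044(F[::(12,0)]))(C 11(P
  0x806062c81(F[::(11,0)]))(F[::(11,0);(10,3)]))))))))(F[::(3,9)])))))))))))(F[::(8,7)]))))))))))(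
  F[::(7,2)]))))))))))(F[::(3,7)]))))))))))))))(F[::(6,2)])))))))))))))))))))(C 21(P 0x80a441c60(P
  0x80a300504(P 0x211a460(P 0x8c4039523(P 0x8c0808067(P 0x80a300888(P 0x8ca540402(P 0x8c4312120(P
  0x2111802(P 0x8ca540406(P 0x2118123(P 0x2118d20(P 0x8c0808047(P 0x8c08080c7(C 15(P 0x80a9104e0(P
  0x80a341140(P 0x806039849(P 0x80a818540(P 0x80a051868(P 0x806039922(P 0x8ca048827(P 0x80a341c0a(
  P 0x2112807(P 0x8ca040c2a(C 6(P 0x808300504(P 0x80aa18028(F[::(8,0)])))(C 6(P 0x2118125(P
  0x221a4a0(D 3)))(D 2)))))))))))))(F[::(6,2)]))))))))))))))))(C 23(P 0x8ca640405(P 0x806221801(P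
  0x80a8080a6(F[::(6,2)]))))(F[::(0,3)]))))))))))))))))))))))))))(A(X 0x8c0509c60)(A(P 0x8ca5100e3
  (P 0x8c0409840(P 0x80a012065(P 0x806119402(P 0x806119440(P 0x8ca028d02(P 0x80a201c65(F[::(5,1)])
  )))))))(A(P 0x80a240ca0(P 0x80a241c01(P 0x80a2410a0(P 0x80a501d02(P 0x2110c20(P 0x806101448(P
  0x8ca012085(P 0x2111461(P 0x8c0612081(P 0x80a028d02(P 0x2111020(P 0x2111c05(P 0x2111481(P
  0x2111824(P 0x80a009848(P 0x806500502(P 0x8ca0408c1(P 0x8ca0408c5(P 0x8ca2280e8(P 0x8ca8004c2(P
  0x2111401(P 0x2111820(P 0x8c0101d04(P 0x806101502(P 0x21118a0(P 0x21114c1(C 12(P 0x80a3490c0(P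
  0x80a510500(P 0x806030469(P 0x80a511d00(P 0x80a040445(P 0x80a229808(P 0x8ca028888(P 0x2112006(P
  0x806030523(P 0x8ca048ce6(P 0x80a511100(C 8(P 0x80a138860(P 0x80a302544(P 0x80a0188e1(P
  0x80a148066(P 0x2112403(P 0x8ca939860(P 0x8ca338520(P 0x8c0302546(C 4(P 0x80a819020(P 0x2111c01(
  P 0x8ca219020(P 0x80a810024(P 0x80a408048(P 0x80a101965(P 0x80aa100e4(C 18(P 0x80a938440(P
  0x80a400827(P 0x211b100(P 0x8c400ad88(P 0x8c402ad88(P 0x80ab20101(P 0x211a180(P 0x2118188(P
  0x221b100(C 2(P 0x80aa58860(P 0x2112408(P 0x80a500c4b(P 0x80a801d61(C 6(P 0x80604ac44(F[::(11,0)
  ]))(C 11(P 0x806059883(F[::(6,0)]))(F[::(10,2);(5,3)])))))))(F[::(4,10)])))))))))))(F[::(3,6)])))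
  ))))))(F[::(1,2)]))))))))))(F[::(2,6)])))))))))))))(F[::(5,1)]))))))))))))))))))))))))))))(A(X
  0x8083008c1)(A(X 0x2111060)(A(X 0x21118a0)(A(P 0x80a530900(P 0x80a0408c1(P 0x80a609100(P
  0x80a041cc1(P 0x80a531d00(P 0x80a041cc5(P 0x2111461(P 0x80a0410a6(P 0x2111823(P 0x808309840(P
  0x80a628d00(P 0x80a0408c5(P 0x808408ce2(P 0x2111481(P 0x80a040ca6(P 0x2111824(P 0x806530500(P
  0x8ca0098e8(P 0x806131500(P 0x8ca029848(P 0x8ca030468(P 0x8ca031468(P 0x21114c1(C 16(P
  0x80a411c60(P 0x80a301444(P 0x8c45190c0(P 0x8ca0208e3(P 0x8c6648405(P 0x21198a0(P 0x806031c29(P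
  0x80a221803(P 0x8c60484c5(P 0x21194c0(P 0x21180c5(P 0x22198a0(P 0x80a302082(P 0x806031d21(C 10(P
  0x2118142(P 0x221a840(D 2)))(D 1))))))))))))))))(C 24(P 0x8c4020ce6(P 0x808229803(P 0x8c66484e0(
  P 0x21198e0(P 0x808511100(P 0x8c402a0e6(P 0x808221803(P 0x8c67484c0(P 0x2119cc0(P 0x80a1480e2(P
  0x8c0711120(P 0x21180e6(P 0x2219cc0(C 11(P 0x2118142(P 0x221a840(D 2)))(D 1)))))))))))))))(F[::(
  5,1)]))))))))))))))))))))))))))(A(P 0x8c0811820(P 0x808231c60(P 0x8c0612061(P 0x2110c20(P
  0x2111023(P 0x8c08398a0(P 0x2111461(P 0x8c0240026(P 0x8c08004c2(P 0x8c0612081(P 0x808008ce2(P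
  0x808028ce2(P 0x2111020(P 0x8c08118a0(P 0x808408ce2(P 0x2111401(P 0x21110a0(P 0x2111481(P
  0x8c01020e6(P 0x8c0131d00(P 0x2112001(P 0x8c0608102(P 0x2111100(P 0x2112081(P 0x21118a0(P
  0x21114c1(C 18(P 0x80a3398a0(P 0x80a801441(P 0x80a042422(P 0x80a5020e3(P 0x80a20a500(P
  0x806608808(P 0x80a041c41(P 0x8ca019c45(P 0x80a02a467(P 0x8ca038d25(P 0x8ca328107(P 0x80a111408(
  P 0x80a131408(P 0x2112005(P 0x8ca030528(P 0x80a111100(P 0x8c05020e2(P 0x8c05020e6(C 17(P
  0x80a1494e0(P 0x80a341140(P 0x806038829(P 0x80a342540(P 0x80a050868(P 0x806038921(P 0x80a819540(
  P 0x80a051103(P 0x8ca0484c7(P 0x80a341c0a(P 0x2112807(P 0x8ca040caa(C 11(P 0x80a140c80(P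
  0x80a402d42(P 0x80a020d01(P 0x80a158089(P 0x8ca440560(P 0x8c0402d49(P 0x2112c04(P 0x8cab42480(C
  4(P 0x80a921420(P 0x2112801(P 0x8ca221420(P 0x8082004a6(P 0x80a910025(P 0x80a508049(P
  0x80a650103(C 11(P 0x80aa40440(P 0x80a500828(P 0x211b160(P 0x808500827(P 0x211ad80(P 0x211818b(P
  0x221b160(P 0x8c400b58b(P 0x8c403358b(C 3(P 0x80a8734a0(P 0x80a600c4a(P 0x2111003(P 0x80a901541(
  P 0x8ca572180(P 0x8cae28188(P 0x8cac728a0(C 6(P 0x806053044(F[::(12,0)]))(C 11(P 0x806061c83(
  F[::(7,0)]))(F[::(11,2);(6,3)]))))))))))(F[::(5,9)])))))))))))(F[::(4,7)])))))))))(F[::(1,3)]))))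
  ))))))(F[::(3,7)]))))))))))))))(F[::(6,2)]))))))))))))))))))))(C 18(P 0x80a1020e3(P 0x8ca519d00(
  P 0x8061014e3(P 0x8ca038d25(P 0x8c08208a0(F[::(5,1)]))))))(C 18(P 0x8ca618104(P 0x8ca320820(P
  0x80a01a486(P 0x806221803(P 0x80a302086(F[::(6,2)]))))))(C 21(P 0x80a448ce0(P 0x80a700524(P
  0x8c4808ce0(P 0x2111401(P 0x211a0e0(P 0x2119d00(P 0x2118107(P 0x80a038889(P 0x8c4012507(C 7(P
  0x80a941cc0(P 0x80a401862(P 0x80a400443(P 0x80a219804(P 0x80a239804(P 0x21180c1(P 0x2111805(P
  0x2119820(P 0x8c462a020(P 0x80a312880(P 0x80a601109(P 0x806710c04(P 0x8c4622420(P 0x8ca418820(P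
  0x8c40428c1(P 0x8ca6424a0(P 0x806311c04(C 11(P 0x80a802ca1(P 0x80a621c40(P 0x80a202cc4(P
  0x8ca809560(D 10)))))(F[::(7,3)])))))))))))))))))))(C 10(P 0x80a111ca0(P 0x80a501822(P
  0x8c4910101(P 0x8ca008945(P 0x8ca2280c1(P 0x80a209805(P 0x2112005(P 0x80a1128a0(P 0x808601524(P
  0x80a028c41(P 0x80a029c41(P 0x8c0801544(P 0x8ca050828(C 11(P 0x80a742540(P 0x80a050864(P
  0x80a052ce1(P 0x80a052c64(P 0x80a052c68(P 0x80641a00a(P 0x80a838940(P 0x80a418940(P 0x808050865(
  P 0x806438540(P 0x8ca009c4a(P 0x806139140(P 0x8ca020c4a(P 0x80641a140(P 0x8ca040c4a(P
  0x80a709940(P 0x808051825(P 0x80a0508e1(P 0x80a051827(P 0x80a050868(C 3(P 0x80a241480(P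
  0x2112807(P 0x80a021502(P 0x80a022502(P 0x80a238083(P 0x80a401d61(C 12(P 0x80a931420(P
  0x80a918025(P 0x80a520068(P 0x80a101182(P 0x80a64a801(P 0x2113404(C 11(P 0x80aa58440(P
  0x80aa38041(P 0x80a638081(P 0x80a1200e6(P 0x80a2015a3(P 0x2113805(C 6(P 0x8060530c1(F[::(12,0)])
  )(C 14(P 0x806062c23(F[::(11,0)]))(F[::(11,2);(10,0)])))))))))(F[::(6,10)]))))))))(F[::(9,5)]))))
  ))))(F[::(3,7)]))))))))))))))))))))))(C 11(P 0x80a742540(P 0x80aa004e4(P 0x80a302925(P
  0x80643a00a(P 0x80a559c20(P 0x80aa00c87(P 0x8ca049563(P 0x8ca518029(P 0x2110c01(P 0x80a83840a(P
  0x80a43840a(P 0x8ca059521(P 0x80a838940(P 0x8c0300528(C 11(P 0x80ab09120(P 0x2110c02(P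
  0x80a0120a4(P 0x80a900d61(P 0x8ca0214e2(P 0x80a200c85(P 0x8ca958440(P 0x80a522402(P 0x8ca329c40(
  P 0x8ca05148c(C 9(P 0x80a1524c0(P 0x80a032541(P 0x80a601182(P 0x80a1180c5(P 0x2113404(C 3(P
  0x80ab51c20(P 0x2113009(P 0x80ab30024(P 0x80a730044(P 0x80a1025a3(C 6(P 0x8060530c2(F[::(12,0)])
  )(C 12(P 0x806062c41(F[::(11,0)]))(F[::(11,0);(10,1)]))))))))(F[::(1,9)])))))))(F[::(5,9)])))))))
  )))))(F[::(8,4)]))))))))))))))))(C 11(P 0x80a742540(P 0x80a55a804(P 0x80a402965(P 0x80613a00a(P
  0x80a838940(P 0x80a558c80(P 0x2112804(P 0x80613a140(P 0x80aa010e1(P 0x8ca059524(P 0x8ca52014b(P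
  0x8c0402967(P 0x80a818940(P 0x80aa01068(C 3(P 0x80a242480(P 0x2112807(P 0x80a022502(P
  0x80a401d61(P 0x80a238083(C 9(P 0x80a951420(P 0x80a918025(P 0x80a520068(P 0x80a101182(P
  0x2113404(C 11(P 0x80a863460(P 0x80ab00827(P 0x80a500ce9(P 0x8ca3621c0(P 0x8cac181c8(P 0x2110c02
  (P 0x8cae61c60(C 5(P 0x8060530c2(F[::(12,0)]))(C 12(P 0x806062c43(F[::(11,0)]))(F[::(11,2);(10,1)
  ]))))))))))(F[::(10,6)])))))))(F[::(2,9)])))))))(F[::(3,7)]))))))))))))))))(C 11(P 0x80a70a540(P
  0x80aa02064(P 0x80a802965(P 0x80643840a(P 0x80a138940(P 0x80a418940(P 0x2112808(P 0x806139140(P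
  0x80aa020e1(P 0x8ca059528(P 0x8ca54014b(P 0x8c0802967(C 3(P 0x80a241480(P 0x2112807(P
  0x80a401d61(P 0x80a021502(P 0x80a238083(C 10(P 0x80a931420(P 0x80a918025(P 0x80a520068(P
  0x80a101182(P 0x2113404(C 10(P 0x80a863460(P 0x80a70082b(P 0x80a500d69(P 0x8ca3621c0(P
  0x8cac181c8(P 0x2110c02(P 0x8cae62c60(C 5(P 0x8060520c2(F[::(8,0)]))(C 12(P 0x806042c43(F[::(
  11,0)]))(F[::(10,1);(7,2)]))))))))))(F[::(6,10)])))))))(F[::(2,5)])))))))(F[::(3,7)])))))))))))))
  )(C 11(P 0x80a402965(P 0x8ca82ad40(P 0x806402165(P 0x8ca059528(P 0x8c0a10d00(F[::(8,4)]))))))(D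
  9)))))))))))))))))))(C 26(P 0x80a929cc0(P 0x8c4009546(P 0x808219804(P 0x808239804(P 0x8c4641540(
  P 0x8c0a10500(P 0x2112006(P 0x80a030ca9(P 0x808310520(P 0x8c401a546(P 0x808710520(P 0x808209804(
  P 0x2119940(P 0x2118146(C 12(P 0x808800941(P 0x80a621c40(P 0x80a202cc4(P 0x8c0b2a500(D 10)))))(C
  17(P 0x8c4018528(P 0x808621c20(P 0x808558104(P 0x8ca050868(D 10)))))(F[::(7,3)])))))))))))))))))
  (F[::(5,1)])))))))))))))(C 29(P 0x80a8218a0(P 0x80a501d04(P 0x808111403(P 0x808131403(P
  0x211a4a0(P 0x8088380a1(P 0x8c4539120(P 0x8c09088e0(P 0x80a028888(P 0x808111100(P 0x8c4012125(P
  0x808131100(P 0x2119520(P 0x2118125(P 0x221a4a0(C 15(P 0x80a819940(P 0x80a051103(P 0x8c4918145(P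
  0x808039824(P 0x80a340540(P 0x8c0a01d01(P 0x80a050868(P 0x8c0a01d04(P 0x808039521(P 0x8c0a220e0(
  P 0x80a341c0a(P 0x8c0740540(P 0x2112807(P 0x8ca040caa(P 0x8ca3500e8(C 2(P 0x80a201883(P
  0x80a141c40(F[::(3,6)])))(C 3(P 0x808301945(P 0x211a440(D 10)))(F[::(9,1);(5,6)])))))))))))))))))
  )(C 20(P 0x808928c40(P 0x8c4918145(P 0x8c4028507(P 0x808219820(P 0x808331c04(P 0x8c4029107(P
  0x808311c04(P 0x2119d00(P 0x8c4010507(P 0x808519820(P 0x8084500e3(P 0x211a0e0(P 0x8c0818940(P
  0x8c4750d00(P 0x2118107(P 0x221a0e0(C 1(P 0x80a00ac64(P 0x8c670804b(D 10)))(C 9(P 0x2118161(P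
  0x221ac20(D 1)))(D 0)))))))))))))))))))(F[::(6,2)]))))))))))))))))))(F[::(4,3)])))))))))))))))))
  )))))))))))))))(A(X 0x8c05008e1)(A(P 0x8c4708103(P 0x8c0602061(P 0x8c0612061(P 0x808031c64(P
  0x2111023(P 0x8c08018a3(P 0x2111461(P 0x8c08214c0(P 0x8c04400c1(P 0x21108c0(P 0x808408ce0(P
  0x808428ce0(P 0x8c0602081(P 0x8c0612081(P 0x808408ce2(P 0x8c08018a4(P 0x2111481(P 0x8c08194c0(P
  0x2111824(P 0x8c0608d00(P 0x8c0628d00(P 0x8c0608d02(P 0x2110900(P 0x2112006(P 0x21114c1(C 5(P
  0x80a531c60(P 0x80a400ce1(P 0x80a01a4a2(P 0x80a138c04(P 0x2111003(P 0x806628860(P 0x806229860(P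
  0x8ca038524(P 0x8ca120067(P 0x80a301045(P 0x80a70a480(P 0x80a0208e1(P 0x8ca328880(P 0x8ca518082(
  P 0x8ca329880(P 0x80a01a4a6(P 0x8ca011523(P 0x80a13a080(P 0x8c0400ce2(P 0x806628803(P
  0x8c0400ce6(P 0x806229803(C 18(P 0x80a4094e0(P 0x80a342540(P 0x806039881(P 0x80a051868(P
  0x806039824(P 0x80a819540(P 0x80a051103(P 0x8ca009107(P 0x80a050903(P 0x8ca0204a7(P 0x80a341c0a(
  P 0x2112807(P 0x8ca040caa(C 12(P 0x80a141c80(P 0x80a021d01(P 0x80a158089(P 0x80a402ca2(P
  0x8c0b01125(P 0x8ca0288c4(P 0x2112c04(P 0x8cab42480(C 4(P 0x80a941420(P 0x2112801(P 0x8ca241420(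
  P 0x80a101c66(P 0x80a910025(P 0x80a508049(P 0x8c0a00584(C 12(P 0x80a569c80(P 0x80a4009a5(P
  0x8c403a18b(P 0x211b160(P 0x211ad80(P 0x211818b(P 0x221b160(P 0x8c400b58b(P 0x8c403358b(C 10(P
  0x80a8285a0(P 0x80a5431a0(P 0x80a3131a0(P 0x80a06b905(P 0x80a0684a8(P 0x80a06b105(P 0x80a06a4a8(
  P 0x80a2185a0(C 6(P 0x806053044(F[::(12,0)]))(C 13(P 0x806062c83(F[::(11,0)]))(F[::(11,2);(10,3)]
  )))))))))))(D 12)))))))))))(F[::(8,7)])))))))))(F[::(1,7)]))))))))))(F[::(3,7)])))))))))))))))(
  F[::(6,2)]))))))))))))))))))))))))(C 12(P 0x8c4808089(P 0x808148c02(P 0x8c070a480(P 0x8c43204e0(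
  P 0x808228061(P 0x2119c60(P 0x808628061(P 0x2118ce0(P 0x21180e3(P 0x2219c60(P 0x808301448(P
  0x8c432a0e0(P 0x8c070a4a0(P 0x808220061(P 0x808620061(P 0x8083014c8(P 0x808148c06(P 0x808501101(
  P 0x8c40488e3(P 0x8c40498e3(C 20(P 0x80a341140(P 0x80aa00503(P 0x8c4918145(P 0x808700482(P
  0x80a342540(P 0x80a051868(P 0x8c0a00502(P 0x808039522(P 0x808700489(P 0x80a340940(P 0x80a051103(
  P 0x2111c01(P 0x8c0a120e0(P 0x8c0102928(P 0x80a341c0a(P 0x8c0740940(P 0x2112807(P 0x8ca040caa(P
  0x8ca350028(C 16(P 0x2118165(P 0x221aca0(D 5)))(D 4)))))))))))))))))))))(C 26(P 0x80a4094e0(P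
  0x80a702881(P 0x8c4908145(P 0x80a4098e0(P 0x808331c02(P 0x8c4031107(P 0x2119d00(P 0x808619520(P
  0x808329c02(P 0x808328480(P 0x8084500e3(P 0x211a0e0(P 0x8082500e3(P 0x8c4750500(P 0x8c0819540(P
  0x2118107(P 0x221a0e0(C 8(P 0x80a052447(P 0x8c62500a9(P 0x80a051845(D 5))))(C 8(P 0x2118149(P
  0x221a920(D 10)))(D 9))))))))))))))))))))(F[::(6,2)])))))))))))))))))))))))(C 16(P 0x8ca618104(P
  0x8ca3208a0(P 0x80a01a486(P 0x806221803(P 0x806221860(P 0x8ca031123(P 0x80a302086(F[::(6,2)]))))
  ))))(C 21(P 0x806201829(P 0x2111803(P 0x80a148c06(P 0x8c03490c0(P 0x806201921(P 0x8ca0484e6(P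
  0x2111cc0(F[::(6,2)]))))))))(C 29(P 0x80a441c60(P 0x80a019d04(P 0x80813a080(P 0x808510061(P
  0x211a460(P 0x808530061(P 0x8c4039123(P 0x80a300888(P 0x8c4312120(P 0x8c0909c40(P 0x808138c05(P
  0x808410061(P 0x808430061(P 0x8c0909cc0(P 0x2111802(P 0x2118123(P 0x2118d20(C 4(P 0x80a201027(P
  0x806309c02(F[::(7,3)])))(C 18(P 0x80a409cc0(P 0x80a602081(P 0x8c4640540(P 0x211a8c0(P
  0x8c4018946(P 0x2119940(P 0x2118146(P 0x221a8c0(C 9(P 0x8c0432c60(P 0x8c0158880(P 0x2110c01(P
  0x8083028c2(P 0x2112420(P 0x8081028c2(P 0x2112460(P 0x8c0432c20(P 0x8083004e2(P 0x2112540(P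
  0x2112004(P 0x2112480(P 0x2112500(C 4(P 0x80a700cca(P 0x80ab09860(F[::(10,1)])))(C 4(P
  0x8c0360820(P 0x8c462006c(P 0x2112801(P 0x8c0123060(P 0x8c0113060(P 0x808700cc2(P 0x2111420(P
  0x2112420(P 0x8c0100d84(P 0x2111540(P 0x2112540(C 9(P 0x8c0369020(P 0x8c01434a0(P 0x8c03690c0(P
  0x808303104(P 0x2113003(P 0x2110820(P 0x2111801(P 0x21108c0(P 0x2112801(P 0x2110940(P 0x2112806(
  P 0x2112c20(P 0x2112cc0(P 0x2112d40(C 10(P 0x80a50288c(P 0x80a41a0a0(F[::(12,3)])))(F[::(12,3);(
  8,9)]))))))))))))))))(D 6)))))))))))))(D 6))))))))))))))))(D 4))))))))))(F[::(5,0)])))))))))))))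
  )))))))(F[::(2,0)])))))))))))))))))))))))))))))))(A(X 0x2111c60)(A(X 0x21110a0)(A(X 0x2219420)(A
  (P 0x80a4298e0(P 0x80a03a081(P 0x80a0398a4(P 0x8c6138046(P 0x2119841(P 0x80a03a085(P 0x80a1120e0
  (P 0x21188c1(P 0x21184c2(P 0x2219841(P 0x8065204e0(P 0x8ca008907(P 0x8c4221cc1(P 0x8ca010467(P
  0x8061214e0(P 0x808208ca0(P 0x8062090e0(P 0x8ca020467(P 0x8c41414c2(P 0x8c6238026(P 0x80a038c22(
  P 0x80a208ce0(P 0x80a038c24(C 6(P 0x2118101(P 0x221a020(D 1)))(D 0)))))))))))))))))))))))))(A(X
  0x8c41198a0)(A(X 0x2119420)(A(X 0x808100c86)(A(X 0x2119420)(A(X 0x2119420)(A(X 0x21184a0)(A(P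
  0x80a530900(P 0x80a041cc1(P 0x80a609100(P 0x2119841(P 0x80a131d00(P 0x80a041cc5(P 0x80a0410a6(P
  0x8c61400c2(P 0x21188c1(P 0x21184c2(P 0x2219841(P 0x8c4221cc1(P 0x80a608d00(P 0x80a0408c5(P
  0x8c6640022(P 0x80a040c26(P 0x806530500(P 0x8ca0098e8(P 0x8c41414c2(P 0x806131500(P 0x8ca0298e8(
  P 0x8ca030468(C 12(P 0x2118121(P 0x221a420(D 1)))(D 0))))))))))))))))))))))))(A(X 0x8c40390a1)(A
  (X 0x2119420)(A(X 0x21184a0)(A(X 0x21184a0)(A(X 0x21184a0)(A(P 0x80a4298e1(P 0x8c6030827(P
  0x2119c20(P 0x806811820(P 0x8c6040827(P 0x21180e1(P 0x2219c20(P 0x8c6019427(P 0x806329820(D 1)))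
  )))))))(A(X 0x8ca019046)(A(X 0x8ca019046)(A(X 0x8ca020ce6)(A(X 0x8ca020ce6)(A(P 0x80a4298e1(P
  0x8c4410ca0(P 0x80a1398a4(P 0x8c6538480(P 0x2119480(P 0x80a13a085(P 0x8c64384a0(P 0x21190a0(P
  0x8084008c3(P 0x80a5220e1(P 0x21104e0(P 0x8ca121467(P 0x8ca129107(P 0x21180a4(P 0x2219480(P
  0x808138ca2(P 0x8c40418a4(P 0x80a428ce1(P 0x80a138ca4(C 10(P 0x2118102(P 0x221a040(D 2)))(D 1)))
  ))))))))))))))))))(A(X 0x21114c0)(A(X 0x80a3208c0)(A(P 0x80a1398a0(P 0x80a4298e1(P 0x80a1398a4(P
  0x80a5020e1(P 0x80a13a085(P 0x8ca009cc5(P 0x806428027(P 0x8c08014c2(P 0x8064280e1(P 0x8ca101467(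
  P 0x8060290e1(P 0x8ca121467(P 0x8c08118a0(P 0x8ca128107(P 0x8ca129107(P 0x21110a0(P 0x2112005(P
  0x808138ca2(P 0x80a138ca0(P 0x80a028ce1(P 0x80a138ca4(P 0x2111100(C 7(P 0x80a2424a0(P
  0x80a03a121(P 0x2111404(P 0x806029848(P 0x808149402(P 0x80a149407(P 0x80a148ce0(P 0x80a701121(P
  0x8c071a4a0(P 0x806029902(P 0x21118a0(P 0x8ca70a480(P 0x80a039829(P 0x8ca0484c7(P 0x21118e0(C 10
  (P 0x8c6050869(P 0x211a460(P 0x2118123(P 0x221a460(P 0x8c6028469(D 3))))))(C 18(P 0x80a442460(P
  0x80a300504(P 0x80a302888(P 0x8ca341140(P 0x8c0a00504(P 0x8ca400d28(P 0x80a608069(P 0x8ca648c01(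
  P 0x2111820(P 0x2111c01(P 0x8ca248c07(P 0x21118e0(P 0x8c09180e8(P 0x8c03494e0(C 6(P 0x80a55a880(
  P 0x80a301c41(P 0x2111c03(P 0x80a301022(P 0x80aa20068(P 0x8ca459520(P 0x8cab20125(P 0x8ca958480(
  C 10(P 0x80a33a480(P 0x80a402067(P 0x211ad40(P 0x808201026(P 0x211a960(P 0x211816a(P 0x221ad40(P
  0x8c400b16a(P 0x8c401956a(C 3(P 0x80a44a8a0(P 0x2112c08(P 0x80a042921(P 0x80a4400a1(P
  0x80a502186(C 9(P 0x80aa59820(P 0x80aa18024(P 0x80a6180a4(P 0x80a1009a7(P 0x2113802(C 5(P
  0x806053061(F[::(12,0)]))(C 11(P 0x806062c22(F[::(11,0)]))(F[::(11,1);(10,0)]))))))))(F[::(4,10)]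
  )))))))(F[::(4,8)])))))))))))(F[::(7,6)]))))))))))(F[::(6,0)]))))))))))))))))(C 18(P 0x80a54a080
  (P 0x80a400d25(P 0x211a880(P 0x8c4040944(P 0x8c0918088(P 0x80a608069(P 0x8ca648c01(P 0x8ca248c07
  (P 0x8ca648c07(P 0x2118144(P 0x2112807(P 0x2119140(P 0x8c09180e8(C 6(P 0x808400d02(P 0x80aa20068
  (F[::(8,0)])))(C 6(P 0x2118125(P 0x221a4a0(D 4)))(D 3))))))))))))))))(F[::(2,7)]))))))))))))))))
  )))(C 18(P 0x8c45190c0(P 0x8c060a460(P 0x8c66408a0(P 0x21198a0(P 0x8c65408c0(P 0x21194c0(P
  0x80a2400c1(F[::(3,8)]))))))))(F[::(4,0)])))))))))))))))))))))))))(A(X 0x808030881)(A(X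
  0x80a3208c0)(A(X 0x80a030883)(A(P 0x80a138ca0(P 0x80a4298e1(P 0x8c40188c5(P 0x808139804(P
  0x8c6538406(P 0x80a13a085(P 0x8c60384a6(P 0x21198a0(P 0x21194c0(P 0x80a5020e1(P 0x8064280e1(P
  0x8ca101467(P 0x8c4021cc5(P 0x8ca128107(P 0x8060290e1(P 0x8ca121467(P 0x808138ca2(P 0x80a028ce1(
  P 0x80a138ca4(P 0x21180c5(P 0x22198a0(C 8(P 0x2118102(P 0x221a040(D 2)))(D 1))))))))))))))))))))
  )))(A(X 0x2111803)(A(X 0x2111803)(A(X 0x80a509c60)(A(P 0x80a122040(P 0x80a231481(P 0x80a409cc2(P
  0x8ca009102(P 0x8ca2204e0(P 0x8c0701481(P 0x8ca1118a4(P 0x80a122046(P 0x806011824(P 0x806011881(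
  P 0x8ca100904(P 0x8ca2204e6(P 0x2111840(P 0x806610081(P 0x2111c24(P 0x2111c02(P 0x80a612081(P
  0x21118e0(P 0x8c07090a0(P 0x806610024(P 0x2112040(P 0x8c0719481(P 0x8c0409cc5(P 0x21118a0(C 19(P
  0x80a2298e0(P 0x806038c45(P 0x80a60a120(P 0x806038ca2(P 0x80a0494c1(P 0x8ca0114c7(P 0x8ca028907(
  P 0x80a131120(P 0x80a048c26(P 0x80a131c09(P 0x8ca030509(P 0x2112407(C 11(P 0x80a141040(P
  0x80a2028c3(P 0x8ca030d22(P 0x80a011101(P 0x80a150047(P 0x8c0a008e6(P 0x2112802(P 0x8caa41c40(C
  6(P 0x80a928c20(P 0x2112001(P 0x80a102887(P 0x8ca228c20(P 0x80a910023(P 0x80a308049(P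
  0x80a1020e4(C 2(P 0x80aa58440(P 0x2118127(P 0x2112402(P 0x80a601561(P 0x211a4e0(P 0x80a60082b(P
  0x8ca658440(P 0x8c4061127(C 1(P 0x80a930500(P 0x80a64a900(P 0x80a312900(P 0x80a043526(P
  0x80a0404c9(P 0x80a218500(P 0x80a042926(P 0x80a0430c9(C 7(P 0x80606b044(F[::(12,0)]))(C 14(P
  0x806062083(F[::(8,0)]))(F[::(11,2);(7,3)])))))))))))(D 7))))))))))(F[::(5,10)])))))))))(F[::(1,4
  )]))))))))))(F[::(1,7)]))))))))))))))(F[::(6,0)]))))))))))))))))))))))))))(A(X 0x2111060)(A(X
  0x21114c0)(A(X 0x80a129060)(A(P 0x80a231c20(P 0x80a231481(P 0x80a409cc2(P 0x8ca0118e1(P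
  0x806009046(P 0x8ca1118a4(P 0x80a102046(P 0x8064080c2(P 0x8ca130900(P 0x8ca130904(P 0x8c08014c2(
  P 0x8ca2004e6(P 0x2111020(P 0x2111c24(P 0x8c08118a0(P 0x80a612001(P 0x806408046(P 0x2111401(P
  0x21110a0(P 0x8c0519c20(P 0x8060090c2(P 0x2111100(P 0x8c0719481(P 0x8c07080a6(C 9(P 0x80a3398a0(
  P 0x806028867(P 0x80a60a500(P 0x80a041cc1(P 0x8ca019cc5(P 0x8060288e3(P 0x8ca038d25(P
  0x80a131408(P 0x2112005(P 0x8ca030528(P 0x80a040826(P 0x80a131100(C 4(P 0x80a130c40(P
  0x80a202504(P 0x8ca041142(P 0x2112402(P 0x8ca931c40(P 0x80a010cc1(P 0x80a148047(P 0x8c0202507(C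
  12(P 0x80a720c20(P 0x2112001(P 0x80a102ca9(P 0x80a710023(P 0x80a308047(P 0x80a102125(P
  0x8ca220c20(C 2(P 0x80a860440(P 0x2118127(P 0x2112402(P 0x80a501981(P 0x211a4e0(P 0x8c4059127(P
  0x80a50082c(P 0x8ca560440(C 1(P 0x80ab38500(P 0x80a75a900(P 0x80a042967(P 0x80a218500(P
  0x80a0434eb(P 0x80a043167(P 0x80a312900(P 0x80a0404eb(C 5(P 0x806069d63(F[::(7,0)]))(C 13(P
  0x806072844(F[::(10,0)]))(F[::(9,2);(6,3)])))))))))))(D 7))))))))))(F[::(4,11)])))))))))(F[::(1,3
  )]))))))))))(F[::(1,5)]))))))))))))))(F[::(4,0)]))))))))))))))))))))))))))(A(X 0x80a3018a1)(A(P
  0x80a409cc0(P 0x80a231481(P 0x80a409cc2(P 0x80a602081(P 0x806030881(P 0x8ca1118a4(P 0x80a122046(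
  P 0x8ca0090a6(P 0x8ca0204e6(P 0x8ca130904(P 0x8ca2204e6(P 0x8ca130104(P 0x21108c0(P 0x80a1214c0(
  P 0x806230081(P 0x2111c24(P 0x806230024(P 0x8c08194c0(P 0x806030824(P 0x2110900(P 0x2112006(P
  0x8c0719481(P 0x8c0409cc5(C 12(P 0x80a22a460(P 0x80a602121(P 0x8ca011523(P 0x8ca328900(P
  0x806019c45(P 0x80a1494c0(P 0x806019ca2(P 0x80a1490c0(P 0x80a031121(P 0x2112003(P 0x80a148c06(P
  0x80a031c29(P 0x8ca0484e6(P 0x2111cc0(C 6(P 0x80a122040(P 0x2111c02(P 0x80a202466(P 0x8ca722840(
  P 0x80a012081(P 0x80a13804a(P 0x80a201cc3(C 2(P 0x80a250460(P 0x2118106(P 0x2112003(P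
  0x80a501141(P 0x211a0c0(P 0x80a500c2a(P 0x8ca550460(P 0x8c4058906(C 1(P 0x80a5424e0(P
  0x80a2230e0(P 0x80a8284e0(P 0x80a03b105(P 0x80a0384a8(P 0x80a2204e0(P 0x80a03a505(P 0x80a03aca8(
  C 10(P 0x80a759460(P 0x80a720065(P 0x80a518087(P 0x80a300901(P 0x2113402(C 7(P 0x80606b061(F[::(
  12,0)]))(C 14(P 0x806062024(F[::(8,0)]))(F[::(11,3);(7,0)]))))))))(F[::(3,10)]))))))))))(D 6)))))
  )))))(F[::(4,9)])))))))))(F[::(1,3)]))))))))))))))))(F[::(2,0)])))))))))))))))))))))))))(A(X
  0x2111c60)(A(X 0x8c03018a4)(A(X 0x2110c01)(A(X 0x80a009c44)(A(X 0x2111801)(A(X 0x2111060)(A(X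
  0x21114c0)(A(X 0x80a221420)(A(X 0x80a101844)(A(X 0x2111c20)(A(P 0x80a329020(P 0x80a329841(P
  0x80a2090a3(P 0x8ca1194c0(P 0x806008865(P 0x8ca1194c2(P 0x8c08018a3(P 0x8ca5004e3(P 0x2110820(P
  0x2111801(P 0x806208065(P 0x21108c0(P 0x2111022(P 0x80a102065(P 0x8062080a3(P 0x8ca128d00(P
  0x8ca128d02(P 0x8c08194c0(P 0x21118e1(P 0x80a009c65(P 0x8ca028ce1(P 0x2110900(P 0x8ca228ce1(P
  0x2111100(P 0x8c0719481(C 10(P 0x80a431c60(P 0x806018886(P 0x80a70a4a0(P 0x80a5020e1(P
  0x8ca0218e3(P 0x8ca038445(P 0x8ca038525(P 0x80a138c05(P 0x2112003(P 0x8060188c4(P 0x80a028827(C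
  5(P 0x80a120c40(P 0x2111802(P 0x80a2018e5(P 0x8ca622040(P 0x8ca2204c0(P 0x80a2024a7(P
  0x80a010c81(P 0x80a130048(C 1(P 0x80a250460(P 0x2111403(P 0x80a02ad41(P 0x80a500c2a(P
  0x8ca052507(P 0x80a501941(P 0x80a1180a2(C 13(P 0x80a629040(P 0x80ab18024(P 0x2110801(P
  0x80a618044(P 0x80a410066(P 0x80a2004e9(P 0x8ca329040(C 2(P 0x80a768460(P 0x80ac30041(P
  0x2118900(P 0x2118102(P 0x2110c02(P 0x8c400b102(P 0x8c402b102(P 0x80a60082d(P 0x8ca668460(C 5(P
  0x806069c62(F[::(7,0)]))(C 13(P 0x806072024(F[::(8,0)]))(F[::(7,1);(6,3)]))))))))))))(F[::(5,12)]
  )))))))))(F[::(2,4)])))))))))(F[::(4,9)]))))))))))(F[::(1,3)])))))))))))))(F[::(2,0)])))))))))))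
  ))))))))))))))))(A(X 0x2111c60)(A(X 0x8c03004a4)(A(X 0x2111804)(A(X 0x2111804)(A(X 0x2110c80)(A(
  X 0x21114c0)(A(X 0x80a021427)(A(X 0x8ca0384a4)(A(X 0x8ca1200c7)(A(P 0x80a509d02(P 0x806040825(P
  0x8060408a1(P 0x8ca112085(P 0x80a128d02(P 0x8c08018a4(P 0x8ca2284e8(P 0x8ca1400c5(F[::(2,0)]))))
  )))))(A(X 0x8c04018e3)(A(X 0x2111480)(A(X 0x2111001)(A(X 0x2110c80)(A(X 0x21114c0)(A(P
  0x80a530900(P 0x80a040ca1(P 0x80a0410a1(P 0x80a509d00(P 0x806628408(P 0x80a041cc5(P 0x2111422(P
  0x80a0410a6(P 0x808209c64(P 0x2111841(P 0x80a128d00(P 0x80a0408c5(P 0x8ca502041(P 0x80a040ca6(P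
  0x21118e1(P 0x806628500(P 0x8ca009468(P 0x8ca0284e8(P 0x8ca029848(P 0x806129900(P 0x8ca031468(P
  0x21118a1(C 9(P 0x80a8118a0(P 0x80a241c05(P 0x2119c60(P 0x806039829(P 0x8c60484e3(P 0x2118ce0(P
  0x21180e3(P 0x2219c60(P 0x80a500c48(P 0x8c432a0e0(P 0x8ca540860(P 0x8c6748403(P 0x806039921(P
  0x80a501102(C 10(P 0x2118142(P 0x221a840(D 2)))(D 1))))))))))))))))(C 24(P 0x808312080(P
  0x8c4020ce6(P 0x808241c05(P 0x8c67484c0(P 0x2119cc0(P 0x8c66484e0(P 0x21198e0(P 0x80a1480c2(P
  0x8c402a0e6(P 0x808219c05(P 0x8c0610d20(P 0x21180e6(P 0x2219cc0(C 11(P 0x2118142(P 0x221a840(D 2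
  )))(D 1)))))))))))))))(F[::(6,1)])))))))))))))))))))))))))(A(P 0x8c4308107(P 0x808209c60(P
  0x808231c60(P 0x8c0502041(P 0x8c0522041(P 0x8c08398a0(P 0x2111422(P 0x808209c64(P 0x8c08014c2(P
  0x2111841(P 0x8c05020e1(P 0x8c05220e1(P 0x808028ce2(P 0x8c051a041(P 0x8c08118a0(P 0x8c02400a1(P
  0x21110a0(P 0x8c05020e6(P 0x21118e1(P 0x8c0508900(P 0x8c0530900(P 0x2112005(P 0x8c0508904(P
  0x2111100(P 0x21118a1(C 7(P 0x80a02a507(P 0x806241c05(P 0x806241ca0(P 0x8ca009843(P 0x8ca828067(
  P 0x8ca540860(P 0x80a501107(F[::(7,2)]))))))))(C 13(P 0x80a149407(P 0x2111c04(P 0x806201c29(P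
  0x8ca70a480(P 0x806201d21(P 0x8ca0484c7(P 0x21118e0(F[::(7,2)]))))))))(C 17(P 0x80a3398a0(P
  0x80a8014c1(P 0x80a02a462(P 0x80a502043(P 0x80a130900(P 0x80a0408c1(P 0x8ca0188c5(P 0x8ca328102(
  P 0x8ca519d00(P 0x80a02a467(P 0x80a60a500(P 0x8ca010d25(P 0x80a131408(P 0x2112005(P 0x8067188a0(
  P 0x8ca030528(P 0x8ca1400a6(P 0x806219ca0(P 0x8c08014c2(P 0x806718805(P 0x80a131100(P
  0x8c05020e6(P 0x806219c05(C 19(P 0x80a131d00(P 0x806041026(P 0x80a339940(P 0x80a0518e3(P
  0x8ca0098e8(P 0x8ca030528(P 0x80a339540(P 0x8060410c1(P 0x80a051067(P 0x80a33a00a(P 0x8ca038d2a(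
  P 0x2112808(C 12(P 0x80a149480(P 0x80a402ce2(P 0x8ca038944(P 0x80a021521(P 0x80a158088(P
  0x8c0b01107(P 0x2112c04(P 0x8cab4a080(C 7(P 0x80aa31420(P 0x2112401(P 0x80a102c68(P 0x8ca231420(
  P 0x80aa10025(P 0x80a50804a(P 0x8c0900584(C 2(P 0x80a56a480(P 0x2118148(P 0x2110c02(P
  0x80a701181(P 0x211a900(P 0x80a70082c(P 0x8ca06b02a(P 0x8c4069948(C 1(P 0x80aa28520(P
  0x80a552d20(P 0x80a312d20(P 0x80a04b945(P 0x80a0484aa(P 0x80a218520(P 0x80a04ad45(P 0x80a04b4aa(
  C 8(P 0x806073444(F[::(13,0)]))(C 15(P 0x80606a483(F[::(9,0)]))(F[::(12,2);(8,3)])))))))))))(D 8)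
  )))))))))(F[::(6,11)])))))))))(F[::(1,5)]))))))))))(F[::(3,8)]))))))))))))))(F[::(7,2)])))))))))
  ))))))))))))))))(C 23(P 0x8c4408109(P 0x808149402(P 0x808500c44(P 0x8c45190c0(P 0x8c060a460(P
  0x8082400a1(P 0x21198a0(P 0x8087400a1(P 0x21194c0(P 0x808500ce4(P 0x808149407(P 0x808302081(P
  0x8c060a500(P 0x8c45404c0(P 0x8082180a1(P 0x8087180a1(P 0x21180c5(P 0x22198a0(P 0x8c40488c5(P
  0x8c4049cc5(C 11(P 0x80a53a080(P 0x80a4018e5(P 0x8c41280c7(P 0x2111002(P 0x8ca720125(P
  0x80a0228a7(P 0x8ca039544(P 0x808201823(P 0x80a4024a7(P 0x8ca439520(P 0x808201828(P 0x80a538c80(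
  P 0x8c0929c40(P 0x8c0929cc0(C 10(P 0x80a501d06(P 0x8ca828146(P 0x806028506(P 0x808301c44(F[::(
  1,0)])))))(C 20(P 0x806402423(P 0x8ca0408ab(F[::(9,4)])))(D 6)))))))))))))))))(C 23(P 0x2118146(
  P 0x221a8c0(D 6)))(D 5)))))))))))))))))))))))(C 32(P 0x80a8218a0(P 0x80a500904(P 0x8c4511120(P
  0x8c0909840(P 0x808131403(P 0x8088100a1(P 0x211a4a0(P 0x8088380a1(P 0x8c09098e0(P 0x2111c02(P
  0x80a029888(P 0x808131100(P 0x8083100a1(P 0x8083380a1(P 0x8c4032125(P 0x2119520(P 0x2118125(C 8(
  P 0x80a201828(P 0x80630a002(F[::(8,3)])))(C 15(P 0x80a60a080(P 0x80a401cc1(P 0x211a880(P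
  0x8c4018944(P 0x8c4438540(P 0x2118144(P 0x2112807(P 0x2119140(C 6(P 0x8c042ac60(P 0x8c0158880(P
  0x2111801(P 0x8c0452c60(P 0x8083004a2(P 0x21120c0(P 0x808301942(P 0x2112020(P 0x8086004a2(P
  0x2112060(P 0x2112080(P 0x2112404(P 0x2112120(C 5(P 0x80a401d6a(P 0x80655a804(F[::(10,5)])))(C 7
  (P 0x8c0360820(P 0x8c482006c(P 0x8c0123060(P 0x808302ce2(P 0x2112c03(P 0x2111420(P 0x2112401(P
  0x2111520(P 0x2112820(P 0x8c0100d84(P 0x2112920(C 7(P 0x8c0369020(P 0x8c013b4a0(P 0x8c03690c0(P
  0x2112003(P 0x808500ce4(P 0x2110820(P 0x2111801(P 0x21108c0(P 0x2112820(P 0x21128c0(P 0x2112c01(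
  P 0x2110960(P 0x2112c06(P 0x2112960(C 8(P 0x80a90110c(P 0x80ad3a080(F[::(12,7)])))(F[::(12,4);(
  8,9)]))))))))))))))))(D 8)))))))))))))(D 5))))))))))))))))(D 6))))))))))(F[::(3,0)])))))))))))))
  )))))))(F[::(4,0)])))))))))))))))))))))))))))))))(A(X 0x2111c20)(A(P 0x8c0819420(P 0x8c0821420(P
  0x8c0522041(P 0x808009c64(P 0x808031c64(P 0x2110820(P 0x8c08018a3(P 0x8c08214c0(P 0x808209c64(P
  0x2111801(P 0x21108c0(P 0x2111841(P 0x808428ce0(P 0x8c05220e1(P 0x2111c22(P 0x8c0240ca1(P
  0x8c08004a4(P 0x8c08194c0(P 0x21118e1(P 0x8c0128d00(P 0x2112001(P 0x2110900(P 0x2112041(P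
  0x8c0508104(P 0x21114c0(P 0x21118a1(C 6(P 0x80a531c60(P 0x80a400c41(P 0x80a022422(P 0x80a110c04(
  P 0x80a138c04(P 0x2111003(P 0x8ca038524(P 0x80a3010c5(P 0x80a20a480(P 0x806708804(P 0x80a021841(
  P 0x8ca329880(P 0x80a01a4a6(P 0x8ca031523(P 0x8ca518086(P 0x80a112080(P 0x8c03010c2(P
  0x8c0400ce6(C 20(P 0x80a509100(P 0x8060408a1(P 0x80a71a540(P 0x80a0518e3(P 0x8ca028488(P
  0x806040825(P 0x80a339540(P 0x80a050867(P 0x80a33a00a(P 0x8ca038d2a(P 0x2112808(C 11(P
  0x80a148c80(P 0x8c0b01106(P 0x8ca448560(P 0x80a402cc2(P 0x80a020d21(P 0x80a158088(P 0x2112c04(P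
  0x8cab4a080(C 7(P 0x80aa21420(P 0x2112401(P 0x8082004a8(P 0x8ca221420(P 0x80aa10025(P
  0x80a50804a(P 0x80a8480c3(C 2(P 0x80ab60440(P 0x2118148(P 0x2112802(P 0x808500829(P 0x211a900(P
  0x80a50082c(P 0x8ca560440(P 0x8c4068548(P 0x8c4069948(C 4(P 0x80aa724a0(P 0x80a600c48(P
  0x2111003(P 0x80ad01501(P 0x8cab720a0(P 0x8ca572960(P 0x8cae2816a(C 7(P 0x806073444(F[::(13,0)])
  )(C 13(P 0x806069c83(F[::(7,0)]))(F[::(12,2);(6,3)]))))))))))(F[::(5,7)])))))))))))(F[::(4,11)]))
  )))))))(F[::(1,3)]))))))))))(F[::(3,8)])))))))))))))(F[::(7,2)]))))))))))))))))))))(C 6(P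
  0x80a1010c5(P 0x8ca329880(P 0x806100cc5(P 0x8ca031523(P 0x8c0440860(F[::(3,1)]))))))(C 6(P
  0x80a02a507(P 0x806241c05(P 0x8ca828027(P 0x8ca540820(P 0x80a501107(F[::(7,2)]))))))(C 6(P
  0x80a8494c0(P 0x21180c4(P 0x2111801(P 0x2119880(P 0x80a600528(P 0x8c460a080(P 0x2110c01(P
  0x21190c0(P 0x80a030909(P 0x8c40488c4(C 13(P 0x80a53a080(P 0x80a601062(P 0x80a600443(P
  0x80a4018e5(P 0x80a3128c0(P 0x806810c06(P 0x8c4431420(P 0x8ca040946(P 0x80a219006(P 0x80a241006(
  P 0x2118081(P 0x2112404(P 0x8c4449c20(P 0x8c403a881(P 0x8ca439520(P 0x2119020(P 0x806312006(C 14
  (P 0x80a902ce1(P 0x80aa21440(P 0x80ab00904(P 0x8ca909d60(D 6)))))(F[::(8,3)])))))))))))))))))))(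
  C 15(P 0x80aa104e0(P 0x80a901022(P 0x8c45100e1(P 0x8084024a6(P 0x8ca008949(P 0x8ca248081(P
  0x80a251007(P 0x2112407(P 0x80a048c41(P 0x80a04a041(P 0x8ca050827(P 0x8c0701146(C 2(P
  0x80a54a0c0(P 0x80a030864(P 0x8064284c0(P 0x8ca009446(P 0x8061290c0(P 0x8ca020c46(P 0x80641a4c0(
  P 0x8ca048c46(P 0x80a032ca1(P 0x80a032c64(P 0x80a1288c0(P 0x80a4188c0(P 0x808030867(P
  0x80a032c69(P 0x80a50a0c0(P 0x80a0308a1(P 0x80a5228c0(P 0x80a032825(P 0x808032827(P 0x80a030869(
  C 5(P 0x80a231480(P 0x2112c09(P 0x80a0214c2(P 0x80a0228c2(P 0x80a258083(P 0x80a4024e1(C 13(P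
  0x80a731420(P 0x80a718025(P 0x80a508067(P 0x80a101102(P 0x80a63ac01(P 0x2113404(C 11(P
  0x80a860440(P 0x80a838041(P 0x80a638081(P 0x80a1200e6(P 0x80a201523(P 0x2113805(C 8(P
  0x8060734c1(F[::(13,0)]))(C 15(P 0x80606a423(F[::(9,0)]))(F[::(12,2);(8,0)])))))))))(F[::(6,11)])
  )))))))(F[::(10,5)]))))))))(F[::(3,5)]))))))))))))))))))))))(C 2(P 0x80a54a0c0(P 0x80a6004a4(P
  0x2110c01(P 0x80a928406(P 0x80a759420(P 0x80a428406(P 0x80a301907(P 0x80a600c85(P 0x8ca041d63(P
  0x8ca718028(P 0x80642a406(P 0x80a9288c0(P 0x8ca059d01(P 0x8c0100d28(C 14(P 0x80a709140(P
  0x8ca0214c2(P 0x80a200c85(P 0x8caa38440(P 0x80a0118a4(P 0x80aa00ce1(P 0x80a522802(P 0x8ca04948c(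
  P 0x2112803(C 9(P 0x80a159cc0(P 0x80a031d61(P 0x80a601102(P 0x80a1180c5(P 0x2113404(C 4(P
  0x80ac41c20(P 0x211340b(P 0x80ac30024(P 0x80a730044(P 0x80a102d23(C 7(P 0x8060734c2(F[::(13,0)])
  )(C 14(P 0x80606a441(F[::(9,0)]))(F[::(12,0);(8,1)]))))))))(F[::(1,7)])))))))(F[::(5,10)]))))))))
  )))(F[::(9,4)]))))))))))))))))(C 2(P 0x80a54a0c0(P 0x80a759804(P 0x2111804(P 0x80612a4c0(P
  0x80a758c80(P 0x80a401967(P 0x80a1288c0(P 0x80a50a0c0(P 0x80a6010a1(P 0x80a9288c0(P 0x8c0401965(
  P 0x80a9188c0(P 0x8ca059d04(P 0x8ca7200cb(P 0x80a601069(C 4(P 0x80a232880(P 0x2112c09(P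
  0x80a0228c2(P 0x80a4024e1(P 0x80a258083(C 9(P 0x80a759420(P 0x80a718025(P 0x80a508067(P
  0x80a101102(P 0x2113404(C 13(P 0x80aa5a460(P 0x80ac00827(P 0x80ae00ceb(P 0x8ca35a9c0(P
  0x8cab181ca(P 0x8cae59c60(P 0x2110c02(C 6(P 0x8060734c2(F[::(13,0)]))(C 14(P 0x80606a443(F[::(
  9,0)]))(F[::(12,2);(8,1)]))))))))))(F[::(11,6)])))))))(F[::(2,10)])))))))(F[::(3,5)])))))))))))))
  ))))(C 2(P 0x80a50a0c0(P 0x80a602464(P 0x2112406(P 0x8061290c0(P 0x80a901967(P 0x806428406(P
  0x80a1288c0(P 0x80a4188c0(P 0x80a6024a1(P 0x8c0901965(P 0x8ca059d09(P 0x8ca7480cb(C 3(P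
  0x80a231480(P 0x2112c09(P 0x80a4024e1(P 0x80a0214c2(P 0x80a258083(C 11(P 0x80a731420(P
  0x80a718025(P 0x80a508067(P 0x80a101102(P 0x2113404(C 10(P 0x80aa5a460(P 0x80a70082c(P
  0x80a30394b(P 0x8ca35a9c0(P 0x8cab181ca(P 0x2110c02(P 0x8cae5b060(C 5(P 0x8060720c2(F[::(8,0)]))
  (C 13(P 0x806042443(F[::(9,0)]))(F[::(8,1);(7,2)]))))))))))(F[::(6,11)])))))))(F[::(2,5)])))))))(
  F[::(3,5)]))))))))))))))(C 2(P 0x80a401967(P 0x8ca93acc0(P 0x806402567(P 0x8ca059d09(P
  0x8c0610d20(F[::(9,4)]))))))(D 5))))))))))))))))))(C 23(P 0x80a54a080(P 0x80a020d25(P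
  0x8083104a0(P 0x8c4019544(P 0x8088104a0(P 0x808209006(P 0x8c400a544(P 0x808219006(P 0x808241006(
  P 0x8c443a540(P 0x8c0a104e0(P 0x2111c04(P 0x2118144(P 0x2119140(C 15(P 0x8089008c1(P 0x80aa21440
  (P 0x80ab00904(P 0x8c0b3a120(D 6)))))(C 17(P 0x8c4008d28(P 0x808a21420(P 0x808758124(P
  0x8ca030869(D 6)))))(F[::(8,3)])))))))))))))))))(F[::(3,1)]))))))))))))))(C 26(P 0x80a441c60(P
  0x80a018904(P 0x808112080(P 0x8c4011123(P 0x80813a080(P 0x80a301888(P 0x808110c05(P 0x808138c05(
  P 0x211a460(P 0x808430061(P 0x8c4332120(P 0x8c09088c0(P 0x2118123(P 0x2112406(P 0x2118d20(C 18(P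
  0x80a719140(P 0x80a0518e3(P 0x8c4118144(P 0x8080424a1(P 0x8c0a31d00(P 0x808041026(P 0x80a338540(
  P 0x8c0a020e1(P 0x80a050867(P 0x8c0a020e6(P 0x80a33a00a(P 0x8c0838540(P 0x8ca038c8a(P
  0x8ca350107(P 0x2112808(C 4(P 0x80a202883(P 0x80a149440(F[::(3,10)])))(C 5(P 0x8083028c7(P
  0x211a040(D 6)))(F[::(9,4);(5,1)]))))))))))))))))))(C 20(P 0x808120c40(P 0x8c4118144(P
  0x8c4008907(P 0x808919020(P 0x808650103(P 0x2119d00(P 0x8c400a507(P 0x808219020(P 0x808322006(P
  0x8c4031107(P 0x808312006(P 0x211a0e0(P 0x8c0718940(P 0x8c4850ce0(P 0x2118107(P 0x221a0e0(C 1(P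
  0x80a00ac64(P 0x8c650804b(D 6)))(C 9(P 0x2118161(P 0x221ac20(D 1)))(D 0)))))))))))))))))))(F[::(
  7,2)]))))))))))))))))))(F[::(2,7)]))))))))))))))))))))))))))))))))(A(X 0x8c04004e3)(A(X
  0x2111480)(A(X 0x2219060)(A(X 0x2119060)(A(P 0x80a530900(P 0x80a040ca1(P 0x8c4410ca1(P
  0x80a531d00(P 0x2119481(P 0x80a041cc5(P 0x8c61400a4(P 0x21190a1(P 0x80a0410a6(P 0x806129808(P
  0x8c6540024(P 0x80a128d00(P 0x80a040825(P 0x21184a4(P 0x2219481(P 0x80a040ca6(P 0x806628500(P
  0x8ca009468(P 0x8ca0284e8(P 0x8c41418a4(P 0x806129900(P 0x8ca031468(C 12(P 0x2118121(P 0x221a420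
  (D 1)))(D 0))))))))))))))))))))))))(A(X 0x2118c80)(A(X 0x2118c80)(A(X 0x8c4039483)(A(X 0x2119060
  )(A(X 0x2118c80)(A(X 0x22198a0)(A(X 0x80a029047)(A(X 0x8c4021cc5)(A(X 0x8c4021cc5)(A(X 0x21198a0
  )(A(X 0x21198a0)(A(X 0x21198a0)(A(P 0x80a530901(P 0x806730820(P 0x211a020(P 0x8c6011828(P
  0x8c6039828(P 0x806329020(P 0x8c6019428(P 0x2118101(P 0x221a020(D 1))))))))))(A(X 0x8ca021427)(A
  (X 0x21104e0)(A(X 0x8ca029047)(A(X 0x2110ce0)(A(P 0x80a530901(P 0x8c40188c5(P 0x80a531d01(P
  0x80a141cc5(P 0x8c66404a0(P 0x21198a0(P 0x80a1410a6(P 0x8c65404c0(P 0x21194c0(P 0x8c4021cc5(P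
  0x80a628d01(P 0x80a1408c5(P 0x80a140ca6(P 0x2110500(P 0x8ca1298e8(P 0x8ca131468(P 0x21180c5(P
  0x22198a0(C 16(P 0x2118122(P 0x221a440(D 2)))(D 1))))))))))))))))))))(A(X 0x2111c04)(A(X
  0x21104e0)(A(P 0x808719420(P 0x808031c61(P 0x808231c61(P 0x808031c64(P 0x8c08018a3(P 0x8c08398a1
  (P 0x8c08094c0(P 0x8c08214c0(P 0x8c08094c2(P 0x21108c0(P 0x808128ce0(P 0x808428ce0(P 0x808128ce2
  (P 0x8c08018a1(P 0x8c08118a1(P 0x8c08018a4(P 0x21110a1(P 0x8c050a0e6(P 0x8c08194c0(P 0x8c0628500
  (P 0x8c0530101(P 0x2112025(P 0x2110900(P 0x2112006(P 0x2111101(C 5(P 0x80a62a460(P 0x80a400ce1(P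
  0x80a3010c2(P 0x80a138c04(P 0x2111003(P 0x806530860(P 0x806231460(P 0x806231403(P 0x8ca038524(P
  0x8ca120067(P 0x80a3010c5(P 0x80a70a480(P 0x80a0218e1(P 0x8ca311880(P 0x80a01a446(P 0x8ca030923(
  P 0x8ca218086(P 0x8ca031523(P 0x8ca518086(P 0x80a13a080(P 0x806530803(P 0x8c0400ce6(C 8(P
  0x80a1228c0(P 0x80a352500(P 0x80a042543(P 0x2111805(P 0x806031c81(P 0x80a351808(P 0x80a801543(P
  0x8ca009146(P 0x8ca6204a0(P 0x806031c24(P 0x80a351100(P 0x80a350900(P 0x80a041c6a(P 0x8ca050ce8(
  P 0x2111d00(C 4(P 0x80a13a080(P 0x2112404(P 0x8ca93ac80(P 0x80a401845(P 0x80a0220e1(P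
  0x80a14808b(P 0x8c0901163(C 11(P 0x80a461860(P 0x80a301584(P 0x8c4031d6a(P 0x211ad40(P 0x211a960
  (P 0x211816a(P 0x221ad40(P 0x8c400b16a(P 0x8c401316a(C 9(P 0x80a722180(P 0x80a233580(P
  0x80a720580(P 0x80a0634e4(P 0x80a060487(P 0x80a062ce4(P 0x80a062087(P 0x80a230580(C 11(P
  0x80aa59c60(P 0x80aa20067(P 0x80a710089(P 0x80a3009a1(P 0x2113802(C 6(P 0x806053061(F[::(12,0)])
  )(C 13(P 0x806062c24(F[::(11,0)]))(F[::(11,3);(10,0)]))))))))(F[::(3,10)]))))))))))(D 11)))))))))
  ))(F[::(7,6)])))))))))(F[::(3,6)])))))))))))))))))(F[::(5,2)]))))))))))))))))))))))))(C 15(P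
  0x8c4808089(P 0x8c070a440(P 0x8c070a480(P 0x8c43204e0(P 0x808610061(P 0x2119c60(P 0x808628061(P
  0x2118ce0(P 0x21180e3(P 0x2111402(P 0x8c43120e0(P 0x8c432a0e0(P 0x8c070a4a0(P 0x808620061(P
  0x8083008c8(P 0x808148c06(P 0x808201101(P 0x808501101(P 0x8c40498e3(C 10(P 0x80a351100(P
  0x80a801543(P 0x8c4418101(P 0x80a042543(P 0x2111805(P 0x808030482(P 0x80aa18500(P 0x80a351808(P
  0x8c0650900(P 0x8c08128c0(P 0x808601522(P 0x808601524(P 0x2112006(P 0x80a04046a(P 0x8c4150104(P
  0x80a041c6a(P 0x8c0801542(P 0x8ca050c28(P 0x8ca3400aa(C 16(P 0x2118165(P 0x221aca0(D 5)))(D 4)))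
  ))))))))))))))))))(C 25(P 0x80a9284c0(P 0x80a929cc0(P 0x80a602125(P 0x8c4428101(P 0x808339802(P
  0x8089400c3(P 0x211a8c0(P 0x808309802(P 0x8c4641540(P 0x8c0a18500(P 0x80a0304a9(P 0x808309520(P
  0x8c400a546(P 0x808339520(P 0x8082400c3(P 0x2119940(P 0x2118146(P 0x221a8c0(C 13(P 0x2118165(P
  0x221aca0(D 5)))(D 4))))))))))))))))))))(F[::(5,2)]))))))))))))))))))))))(C 20(P 0x806201427(P
  0x2111403(P 0x8062014e1(P 0x8ca038525(P 0x80a138c05(P 0x8c03398a0(P 0x8c08218a0(F[::(5,2)]))))))
  ))(C 23(P 0x80a1490c0(P 0x80a602121(P 0x8c4408109(P 0x80a1488c0(P 0x8c0612460(P 0x8c062a460(P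
  0x2111803(P 0x808302082(P 0x80a1494c0(P 0x808302085(P 0x80a031121(P 0x8c0622460(P 0x80a148c06(P
  0x8c03488c0(P 0x80a031c29(P 0x8ca0484e6(P 0x8ca130069(P 0x8c0600d22(P 0x8c0600d25(P 0x2111cc0(C
  11(P 0x80a409cc0(P 0x80a9018e3(P 0x80a602502(P 0x806820406(P 0x8ca430121(P 0x8ca0120e6(P
  0x80a032848(P 0x8ca041146(P 0x8ca230128(P 0x80a339809(P 0x2112406(P 0x8068204c0(P 0x8ca038d49(P
  0x8ca3480c7(P 0x8061220c0(P 0x80a602424(P 0x806241006(P 0x80a339520(P 0x8c0602507(P 0x806122006(
  C 7(P 0x80a22a460(P 0x2112003(P 0x80a302827(P 0x8ca82ac60(P 0x80a01a4a2(P 0x80a24006b(P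
  0x8c0800d64(C 2(P 0x80a562040(P 0x2118127(P 0x2112402(P 0x80a600961(P 0x211a4e0(P 0x80a60102b(P
  0x2119d20(P 0x8c4060d27(C 1(P 0x80a34a900(P 0x80a22b500(P 0x80a918500(P 0x80a043523(P
  0x80a040469(P 0x80a228500(P 0x80a042923(P 0x80a043069(C 11(P 0x80a861860(P 0x80a828066(P
  0x80a6180a8(P 0x80a300921(P 0x2113802(C 8(P 0x806073461(F[::(13,0)]))(C 15(P 0x80606a424(F[::(
  9,0)]))(F[::(12,3);(8,0)]))))))))(F[::(4,11)]))))))))))(D 7))))))))))(F[::(5,10)])))))))))(F[::(
  2,4)]))))))))))))))))))))))(C 17(P 0x8c451812a(P 0x8c46104e0(P 0x8c071a840(P 0x8088480c3(P
  0x2119cc0(P 0x21198e0(P 0x808600905(P 0x808351808(P 0x808201023(P 0x8084024a3(P 0x8c071a920(P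
  0x8c4648ce0(P 0x8081200c3(P 0x8088200c3(P 0x21180e6(P 0x2219cc0(P 0x8c40504e6(P 0x8c40520e6(C 19
  (P 0x2118167(P 0x221ace0(D 7)))(D 6))))))))))))))))))))(C 25(P 0x80a929cc0(P 0x80a600525(P
  0x8c4608940(P 0x8c0a19c20(P 0x8089400c3(P 0x211a8c0(P 0x8c0a19d00(P 0x80a031ca9(P 0x808339520(P
  0x8084080c3(P 0x8084400c3(P 0x8c403a546(P 0x2119940(P 0x2118146(P 0x221a8c0(C 4(P 0x80a201d63(P
  0x808401941(P 0x806012163(P 0x8cab10123(F[::(8,0)])))))(C 4(P 0x2118123(P 0x221a460(D 7)))(D 6))
  ))))))))))))))))(F[::(5,2)]))))))))))))))))))))))))(C 30(P 0x80a441c60(P 0x80a019d04(P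
  0x80813a080(P 0x808230061(P 0x211a460(P 0x808530061(P 0x8c4039123(P 0x80a301888(P 0x808138c02(P
  0x808138c05(P 0x808430061(P 0x8c4332120(P 0x8c0909cc0(P 0x2118123(P 0x2112406(P 0x2118d20(C 2(P
  0x80a409c60(P 0x80a019d02(P 0x8c641802a(P 0x806940860(P 0x8ca0120e3(P 0x8c611808a(P 0x80a01a848(
  P 0x8ca041143(P 0x80a019ca9(P 0x806820460(P 0x2111c60(P 0x808122040(P 0x806122060(P 0x2112860(P
  0x806122003(C 2(P 0x2118081(P 0x2219020(P 0x806512020(P 0x2119020(D 1)))))(F[::(0,10)]))))))))))
  )))))))(C 3(P 0x806301909(P 0x8ca042546(P 0x806301928(P 0x8ca038542(P 0x8ca6424a0(F[::(6,3)]))))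
  ))(C 13(P 0x8c072a840(P 0x8083024a1(P 0x8c0732840(P 0x2118ce0(P 0x808650c08(P 0x8082024a1(P
  0x2119c60(P 0x808901026(P 0x8c43484e0(P 0x8c0732920(P 0x808820066(P 0x21180e3(P 0x2219c60(P
  0x808201026(P 0x8c40520e3(C 13(P 0x2118164(P 0x221ac80(D 4)))(D 3)))))))))))))))))(C 19(P
  0x80a409c60(P 0x80a302081(P 0x808638c02(P 0x8c4038943(P 0x8c4340540(P 0x8c0a31d00(P 0x211a860(P
  0x808639520(P 0x808440066(P 0x2118d40(P 0x2118143(P 0x221a860(C 4(P 0x8087008a3(P 0x211a420(P
  0x8086008a3(D 5))))(C 6(P 0x8083028c4(P 0x211a040(P 0x808a00487(P 0x808300487(D 4)))))(F[::(4,0);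
  (1,3)])))))))))))))))(F[::(2,0)])))))))))))))))))))))(F[::(2,0)])))))))))))))))))))))))))))))))(
  A(X 0x2110ce0)(A(X 0x2111480)(A(X 0x2219c20)(A(X 0x21184e0)(A(X 0x21184e0)(A(X 0x21184e0)(A(X
  0x2111c05)(A(X 0x2110ce0)(A(X 0x21110a0)(A(X 0x2219c60)(A(X 0x2118ce0)(A(X 0x2219480)(E)))))))))
  ))))))))))))))))))))))))))))))))))))))))))))))))))))))))))))))))))))))))))))))))))))))))))))))))
  ))))))))))))))))))))))))))))))))))))))))))))))))))))))))))))))))))))))))))))))))))))))))))))))))
  )))))))))))))))))))))))))))))))))))))))))))))))))))))))).

(** Forbidden graph number 4 is now [c5_roof_ear]. The leaves have two additional vertices, and all
    of them place the 5-cycle and its roof on the same six lines as in the previous tree. *)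
Definition c5_roof_tree : tree :=
  P 0x8c0520c41(P 0x8c40184a4(P 0x8c0129062(P 0x2110440(P 0x2119480(P 0x12086508804(P 0x8c0209483(
  P 0x2111062(P 0x21190a0(P 0x8c02190a1(P 0x2111422(P 0x12082418805(P 0x21180a4(P 0x2219480(C 4(P
  0x80a530860(P 0x80a629060(P 0x2110460(P 0x80a0188c5(P 0x8c66180a1(P 0x8ca029843(P 0x2110860(P
  0x80a0190a6(P 0x8c65180c1(P 0x8ca031483(P 0x2111060(C 5(P 0x2118081(P 0x2219020(P 0x806638c20(P
  0x2119020(D 1)))))(F[::(0,4)])))))))))))))(C 2(P 0x80a508c40(P 0x8c6510026(P 0x806428440(P
  0x80a0118a4(P 0x8ca0214c2(P 0x80a010c25(P 0x8c61100a6(P 0x2110c40(P 0x8ca028462(P 0x806129040(P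
  0x2111840(P 0x806129002(C 3(P 0x2118061(P 0x2218c20(P 0x806611020(P 0x2118c20(D 1)))))(C 3(P
  0x2118061(P 0x2218c20(P 0x8c66004e2(P 0x2118c20(D 1)))))(F[::(0,6)])))))))))))))))(C 4(P
  0x80a610c80(P 0x80a0214c2(P 0x8c6620025(P 0x806230480(P 0x8ca0118a4(P 0x806130804(P 0x806130880(
  P 0x2111480(P 0x80a020c26(P 0x8c61200c5(P 0x8ca030464(P 0x2110c80(C 4(P 0x21180a1(P 0x2219420(P
  0x806711020(P 0x2119420(D 1)))))(C 4(P 0x21180a1(P 0x2219420(P 0x8c67004c2(P 0x2119420(D 1)))))(
  F[::(0,5)])))))))))))))))(C 9(P 0x80a608c80(P 0x80a4008c1(P 0x120865008c1(P 0x8c44104a0(P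
  0x2119480(P 0x1208c418805(P 0x21190a0(P 0x21180a4(P 0x2219480(P 0x80a020c26(P 0x8c40198a4(C 5(P
  0x80a4184c0(P 0x80a031483(P 0x80a031c64(P 0x12100708c46(P 0x80a3208c0(P 0x12100511026(P
  0x80a030883(P 0x80a030464(C 6(P 0x8c6041027(P 0x2119c20(P 0x8c6031427(P 0x21180e1(P 0x2219c20(P
  0x8c6011027(P 0x8c6019427(D 1))))))))(C 6(P 0x8c64384a0(P 0x21190a0(P 0x21180a4(P 0x2219480(P
  0x12110601447(D 5))))))(C 8(P 0x80a138ca0(P 0x806029027(P 0x2111040(P 0x2111402(P 0x1208c801467(
  P 0x121464008e5(P 0x21110a0(P 0x2111100(P 0x8ca509c40(C 4(P 0x806029848(P 0x8ca018524(P
  0x8ca048467(D 2))))(F[::(4,0)])))))))))))(C 4(P 0x806021427(P 0x2111460(P 0x12144500ce4(P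
  0x2111480(P 0x21114c0(D 5))))))(C 4(P 0x80a5208e0(P 0x806038485(P 0x8060384a4(P 0x21104e0(P
  0x80a428ce0(C 6(P 0x8c65404c0(P 0x2111802(P 0x2118102(D 6))))(F[::(1,0)])))))))(L[::23;14;10;12;
  7;1;5;0](A(X 0x808531c20)(A(X 0x808441c20)(A(X 0x808221460)(A(P 0x80a101524(P 0x2111802(P
  0x1218241a006(P 0x2118102(P 0x80a101467(P 0x1218274a006(D 6)))))))(A(X 0x808329040)(A(X
  0x808519c20)(A(X 0x808411c20)(A(X 0x2219040)(A(X 0x2119040)(A(X 0x8c4419840)(A(X 0x2118880)(A(X
  0x2119040)(A(X 0x2118880)(A(X 0x8ca608065)(A(X 0x2219460)(A(X 0x2119460)(A(X 0x2118ca0)(A(X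
  0x8c4512060)(A(X 0x8ca808044)(A(X 0x2118ca0)(A(X 0x2111803)(A(X 0x80a301844)(A(X 0x80a019482)(A(
  X 0x8ca430068)(A(X 0x21114c0)(A(X 0x2219c20)(A(X 0x80a1014c2)(A(X 0x2119c20)(A(X 0x2119c20)(A(X
  0x2112002)(A(X 0x2111100)(A(X 0x8ca540046)(A(X 0x221a080)(A(X 0x2119100)(A(X 0x22198a0)(E)))))))
  )))))))))))))))))))))))))))))))))))))))))))(C 5(P 0x2119060(P 0x2118c80(P 0x8080184a2(P
  0x1210a700c46(P 0x2118083(P 0x2219060(P 0x8080208e1(P 0x1210e501026(C 1(P 0x80a009103(P
  0x121845004e3(P 0x80a009046(P 0x121905004e6(D 5)))))(L[::4;14;10;12;7;1;5;0](A(X 0x808129840)(A(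
  X 0x808409c60)(A(X 0x808221460)(A(X 0x808329040)(A(X 0x808338480)(A(X 0x8082384a0)(A(X 0x2219040
  )(A(X 0x2119040)(A(X 0x8c4419840)(A(X 0x2119040)(A(X 0x2118880)(A(X 0x8c4032082)(A(X 0x2219460)(
  A(X 0x2119460)(A(X 0x8c4512060)(A(X 0x8c40418a3)(A(X 0x2118ca0)(A(X 0x2110c01)(A(X 0x80a019482)(
  A(X 0x8ca830024)(A(X 0x21114c0)(A(X 0x2110801)(A(X 0x2111100)(A(X 0x8ca640025)(A(X 0x221a080)(A(
  X 0x2119100)(A(X 0x22198a0)(E))))))))))))))))))))))))))))))))))))))(D 5))))))))))))))(C 11(P
  0x80a508c40(P 0x80a2010a1(P 0x120866010a1(P 0x8c42204c0(P 0x2119840(P 0x80a010c25(P 0x8c40194c2(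
  P 0x1208a219006(P 0x21188c0(P 0x21180c2(P 0x2219840(C 8(P 0x80a4284e0(P 0x80a0398a4(P
  0x80a038c85(P 0x12100609447(P 0x80a5208e0(P 0x12100311027(P 0x80a0384a4(C 4(P 0x80a1408c0(P
  0x806031428(P 0x2111460(P 0x2111803(P 0x2111480(P 0x1208e401848(P 0x12144500d06(P 0x21114c0(C 9(
  P 0x8c6041c49(P 0x211a440(P 0x2118122(P 0x221a440(D 2)))))(F[::(1,3)]))))))))))(C 5(P
  0x12150601462(P 0x2111840(P 0x12146600905(P 0x21118a0(D 6)))))(C 7(P 0x8c6021428(P 0x211a020(P
  0x8c6039828(P 0x8c6019428(P 0x2118101(P 0x221a020(D 1)))))))(C 7(P 0x12102701868(P 0x21194c0(P
  0x21180c5(P 0x22198a0(D 6)))))(C 6(P 0x80a530900(P 0x8060404a6(P 0x80a0410a6(P 0x80a628d00(P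
  0x2110500(C 8(P 0x12102801c89(P 0x2111c02(P 0x2118122(D 7))))(F[::(1,0)])))))))(L[::11;17;10;12;
  7;1;5;0](A(X 0x808231460)(A(X 0x80863a020)(A(X 0x808522020)(A(X 0x808329040)(A(X 0x808612020)(A(
  P 0x80a1018a3(P 0x2111c02(P 0x12182322407(P 0x2118122(D 7)))))(A(X 0x2111003)(A(X 0x2111460)(A(X
  0x8ca618082)(A(X 0x80a0194c2)(A(X 0x2111480)(A(X 0x80a301046)(A(X 0x2219460)(A(X 0x2119460)(A(X
  0x8c4511c60)(A(X 0x2118ca0)(A(X 0x2118ca0)(A(X 0x2219840)(A(X 0x2119840)(A(X 0x8ca508044)(A(X
  0x21188c0)(A(X 0x2111c02)(A(X 0x8ca538044)(A(X 0x80a201c65)(A(X 0x2219480)(A(X 0x21190a0)(A(X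
  0x221a020)(E)))))))))))))))))))))))))))))))))))))))))(C 8(P 0x808028462(P 0x2119480(P 0x21190a0(
  P 0x12106601447(P 0x8080208c1(P 0x1210c301027(P 0x21180a4(P 0x2219480(C 1(P 0x80a009482(P
  0x12186600502(D 6)))(L[::20;17;10;12;7;1;5;0](A(X 0x808231460)(A(X 0x808131c60)(A(X 0x808129040)
  (A(X 0x808329040)(A(X 0x808130880)(A(X 0x2110c01)(A(X 0x2111460)(A(X 0x8ca618082)(A(X
  0x80a0194c2)(A(X 0x2111480)(A(X 0x2219460)(A(X 0x2119460)(A(X 0x8c4511c60)(A(X 0x2118ca0)(A(X
  0x2219840)(A(X 0x2119840)(A(X 0x8c4021cc2)(A(X 0x2110801)(A(X 0x8ca538044)(A(X 0x2219480)(E)))))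
  ))))))))))))))))))))))))))(D 6))))))))))))))(C 11(P 0x808021422(P 0x2119060(P 0x2118c80(P
  0x12104501026(P 0x12084429803(P 0x2118083(P 0x2219060(C 1(P 0x8080094c3(P 0x1218c4004e3(F[::(3,2
  )])))(C 1(P 0x80a129840(P 0x8ca0094c2(P 0x2111040(P 0x8ca0284e2(P 0x80a509c40(P 0x8c6510024(P
  0x80a0118a1(C 2(P 0x2118061(P 0x2218c20(D 1)))(D 0)))))))))(C 5(P 0x80a3214c0(P 0x80a031483(P
  0x12100728446(P 0x80a031c24(P 0x8c6130085(P 0x80a409cc0(P 0x8063204c0(P 0x8ca009046(P
  0x8ca0204e6(P 0x80a030881(C 5(P 0x21180a4(P 0x2219480(D 4)))(D 3))))))))))))(C 7(P 0x80a038c85(P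
  0x12100609447(D 5)))(C 0(P 0x808629060(P 0x808129840(P 0x8083384a0(P 0x8083208c0(P 0x808509c60(P
  0x808611020(C 8(P 0x80a612080(P 0x80a401cc2(P 0x12100830867(P 0x80a022046(P 0x12080811467(P
  0x21180a4(P 0x2219480(P 0x1208c441c05(P 0x21190a0(C 2(P 0x80a141c60(P 0x2111003(P 0x12080838d24(
  P 0x120807410c3(P 0x12100830524(C 2(P 0x12150101524(P 0x2110480(D 9)))(D 5)))))))(D 4)))))))))))
  (F[::(3,2)]))))))))(C 5(P 0x80a3018a1(P 0x12100728446(P 0x2118c80(P 0x80a019c25(P 0x12080709046(
  P 0x2118083(P 0x2219060(P 0x1208a339804(L[::4;20;10;12;7;1;5;0](A(X 0x2110c02)(A(X 0x2111460)(A(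
  X 0x80a0120e1)(A(X 0x8ca710081)(A(X 0x2112040)(A(X 0x2219460)(A(X 0x2119460)(A(X 0x8c40388a3)(A(
  X 0x8c40404a3)(A(X 0x2110c01)(A(X 0x2111c20)(A(X 0x8ca8080c2)(A(X 0x2219c20)(A(X 0x2119c20)(A(X
  0x221a040)(E)))))))))))))))))))))))))(F[::(2,1)]))))))))))))))(F[::(3,0)])))))))))))))))))))).

(** Literals that begin with [0x94] have first digit 5 and cite [c5_roof]. *)
Definition triangle_tree : tree :=
  P 0x2118820(P 0x2118440(P 0x2118041(P 0x2218820(C 3(C 6(P 0x2110480(C 8(P 0x8c4308085(P
  0x8c4310085(P 0x944308085(P 0x944310085(C 5(P 0x808231001(P 0x808129840(P 0x808129860(P
  0x808231420(P 0x944510086(P 0x808021841(P 0x944518086(P 0x808021861(P 0x944608085(P 0x808129002(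
  P 0x808021422(P 0x808129003(P 0x808021423(C 2(P 0x80a129840(P 0x80a0118a1(P 0x80a339840(P
  0x80a0118e3(P 0x80a0118e4(P 0x806339440(P 0x8c67100a6(P 0x808339420(P 0x2111840(P 0x808129c60(P
  0x808129c80(P 0x8c65100e6(P 0x806129c40(C 16(P 0x806119ca0(P 0x211a0a0(P 0x2118105(P 0x221a0a0(D
  5)))))(F[::(4,6)])))))))))))))))(C 13(P 0x806339440(P 0x2119840(P 0x21180c2(P 0x2219840(P
  0x806129c40(D 2))))))(C 18(P 0x80a129840(P 0x80a201ca1(P 0x8c46080e5(P 0x9467100a6(P 0x9466008a7
  (P 0x8080118a3(P 0x8080118a4(P 0x9446080e5(P 0x80a0118a1(P 0x2111c02(C 5(P 0x21180c2(P 0x2219840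
  (P 0x80a031c61(P 0x2119840(D 2)))))(F[::(1,7)]))))))))))))(F[::(1,4)])))))))))))))))))(C 5(P
  0x80a231420(P 0x80a231001(P 0x80a1010c2(P 0x806330801(P 0x80a0094c3(P 0x8c4510086(P 0x2111001(P
  0x80a0094c2(P 0x2111420(P 0x80a331001(P 0x80a1010c3(P 0x944518086(P 0x9464080c5(P 0x9465004c4(C
  11(P 0x80a039841(P 0x2119c80(P 0x80a039422(P 0x21180e4(P 0x2219c80(D 4))))))(C 11(P 0x80a4004a6(
  P 0x9467080c5(P 0x946239820(P 0x2118820(P 0x94a619c02(D 6))))))(F[::(3,2)])))))))))))))))))(C 5(
  P 0x80a129840(P 0x80a2010a1(P 0x808331001(P 0x80a129002(P 0x94a219880(P 0x2111002(P 0x9464100a6(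
  P 0x9466008a4(P 0x8082010a3(P 0x944608085(P 0x2111840(P 0x808129003(C 7(P 0x21180c2(P 0x2219840(
  P 0x80a031423(P 0x2119840(D 2)))))(F[::(1,6)]))))))))))))))(C 5(P 0x80a129860(P 0x80a3010a1(P
  0x808231001(P 0x80a129003(P 0x94a311880(P 0x2111003(P 0x9464180a6(P 0x8083010a2(P 0x946600ca4(P
  0x944608085(P 0x808129002(P 0x2111860(C 6(P 0x21180c2(P 0x2219840(P 0x80a031424(P 0x2119840(D 2)
  ))))(F[::(1,6)]))))))))))))))(C 5(P 0x80a129003(P 0x80a129840(P 0x2110c02(P 0x946600ca4(P
  0x94a329840(P 0x2111860(P 0x80a2010a1(F[::(3,4)]))))))))(D 3))))))))))(C 8(P 0x8c4310085(P
  0x808320022(P 0x946408065(P 0x946500464(P 0x808101062(P 0x94a111480(P 0x2111001(P 0x94a411420(P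
  0x2111420(C 1(P 0x80a0088c4(P 0x8c6608085(P 0x806331020(P 0x2110820(D 4)))))(C 2(P 0x80a331420(P
  0x2218820(P 0x806430c01(P 0x2118440(P 0x946229801(P 0x2118820(D 0)))))))(C 4(P 0x946121440(P
  0x2118440(P 0x80a1010c3(P 0x946131402(D 5)))))(F[::(0,5)])))))))))))))(C 8(P 0x8c4308085(P
  0x808320041(P 0x946410065(P 0x808201061(P 0x946500864(P 0x94a209480(P 0x2111002(P 0x2111440(C 1(
  P 0x80a008cc4(P 0x8c6608085(P 0x806231020(P 0x2110c20(D 4)))))(C 3(P 0x80a231420(P 0x808428402(P
  0x2218c20(P 0x2118460(P 0x946329801(P 0x2118c20(D 0)))))))(C 4(P 0x946121460(P 0x2118460(D 5)))(
  F[::(0,5)]))))))))))))(C 8(P 0x2110801(P 0x946408065(P 0x946500464(P 0x94a119440(P 0x946500864(P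
  0x2111420(P 0x2111440(C 7(P 0x80a021423(P 0x8c4518086(P 0x80a021841(P 0x80a209480(F[::(3,5)]))))
  )(D 3)))))))))(D 3))))))(C 6(P 0x2118081(P 0x2219020(D 4)))(D 3)))(D 2))))).

End Trees.

Lemma c5_cap_refuted : check base_codes c5_cap_tree c5_cap (all_types 6).
Proof. by vm_compute. Qed.

Lemma c5_roof_ear_refuted : check (base_codes ++ [:: c5_cap]) c5_roof_ear_tree c5_roof_ear (all_types 7).
Proof. by vm_compute. Qed.

Lemma c5_roof_refuted : check (base_codes ++ [:: c5_cap; c5_roof_ear]) c5_roof_tree c5_roof (all_types 6).
Proof. by vm_compute. Qed.

Lemma triangle_refuted :
  check (base_codes ++ [:: c5_cap; c5_roof_ear; c5_roof]) triangle_tree (clique_code 3) (all_types 3).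
Proof. by vm_compute. Qed.

Local Opaque line_adj line_of_row.

(** * Soundness of the certificates *)

(** These are the consequences of the hypotheses on which the certificates rely. The first three
    come from criticality alone; [no_image] also uses that [G] is not the 25-vertex graph. *)
Record irreducible (G : sgraph) : Prop := Irreducible {
  min_degree : forall x : G, 4 < #|[set y | edge x y]|;
  hom_surj : forall h : G -> G,
    (forall x y, edge x y -> edge (h x) (h y)) -> forall z, exists x, h x = z;
  connected : forall B : {set G}, B != set0 -> ~: B != set0 ->
    exists x y, [/\ x \in B, y \notin B & edge x y];
  no_image : forall f : G -> nat, (forall x, f x < 27) -> injective f ->
    ~ (forall x y, edge x y = line_adj (f x) (f y)) }.

Definition state (G : sgraph) (F L : seq bitseq) (s : seq G) : Prop :=
  [/\ uniq s, rows (@edge G) s = F & forall y, y \notin s -> row (@edge G) y s \in L].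

Definition refuted (G : sgraph) (F L : seq bitseq) : Prop := forall s : seq G, ~ state F L s.

Lemma mem_ext b t L : t \in L -> b :: t \in ext L.
Proof.
move=> tL; apply/flattenP; exists [:: false :: t; true :: t]; first exact: map_f.
by case: b; rewrite !inE eqxx ?orbT.
Qed.

Lemma state_cons (G : sgraph) F L (s : seq G) y :
  state F L s -> y \notin s -> state (row (@edge G) y s :: F) (ext L) (y :: s).
Proof.
move=> [us Fs Ls] ys; split=> [||z]; rewrite /= ?ys ?Fs //.
by rewrite inE negb_or => /andP[_ zs]; apply/mem_ext/Ls.
Qed.

Lemma mem_cut (T : eqType) (x0 x : T) i s :
  x \in s -> x != nth x0 s i -> x \in take i s ++ drop i.+1 s.
Proof.
case: (ltnP i (size s)) => lt_i; last by rewrite take_oversize // mem_cat => ->.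
rewrite -{1}(cat_take_drop i s) (drop_nth x0) // !mem_cat inE.
by move=> /orP[->//|/orP[/eqP->|->]]; rewrite ?eqxx ?orbT.
Qed.

Lemma uniq_insert j m : uniq (iota 1 j ++ 0 :: iota j.+1 m).
Proof.
rewrite cat_uniq /= !iota_uniq mem_iota negb_or mem_iota ltnn /= andbT.
by apply/hasPn => i; rewrite !mem_iota => /andP[lt_i _]; rewrite negb_and orbC -leqNgt add1n lt_i.
Qed.

(** A row that matches would make [y], inserted at place [j] among the vertices [qs] of [s], an
    ordered copy of a forbidden graph. *)
Lemma witness_sound (G : sgraph) fs F w r (s : seq G) y :
  (forall c, c \in fs -> avoids G c) -> witness fs F w = Some r ->
  uniq s -> rows (@edge G) s = F -> y \notin s -> ~~ matches r (row (@edge G) y s).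
Proof.
move=> avoid_fs; rewrite /witness; case: (digits w) => // k [//|j qs].
case: ifP => // /and5P[lt_k le_j uq lt_qs /eqcodeP eP] [<-] us Fs ys; apply/negP => /eqbitsP /=.
set bs := (X in _ = X) => ybs.
have lt_s : all (gtn (size s)) qs by rewrite -(size_rows (@edge G)) Fs.
(* The copy is first listed with [y] in front, where its code is known; the permutation of places is
   applied afterwards. *)
pose s' := y :: [seq nth y s q | q <- qs].
have us' : uniq s'.
  rewrite /= map_inj_in_uniq ?uq ?andbT => [|p q pq qq]; last first.
    move/eqP; rewrite nth_uniq ?us //; first by move/eqP.
      exact: (allP lt_s).
    exact: (allP lt_s).
  apply: contra ys => /mapP[q qq ->]; apply: mem_nth; exact: (allP lt_s).
have rs' : rows (@edge G) s' = bs :: rows (adj F) qs.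
  rewrite /= -Fs (rows_adj y) //; [|exact: edge_sym|exact: edge_irr].
  congr (_ :: _); rewrite -ybs /row -map_comp; apply/eq_in_map => q qq /=.
  by rewrite (nth_row _ _ y) //; exact: (allP lt_s).
apply: (avoid_fs _ (mem_nth [::] lt_k) [seq nth y s' p | p <- iota 1 j ++ 0 :: iota j.+1 (size qs - j)]).
  rewrite map_inj_in_uniq ?uniq_insert // => p q.
  have lt_p i : i \in iota 1 j ++ 0 :: iota j.+1 (size qs - j) -> i < size s'.
    rewrite /= size_map mem_cat inE !mem_iota [j.+1 + _]addSn subnKC // add1n !ltnS.
    by case/or3P => [/andP[_ /leq_trans->]|/eqP->|/andP[_ ->]].
  by move=> /lt_p ip /lt_p iq /eqP; rewrite nth_uniq // => /eqP.
rewrite -eP -rs' (rows_adj y) //; [exact: edge_sym|exact: edge_irr|].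
apply/allP=> i /=; rewrite size_map mem_cat inE !mem_iota [j.+1 + _]addSn subnKC // add1n !ltnS.
by case/or3P => [/andP[_ /leq_trans->]|/eqP->|/andP[_]].
Qed.

Lemma prune_sound (G : sgraph) fs F w L (s : seq G) :
  (forall c, c \in fs -> avoids G c) -> state F L s -> state F (prune fs F w L) s.
Proof.
move=> avoid_fs [us Fs Ls]; split=> // y ys; rewrite /prune.
case def_r: (witness fs F w) => [r|]; last exact: Ls.
by rewrite mem_filter (witness_sound avoid_fs def_r) ?Ls.
Qed.

(** No outside vertex is adjacent to vertex [i], so all its neighbours lie in [s], and there are at
    most four of them. *)
Lemma deg_sound (G : sgraph) F L i : irreducible G -> deg_ok F L i -> refuted G F L.
Proof.
move=> irrG /and3P[lt_i deg_i /allP L_i] s [us Fs Ls].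
have{} lt_i: i < size s by rewrite -(size_rows (@edge G)) Fs.
case: s => [//|x0 s0] in us Fs Ls lt_i *; set s := x0 :: s0 in us Fs Ls lt_i.
have := min_degree irrG (nth x0 s i); rewrite ltnNge => /negP; apply.
rewrite -ltnS; apply: leq_ltn_trans deg_i.
rewrite -Fs size_rows -size_filter -(size_map (nth x0 s)) cardE.
apply: uniq_leq_size; first exact: enum_uniq.
move=> y; rewrite mem_enum inE => e_iy.
have ys : y \in s.
  apply/negPn/negP => ys; have := L_i _ (Ls _ ys).
  by rewrite (nth_row _ _ x0) // edge_sym e_iy.
apply/mapP; exists (index y s); last by rewrite nth_index.
have [sy ir] := (@edge_sym G, @edge_irr G).
by rewrite mem_filter mem_iota add0n index_mem ys andbT (adjE x0) ?index_mem ?nth_index ?e_iy.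
Qed.

(** The map on [s], extended by the identity, is an endomorphism of [G] whose image misses the
    vertex [a] of [s]. *)
Lemma fold_sound (G : sgraph) F L ab : irreducible G -> fold_ok F L ab -> refuted G F L.
Proof.
move=> irrG; rewrite /fold_ok; case: ab => // -[a b] ab'; set ab := _ :: ab'.
move=> /and4P[lt_a /allP h_ok /allP h_in /allP h_out] s [us Fs Ls].
have sF : size F = size s by rewrite -Fs size_rows.
rewrite sF in lt_a h_ok h_in h_out.
case: s => [//|x0 s0] in us Fs Ls sF lt_a h_ok h_in h_out; set s := x0 :: s0 in us Fs Ls sF lt_a h_ok h_in h_out.
pose h := lookup ab; pose g x := if x \in s then nth x0 s (h (index x s)) else x.
have ix x : x \in s -> index x s \in iota 0 (size s) by rewrite mem_iota add0n index_mem.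
have lt_h x : x \in s -> h (index x s) < size s by move=> /ix/h_ok/andP[].
(* For an edge that leaves [s], the condition on the rows is exactly what is required. *)
have out x y : x \in s -> y \notin s -> edge x y -> edge (g x) y.
  move=> xs ys; rewrite /g xs edge_sym [edge (nth _ _ _) _]edge_sym.
  have /allP/(_ _ (ix _ xs)) := h_out _ (Ls _ ys).
  by rewrite !(nth_row _ _ x0) ?lt_h ?index_mem // nth_index // => /implyP.
have [x y|x gx] := hom_surj irrG (h := g) _ (nth x0 s a).
  case xs: (x \in s); case ys: (y \in s).
  - move=> exy; rewrite /g xs ys.
    have /allP/(_ _ (ix _ ys)) := h_in _ (ix _ xs).
    have [sy ir] := (@edge_sym G, @edge_irr G).
    by rewrite -Fs !(adjE x0) ?lt_h ?index_mem // !nth_index // exy.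
  - by move=> exy; rewrite {2}/g ys; apply: out; rewrite ?ys.
  - by rewrite edge_sym [edge (g x) _]edge_sym => exy; rewrite {2}/g xs; apply: out; rewrite ?xs.
  - by rewrite /g xs ys.
move: gx; rewrite /g; case: ifP => [xs|xs eq_x]; last by rewrite eq_x mem_nth in xs.
move/eqP; rewrite nth_uniq ?lt_h //.
by have /andP[_ /negPf->] := h_ok _ (ix _ xs).
Qed.

Lemma mem_pairs (T : eqType) (s : seq T) x y :
  x \in s -> y \in s -> ((x, y) \in pairs s) || ((y, x) \in pairs s).
Proof.
elim: s => //= z s IH; rewrite !inE !mem_cat => /orP[/eqP->|xs] /orP[/eqP->|ys].
- by rewrite eqxx.
- by rewrite [(z, y) \in _](map_f (pair z)) ?orbT // inE ys orbT.
- by rewrite [(z, x) \in _](map_f (pair z)) ?orbT // inE xs orbT.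
- by have /orP[->|->] := IH xs ys; rewrite ?orbT.
Qed.

(** Sending every vertex of [s] to its line in [m], and every other vertex to the line with its row,
    yields an induced embedding into the 27 lines, against [no_image]. It remains to show that edges
    agree, that every outside vertex has a line, and that the map is injective. *)
Lemma leaf_sound (G : sgraph) F L m : irreducible G -> leaf_ok F L m ->
  (forall F2, F2 \in leaf_codes F L m -> refuted G F2 (ext (ext L))) -> refuted G F L.
Proof.
move=> irrG /and5P[F_gt0 um /allP lt_m /eqcodeP Fm /allP L_ok] ref s stF.
have [us Fs Ls] := stF.
have sz_m : size m = size s by rewrite -(size_rows line_adj) Fm -Fs size_rows.
case: s => [|x0 s0] in us Fs Ls stF sz_m *; first by rewrite -Fs in F_gt0.
set s := x0 :: s0 in us Fs Ls stF sz_m.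
pose ty y := row (@edge G) y s; pose hh y := line_of_row m (ty y).
have edge_out y z : y \notin s -> z \notin s -> y != z -> (hh y < 27) || (hh z < 27) ->
    edge y z = line_adj (hh y) (hh z).
  move=> ys zs yz lt_yz.
  (* The list [pairs] may contain the two rows in one order only, so the claim is proved for the
     order that is listed. A wrong adjacency would give a state that [ref] excludes. *)
  have wlog a b : a \notin s -> b \notin s -> a != b -> (hh a < 27) || (hh b < 27) ->
      ((ty a, hh a), (ty b, hh b)) \in pairs [seq (t, line_of_row m t) | t <- L] ->
      edge a b = line_adj (hh a) (hh b).
    move=> as_ bs ab lt_ab in_ab; apply/eqP/negPn/negP => ne_ab.
    have st_a := state_cons stF as_.
    have bas : b \notin a :: s by rewrite inE negb_or eq_sym ab.
    have st_b := state_cons st_a bas.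
    apply: ref st_b; apply/mapP; exists ((ty a, hh a), (ty b, hh b)).
      by rewrite mem_filter lt_ab.
    congr (_ :: _); rewrite /row /= -/(row (@edge G) b s); congr (_ :: _).
    by rewrite edge_sym; case: (edge a b) ne_ab; case: (line_adj _ _).
  have inL w : w \notin s -> (ty w, hh w) \in [seq (t, line_of_row m t) | t <- L].
    by move=> ws; apply/mapP; exists (ty w) => //; apply: Ls.
  have /orP[] := mem_pairs (inL _ ys) (inL _ zs); first exact: wlog.
  rewrite edge_sym line_adj_sym => in_zy; apply: (wlog _ _ zs ys _ _ in_zy).
    by rewrite eq_sym.
  by rewrite orbC.
(* The vertices without a line have zero rows, and they are not adjacent to vertices that have a
   line, since [line_adj] vanishes at 27. So no edge would leave their set, against
   connectedness. *)
have [lt_hh|/existsP[y0]] := boolP [forall y, (y \notin s) ==> (hh y < 27)]; last first.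
  rewrite negb_imply => /andP[y0s hy0].
  have [||x [y [/setIdP[_ /andP[xs hx]] yB exy]]] :=
    connected irrG (B := [set y in predT | (y \notin s) && ~~ (hh y < 27)]).
  - by apply/set0Pn; exists y0; rewrite !inE y0s.
  - by apply/set0Pn; exists x0; rewrite !inE eqxx.
  have /orP[lt_x|tx] := L_ok _ (Ls _ xs); first by rewrite lt_x in hx.
  have ys : y \notin s.
    apply: contra tx => ys; apply/hasP; exists true => //.
    by apply/mapP; exists y.
  have lt_y : hh y < 27 by move: yB; rewrite !inE /= ys /= negbK.
  have xy : x != y by apply: contraTneq exy => ->; rewrite edge_irr.
  have lt_xy : (hh x < 27) || (hh y < 27) by apply/orP; right.
  have le_x : 27 <= hh x by rewrite leqNgt.
  by rewrite (edge_out _ _ xs ys xy lt_xy) line_adj_sym (line_adj_out _ le_x) in exy.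
have{} lt_hh y : y \notin s -> hh y < 27 by apply/implyP/(forallP lt_hh).
pose f x := if x \in s then nth 27 m (index x s) else hh x.
have f_in x : x \in s -> nth 27 m (index x s) \in m.
  by move=> xs; rewrite mem_nth // sz_m index_mem.
have f_io x y : x \in s -> y \notin s -> edge y x = line_adj (f y) (f x).
  move=> xs ys; rewrite /f xs (negPf ys).
  have [_] := line_of_rowP (lt_hh _ ys); rewrite -/(hh y) /ty => row_y.
  have lt_x : index x s < size s by rewrite index_mem.
  by rewrite -(nth_row _ _ 27) ?sz_m // row_y (nth_row _ _ x0) // nth_index.
have f_e x y : x != y -> edge x y = line_adj (f x) (f y).
  move=> xy; case xs: (x \in s); case ys: (y \in s).
  - rewrite /f xs ys.
    have [sy ir] := (@edge_sym G, @edge_irr G).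
    have [hs hi] := (line_adj_sym, line_adj_irr).
    rewrite -(adjE 27) ?sz_m ?index_mem // Fm -Fs (adjE x0) ?index_mem //.
    by rewrite !nth_index.
  - by rewrite edge_sym line_adj_sym f_io ?ys.
  - by rewrite f_io ?xs.
  - have [xs' ys'] := (negbT xs, negbT ys).
    have lt_xy : (hh x < 27) || (hh y < 27) by apply/orP; left; apply: lt_hh.
    by rewrite /f xs ys; apply: edge_out.
have f_ee x y : edge x y = line_adj (f x) (f y).
  by case: (eqVneq x y) => [->|/f_e//]; rewrite edge_irr line_adj_irr.
have f_lt x : f x < 27.
  by rewrite /f; case: ifP => [xs|/negbT/lt_hh]; first by apply: lt_m; apply: f_in.
apply: (no_image irrG f_lt _ f_ee) => x y eq_f.
apply/eqP/negPn/negP => xy.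
(* Two vertices on the same line would be twins; mapping [x] to [y] and fixing the rest would be an
   endomorphism that misses [x]. *)
have eq_e z : edge x z = edge y z by rewrite !f_ee eq_f.
have hom a b : edge a b -> edge (if a == x then y else a) (if b == x then y else b).
  case: (eqVneq a x) => [->|_]; case: (eqVneq b x) => [->|_] e_ab.
  - by rewrite edge_irr in e_ab.
  - by rewrite -eq_e.
  - by rewrite edge_sym -eq_e edge_sym.
  - exact: e_ab.
have [z] := hom_surj irrG hom x.
by case: eqP => [_ yx|zx zx']; [rewrite yx eqxx in xy | case: zx].
Qed.

(** The recursion follows the certificate, since [F] grows on the way. It is mutual because the
    subtrees of a leaf are strung together by [And]. *)
Fixpoint check_sound (G : sgraph) fs tr (irrG : irreducible G)
    (fsG : forall c, c \in fs -> avoids G c) {struct tr} :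
  forall F L, check fs tr F L -> refuted G F L
with checks_sound (G : sgraph) fs tr (irrG : irreducible G)
    (fsG : forall c, c \in fs -> avoids G c) {struct tr} :
  forall L Fs, checks fs tr L Fs -> forall F, F \in Fs -> refuted G F L.
Proof.
- case: tr => [w tr|i tr1 tr2|i|ab|w|m tr|tr1 tr2|] F L //=.
  + move=> /(check_sound G _ _ irrG fsG) ref s /(prune_sound w fsG); exact: ref.
  + move=> /andP[/(check_sound G _ _ irrG fsG) ref1 /(check_sound G _ _ irrG fsG) ref2] s st.
    apply: (ref2 s); have [us Fs Ls] := st; split=> // y ys.
    apply: (@mem_cut _ [::]); first exact: Ls.
    (* A vertex with row number [i] could be added to [s], which the first subtree refutes; so the
       row may be dropped. *)
    by apply/eqP => eq_y; apply: (ref1 (y :: s)); rewrite -eq_y; apply: state_cons.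
  + exact: deg_sound.
  + exact: fold_sound.
  (* At a [Clash] the front vertex itself completes a forbidden graph with the rest of [s]. *)
  + case: F => // t F; case def_r: (witness fs F w) => [r|] // mt [|y s] [] //= /andP[ys us].
    by case=> def_t Fs _; move: (witness_sound fsG def_r us Fs ys); rewrite def_t mt.
  + move=> /andP[ok /(checks_sound G _ _ irrG fsG) ref]; exact: leaf_sound ref.
- case: tr => [w tr|i tr1 tr2|i|ab|w|m tr|tr1 tr2|] L [|F Fs] //=.
  move=> /andP[/(check_sound G _ _ irrG fsG) ref1 /(checks_sound G _ _ irrG fsG) ref2] F'.
  by rewrite inE => /predU1P[->|/ref2].
Qed.

Lemma mem_all_types (G : sgraph) (y : G) s : row (@edge G) y s \in all_types (size s).
Proof. by elim: s => //= x s; apply: mem_ext. Qed.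

Lemma avoids_check (G : sgraph) fs tr F : irreducible G ->
  (forall c, c \in fs -> avoids G c) -> check fs tr F (all_types (size F)) -> avoids G F.
Proof.
move=> irrG fsG /(check_sound irrG fsG) ref s us Fs; apply: (ref s); split=> // y _.
by rewrite -Fs size_rows mem_all_types.
Qed.

(** * The colour search *)

Lemma has_cliqueP k s : has_clique k s ->
  exists t, [/\ size t = k, {subset t <= s} & pairwise line_adj t].
Proof.
elim: k s => [|k IHk] s; first by exists [::].
elim: s => [|x s IHs] //=; case: ifP => [/IHk[t [st ts pt]] _|_ /IHs[t [st ts pt]]]; last first.
  by exists t; split=> // y /ts ys; rewrite inE ys orbT.
exists (x :: t); split=> [||/=]; rewrite /= ?st // ?pt ?andbT.
  by move=> y /predU1P[->|/ts]; rewrite inE ?eqxx // mem_filter => /andP[_ ->]; rewrite orbT.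
by apply/allP => y /ts; rewrite mem_filter => /andP[].
Qed.

(** Pigeonhole principle: the vertices of the clique would have [k.+1] different colours below
    [k]. *)
Lemma has_clique_col k s (c : nat -> nat) : has_clique k.+1 s ->
  {in s &, forall x y, line_adj x y -> c x != c y} -> ~ {in s, forall x, c x < k}.
Proof.
move=> /has_cliqueP[t [st ts pt]] pc lt_c.
suff: size (map c t) <= size (iota 0 k) by rewrite size_map size_iota st ltnn.
apply: uniq_leq_size => [|_ /mapP[x /ts xs ->]]; last by rewrite mem_iota lt_c.
rewrite uniq_pairwise pairwise_map; apply: (sub_in_pairwise (P := mem t)) pt; last exact/allP.
by move=> x y /ts xs /ts ys; apply: pc.
Qed.

Lemma count_mem_filter (x : nat) (a : pred nat) s :
  count_mem x [seq y <- s | a y] = if a x then count_mem x s else 0.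
Proof.
elim: s => //= [|y s IH]; first by case: ifP.
case: (eqVneq y x) => [->|yx]; case: ifP => ay /=; rewrite ?IH ?ay ?eqxx ?(negPf yx) //.
Qed.

(** The colouring varies in the induction, because it is changed twice: two colours are exchanged
    when a class is started, and a vertex without neighbours in the class is moved into it. The last
    condition records the maximality of the class that is being built. *)
Lemma no_coloring_sound n k cand out ob (c : nat -> nat) : no_coloring n k cand out ob ->
  uniq (cand ++ ob ++ out) -> {in cand ++ ob ++ out &, forall x y, line_adj x y -> c x != c y} ->
  {in cand, forall x, c x <= k} -> {in ob ++ out, forall x, c x < k} ->
  ~ {in ob, forall x, exists2 y, y \in cand & line_adj x y && (c y == k)}.
Proof.
elim: n k cand out ob c => //= n IH k cand out ob c.
case: ifP => [bad _ _ pc _ lt_c _|_].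
  case: ifP bad => // _ /has_clique_col/(_ _ lt_c); apply=> x y xs ys.
  by apply: pc; rewrite mem_cat ?xs ?ys orbT.
case: cand => [|p cand].
  case: ob => [|o ob] => [|_ _ _ _ _ /(_ o)]; last by rewrite inE eqxx => /(_ isT)[].
  case: k => // k; case: out => //= v r ok /andP[_ ur] pc _ lt_c _.
  have lt_v : c v <= k by apply: lt_c; rewrite inE eqxx.
  (* Exchanging the colours [c v] and [k] makes the class of [v] the class number [k]. *)
  pose tr a := if a == c v then k else if a == k then c v else a.
  have trK : involutive tr.
    move=> a; rewrite /tr; case: (eqVneq a (c v)) => [->|av]; first by rewrite eqxx; case: eqVneq.
    by case: (eqVneq a k) => [->|ak]; rewrite ?eqxx // (negPf av) (negPf ak).
  pose c' x := tr (c x).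
  have c'E x y : (c' x == c' y) = (c x == c y) by rewrite (inj_eq (inv_inj trK)).
  have le_c' x : c x <= k -> c' x <= k by rewrite /c' /tr; do 2?case: ifP.
  apply: (IH _ _ _ _ c' ok) => [|x y|x|x|//].
  - by rewrite /= (perm_uniq (permEl (perm_catC _ _))) (perm_uniq (permEl (perm_filterC _ _))).
  - rewrite !mem_cat !mem_filter /= => xr yr exy; rewrite c'E; apply: pc exy.
      by rewrite inE; case/orP: xr => /andP[_ ->]; rewrite orbT.
    by rewrite inE; case/orP: yr => /andP[_ ->]; rewrite orbT.
  - by rewrite mem_filter => /andP[_ xr]; apply/le_c'/lt_c; rewrite inE xr orbT.
  - rewrite mem_filter => /andP[vx xr]; rewrite ltn_neqAle le_c' ?andbT; last first.
      by apply: lt_c; rewrite inE xr orbT.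
    have <- : c' v = k by rewrite /c' /tr eqxx.
    by rewrite c'E eq_sym pc // inE ?eqxx ?xr ?orbT.
case: ifP => // ok1 ok2 us pc le_c lt_c obl.
(* The branch in which [p] joins the class is stated for any colouring [d]: it is used for [c]
   itself and for [c] with [p] recoloured. *)
have IN (d : nat -> nat) : d p = k ->
    {in (p :: cand) ++ ob ++ out &, forall x y, line_adj x y -> d x != d y} ->
    {in p :: cand, forall x, d x <= k} -> {in ob ++ out, forall x, d x < k} ->
    ~ {in ob, forall x, exists2 y, y \in p :: cand & line_adj x y && (d y == k)}.
  move=> dp pd le_d lt_d obl_d.
  have sub x : x \in [seq q <- cand | ~~ line_adj p q] ++ [seq q <- ob | ~~ line_adj p q] ++
      [seq q <- cand | line_adj p q] ++ [seq q <- ob | line_adj p q] ++ out ->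
      x \in (p :: cand) ++ ob ++ out.
    rewrite !(mem_cat, mem_filter, inE).
    by case: (x \in cand); case: (x \in ob); case: (x \in out); rewrite ?andbF ?orbT.
  apply: (IH _ _ _ _ d ok1) => [|x y xs ys|x|x|x].
  - have us' : uniq (cand ++ ob ++ out) by case/andP: us.
    apply: etrans us'; apply: perm_uniq; apply/allP => x _ /=.
    by rewrite !count_cat !count_mem_filter; case: (line_adj p x); rewrite !add0n.
  - by apply: pd; apply: sub.
  - by rewrite mem_filter => /andP[_ xc]; apply: le_d; rewrite inE xc orbT.
  - rewrite !(mem_cat, mem_filter) => /or4P[/andP[_ xo]|/andP[px xc]|/andP[_ xo]|xo].
    + by apply: lt_d; rewrite mem_cat xo.
    + rewrite ltn_neqAle le_d ?inE ?xc ?orbT // -dp eq_sym pd //.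
        by rewrite !(mem_cat, inE) eqxx.
      by rewrite !(mem_cat, inE) xc orbT.
    + by apply: lt_d; rewrite mem_cat xo.
    + by apply: lt_d; rewrite mem_cat xo orbT.
  - rewrite mem_filter => /andP[px xo]; have [y] := obl_d x xo.
    rewrite inE => /predU1P[->|yc] /andP[xy dy]; first by rewrite line_adj_sym xy in px.
    exists y; last by rewrite xy.
    rewrite mem_filter yc andbT; apply/negP => py.
    have /eqP[] : d p != d y.
      by apply: pd py; rewrite !(mem_cat, inE) ?eqxx ?yc ?orbT.
    by rewrite dp (eqP dy).
have [cp|cp] := eqVneq (c p) k; first exact: IN cp pc le_c lt_c obl.
have lt_cp : c p < k by rewrite ltn_neqAle cp le_c ?inE ?eqxx.
(* Here [p] lies outside the class. If it has a neighbour [q] in the class among the candidates, it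
   satisfies the condition on [ob] and goes there. *)
have [/hasP[q qc /andP[pq cq]]|/hasPn no_q] := boolP (has (fun q => line_adj p q && (c q == k)) cand).
  have ok : no_coloring n k cand out (p :: ob).
    by move: ok2; case: ifP => // /negP[]; apply/hasP; exists q.
  have sub x : x \in cand ++ (p :: ob) ++ out -> x \in (p :: cand) ++ ob ++ out.
    rewrite !(mem_cat, inE) -!orbA => /or4P[->|->|->|->]; rewrite ?orbT //.
  apply: (IH _ _ _ _ c ok) => [|x y xs ys|x xc|x|x].
  - apply: etrans us; apply: perm_uniq; apply/allP => x _ /=.
    by rewrite !count_cat /= !count_cat addnCA.
  - by apply: pc; apply: sub.
  - by apply: le_c; rewrite inE xc orbT.
  - by rewrite inE => /predU1P[->//|]; apply: lt_c.
  - rewrite inE => /predU1P[->|xo]; first by exists q; rewrite ?pq.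
    have [y] := obl x xo; rewrite inE => /predU1P[->|yc]; last by exists y.
    by case/andP=> _ /eqP eq_cp; rewrite eq_cp eqxx in cp.
(* Now [p] has no neighbour in the class, so it can be moved into it. *)
pose d x := if x == p then k else c x.
have dp : d p = k by rewrite /d eqxx.
have dE x : x \in cand ++ ob ++ out -> d x = c x.
  by rewrite /d; case: eqP => // -> p_in; case/andP: us; rewrite p_in.
have dout x : x \in ob ++ out -> d x = c x by move=> xo; apply: dE; rewrite mem_cat xo orbT.
have d_p x : x \in cand ++ ob ++ out -> line_adj p x -> d p != d x.
  move=> xs px; rewrite dp dE //; rewrite mem_cat in xs; case/orP: xs => [xc|xo].
    by have := no_q x xc; rewrite px eq_sym.
  by rewrite neq_ltn orbC lt_c.
apply: (IN d dp) => [x y|x|x xo|x xo].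
- rewrite !inE => /predU1P[->|xs] /predU1P[->|ys] xy.
  + by rewrite line_adj_irr in xy.
  + exact: d_p.
  + by rewrite eq_sym d_p // line_adj_sym.
  + by rewrite !dE // pc // inE ?xs ?ys orbT.
- rewrite inE => /predU1P[->|xc]; first by rewrite dp.
  by rewrite dE ?le_c ?inE ?xc ?orbT // mem_cat xc.
- by rewrite dout ?lt_c.
- have [y] := obl x xo; rewrite inE => /predU1P[->|yc] /andP[xy /eqP cy].
    by rewrite cy eqxx in cp.
  by exists y; rewrite ?inE ?yc ?orbT // xy dE ?cy //= mem_cat yc.
Qed.

(** * Symmetry of the 27 lines *)

Lemma line_gq u v : u < 27 -> v < 27 -> line_adj u v ->
  exists w, [/\ w < 27, line_adj u w, line_adj v w &
    forall z, z < 27 -> (z \in [:: u; v; w]) || (line_adj z u + line_adj z v + line_adj z w == 1)].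
Proof.
move=> lt_u lt_v uv; have /allP/(_ u) := line_gq_okP; rewrite mem_iota lt_u => /(_ isT)/allP/(_ v).
rewrite mem_iota lt_v uv => /(_ isT); case: ifP => // lt_w /allP ok_w.
have has_w : has (fun w => if line_adj u w then line_adj v w else false) all_lines.
  by rewrite has_find size_iota.
have := nth_find 0 has_w; rewrite -/(third u v) nth_iota // add0n; case: ifP => // uw vw.
exists (third u v); split=> // z lt_z; have := ok_w z; rewrite mem_iota lt_z => /(_ isT).
by rewrite /third_ok; case: ifP => //= _ ->.
Qed.

Lemma autoP F : auto_ok F -> forall i j, i < 27 -> j < 27 ->
  line_adj (nth 27 F i) (nth 27 F j) = line_adj i j.
Proof.
move=> /and4P[_ _ _ /allP ok] i j lt_i lt_j.
have aux k l : k < 27 -> l < k -> line_adj (nth 27 F k) (nth 27 F l) = line_adj k l.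
  move=> lt_k lt_l; have := ok k; rewrite mem_iota lt_k => /(_ isT)/allP/(_ l).
  by rewrite mem_iota lt_l => /(_ isT)/eqP.
case: (ltngtP i j) => [lt_ij|lt_ji|->]; last by rewrite !line_adj_irr.
  by rewrite line_adj_sym aux // line_adj_sym.
exact: aux.
Qed.

Lemma auto_mem F x : auto_ok F -> x < 27 -> x \in F.
Proof.
move=> /and4P[/eqP sF /allP ltF uF _] lt_x.
have sub : {subset F <= all_lines} by move=> y /ltF; rewrite mem_iota.
have le_F : size all_lines <= size F by rewrite size_iota sF.
by have [_ ->] := uniq_min_size uF sub le_F; rewrite mem_iota.
Qed.

Lemma trans_aut u v : u < v -> v < 27 -> exists F, [/\ auto_ok F, nth 27 F a0 = u &
  nth 27 F (if line_adj u v then b1 else a1) = v].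
Proof.
move=> lt_uv lt_v; have lt_u := ltn_trans lt_uv lt_v.
have /allP/(_ u) := trans_okP; rewrite mem_iota lt_u => /(_ isT)/allP/(_ v).
rewrite mem_iota lt_uv addSn subnKC // lt_v => /(_ isT)/and3P[ok /eqP eu /eqP ev].
by exists (blowdown (six_through u v)).
Qed.

(** The colouring is composed with the inverse of the automorphism, which is [index _ F]. *)
Lemma colorable_off_aut F R : auto_ok F -> all (gtn 27) R ->
  colorable_off R -> colorable_off [seq nth 27 F i | i <- R].
Proof.
move=> okF /allP ltR [c cR]; have /and4P[/eqP sF _ _ _] := okF.
have ix x : x < 27 -> x \notin [seq nth 27 F i | i <- R] -> index x F < 27 /\ index x F \notin R.
  move=> lt_x xR; have xF := auto_mem okF lt_x.
  split; first by rewrite -[X in _ < X]sF index_mem.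
  by apply: contra xR => iR; apply/mapP; exists (index x F); rewrite ?nth_index.
exists (fun x => c (index x F)) => x lt_x /(ix _ lt_x)[lt_ix ixR].
have [lt_c c_edge] := cR _ lt_ix ixR; split=> // y lt_y /(ix _ lt_y)[lt_iy iyR] xy.
by apply: c_edge => //; rewrite -(autoP okF) // !nth_index ?auto_mem.
Qed.

Lemma colorable_off_sub R R' : {subset R <= R'} -> colorable_off R -> colorable_off R'.
Proof.
move=> sub [c cR]; exists c => x lt_x xR'.
have [|lt_c c_edge] := cR x lt_x; first by apply: contra xR'; apply: sub.
split=> // y lt_y yR'; apply: c_edge => //; by apply: contra yR'; apply: sub.
Qed.

Lemma colorable_off_nonadj u v : u < 27 -> v < 27 -> u != v -> ~~ line_adj u v -> colorable_off [:: u; v].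
Proof.
have aux x y : x < y -> y < 27 -> ~~ line_adj x y -> colorable_off [:: x; y].
  move=> lt_xy lt_y xy; have [F [okF ex]] := trans_aut lt_xy lt_y.
  rewrite (negPf xy) => ey; rewrite -ex -ey; exact: (colorable_off_aut okF _ colorable_off_a0a1).
move=> lt_u lt_v; case: ltngtP => // [lt_uv|lt_vu] _ uv; first exact: aux.
apply: (@colorable_off_sub [:: v; u]); last by apply: aux; rewrite // line_adj_sym.
by move=> x; rewrite !inE orbC.
Qed.

(** Only membership is compared, because the automorphism was computed for the increasing order of
    [u] and [v]. *)
Lemma edge_aut u v : u < 27 -> v < 27 -> line_adj u v -> exists F, auto_ok F /\
  [:: u; v] =i [:: nth 27 F a0; nth 27 F b1].
Proof.
move=> lt_u lt_v uv; case: (ltngtP u v) => [lt_uv|lt_vu|eq_uv].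
- have [F [okF eu]] := trans_aut lt_uv lt_v; rewrite uv => ev.
  by exists F; rewrite eu ev.
- have [F [okF ev]] := trans_aut lt_vu lt_u; rewrite line_adj_sym uv => eu.
  by exists F; rewrite eu ev; split=> // x; rewrite !inE orbC.
- by rewrite eq_uv line_adj_irr in uv.
Qed.

(** A vertex adjacent to both [u] and [v] violates the quadrangle axiom for the triangle on [uv],
    unless it is the third vertex of that triangle. *)
Lemma third_uniq u v w w' : u < 27 -> v < 27 -> w < 27 -> w' < 27 ->
  line_adj u v -> line_adj u w -> line_adj v w -> line_adj u w' -> line_adj v w' -> w = w'.
Proof.
have eq3 x : u < 27 -> v < 27 -> x < 27 -> line_adj u v -> line_adj u x -> line_adj v x ->
    forall z, z < 27 -> line_adj u z -> line_adj v z ->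
    (forall y, y < 27 -> (y \in [:: u; v; z]) || (line_adj y u + line_adj y v + line_adj y z == 1)) -> x = z.
  move=> lt_u lt_v lt_x uv ux vx z lt_z uz vz /(_ x lt_x).
  rewrite !inE [line_adj x u]line_adj_sym [line_adj x v]line_adj_sym ux vx /= orbF.
  case/or3P => /eqP // eq_x; first by rewrite eq_x line_adj_irr in ux.
  by rewrite eq_x line_adj_irr in vx.
move=> lt_u lt_v lt_w lt_w' uv uw vw uw' vw'.
have [z [lt_z uz vz ok]] := line_gq lt_u lt_v uv.
by rewrite (eq3 w _ _ _ _ _ _ z) // (eq3 w' _ _ _ _ _ _ z).
Qed.

(** An automorphism carries a_0 b_1 to [uv]; it then carries c_01 to [w], as the triangle on an edge
    is unique. *)
Lemma colorable_off_triangle u v w : u < 27 -> v < 27 -> w < 27 ->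
  line_adj u v -> line_adj u w -> line_adj v w -> colorable_off [:: u; v; w].
Proof.
move=> lt_u lt_v lt_w uv uw vw; have [F [okF eq_uv]] := edge_aut lt_u lt_v uv.
have [ab ac bc] := line_adj_a0b1c01.
have okFF := okF; have /and4P[/eqP sF /allP ltF _ _] := okFF.
have ltF' i : i < 27 -> nth 27 F i < 27 by move=> lt_i; apply/ltF/mem_nth; rewrite sF.
have adjc x : x \in [:: u; v] -> line_adj x (nth 27 F c01).
  by rewrite eq_uv !inE => /orP[]/eqP->; rewrite (autoP okF).
have eq_w : w = nth 27 F c01.
  apply: (third_uniq lt_u lt_v) => //; first exact: ltF'.
    by apply: adjc; rewrite inE eqxx.
  by apply: adjc; rewrite !inE eqxx orbT.
apply: colorable_off_sub (colorable_off_aut okF _ colorable_off_a0b1c01) => // x /=.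
have := eq_uv x; rewrite !inE eq_w orbA => <-; by rewrite orbA.
Qed.

(** * Colourings and the theorem *)

Lemma colorableP (G : sgraph) k :
  reflect (exists2 c : G -> nat, forall x, c x < k & forall x y, edge x y -> c x != c y)
          (colorable G k).
Proof.
apply: (iffP existsP) => [[c /forallP c_ok]|[c lt_c c_ok]].
  exists (fun x => val (c x)) => [x|x y xy]; first exact: ltn_ord.
  by have /forallP/(_ y)/implyP := c_ok x; apply.
exists [ffun x => Ordinal (lt_c x)]; apply/forallP => x; apply/forallP => y.
by apply/implyP => xy; rewrite !ffunE; apply: contra (c_ok x y xy) => /eqP[->].
Qed.

Lemma chromatic_leq (G : sgraph) k : (chromatic_number G <= k) = colorable G k.
Proof.
rewrite /chromatic_number; case: ex_minnP => m /colorableP[c lt_c c_ok] min_m.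
apply/idP/idP => [le_mk|]; last exact: min_m.
by apply/colorableP; exists c => // x; apply: leq_trans le_mk.
Qed.

Lemma vertex_criticalP (G : sgraph) k : vertex_critical k.+1 G <->
  [/\ ~~ colorable G k, colorable G k.+1 &
      forall S : {set G}, S \proper [set: G] -> colorable (induced S) k].
Proof.
rewrite -!chromatic_leq; split=> [[-> crit]|[]].
  by rewrite ltnn leqnn; split=> // S /crit; rewrite ltnS chromatic_leq.
rewrite -ltnNge => gt_k le_k crit; split; first by apply/eqP; rewrite eqn_leq le_k.
by move=> S /crit; rewrite ltnS chromatic_leq.
Qed.

Lemma colorable_induced (G : sgraph) (S : {set G}) k : colorable (induced S) k <->
  exists c : G -> nat, forall x, x \in S ->
    c x < k /\ forall y, y \in S -> edge x y -> c x != c y.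
Proof.
split=> [/colorableP[c lt_c c_ok]|[c c_ok]].
  exists (fun x => oapp c 0 (insub x)) => x xS; rewrite (insubT (mem S) xS) /=; split=> [//|y yS xy].
  by rewrite (insubT (mem S) yS) /= c_ok.
apply/colorableP; exists (fun u => c (val u)) => [[x xS]|[x xS] [y yS]] /=.
  by case: (c_ok x xS).
by case: (c_ok x xS) => _; apply.
Qed.

Lemma contains_rows (G H : sgraph) (w : seq H) : contains G H -> uniq w ->
  exists2 s : seq G, uniq s & rows (@edge G) s = rows (@edge H) w.
Proof.
case=> S [f [g fK gK] f_e] uw; exists [seq val (g x) | x <- w].
  by rewrite map_inj_uniq // => x y /val_inj/(can_inj gK).
by rewrite rows_map; apply: eq_rows => x y _ _; rewrite -{2}[x]gK -{2}[y]gK f_e.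
Qed.

Lemma rows_pairwise (T : eqType) (U : eqType) (e : rel T) (e' : rel U) x0 y0 s t :
  symmetric e -> irreflexive e -> symmetric e' -> irreflexive e' ->
  rows e s = rows e' t -> forall i j, i < size s -> j < size s ->
  e (nth x0 s i) (nth x0 s j) = e' (nth y0 t i) (nth y0 t j).
Proof.
move=> es ei es' ei' eq_r i j lt_i lt_j; have sz : size s = size t.
  by rewrite -(size_rows e) eq_r size_rows.
by rewrite -(adjE x0) // eq_r (adjE y0) // -sz.
Qed.

(** Equal codes make the map that sends the vertex at each place of [s] to the one at the same place
    of [w] an isomorphism; [w] lists all of [H]. *)
Lemma rows_contains (G H : sgraph) (s : seq G) (w : seq H) (h0 : H) :
  uniq s -> uniq w -> (forall x, x \in w) -> rows (@edge G) s = rows (@edge H) w -> contains G H.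
Proof.
move=> us uw mem_w eq_r; have sz : size s = size w.
  by rewrite -(size_rows (@edge G)) eq_r size_rows.
pose S := [set x in s]; exists S.
pose vl (u : induced S) : G := val u.
have vl_s u : vl u \in s by have := valP u; rewrite inE.
have ix u : index (vl u) s < size w by rewrite -sz index_mem.
pose f u := nth h0 w (index (vl u) s).
have inj_f : injective f.
  move=> u v /eqP; rewrite nth_uniq // => /eqP eq_i; apply: val_inj.
  by rewrite -[LHS](nth_index (vl u) (vl_s u)) eq_i nth_index.
exists f => [|u v].
  apply: inj_card_bij => //; rewrite card_sig (eq_card (B := mem s)) => [|x]; last by rewrite !inE.
  by rewrite (card_uniqP us) sz -(card_uniqP uw); apply: subset_leq_card; apply/subsetP.
have [sG iG sH iH] : [/\ symmetric (@edge G), irreflexive (@edge G), symmetric (@edge H)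
    & irreflexive (@edge H)].
  by split; [exact: edge_sym | exact: edge_irr | exact: edge_sym | exact: edge_irr].
by rewrite /f -(rows_pairwise (vl u) h0 sG iG sH iH eq_r) ?sz // !nth_index.
Qed.

(** * The 25-vertex graph *)

Lemma G25_sym : symmetric (fun i j : 'I_25 => line_adj i j).
Proof. by move=> i j; rewrite line_adj_sym. Qed.

Lemma G25_irr : irreflexive (fun i j : 'I_25 => line_adj i j).
Proof. by move=> i; rewrite line_adj_irr. Qed.

Definition G25 : sgraph := SGraph G25_sym G25_irr.

Lemma G25_not_5colorable : ~~ colorable G25 5.
Proof.
apply/negP => /colorableP[c lt_c c_ok].
pose c' x := if insub x is Some i then c i else 0.
apply: (no_coloring_sound no_coloring_25 (c := c')) => // [x y|x].
  rewrite !cat0s !mem_iota !add0n => lt_x lt_y xy.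
  by rewrite /c' !insubT; apply: c_ok.
by rewrite cat0s mem_iota /c' => lt_x; rewrite insubT.
Qed.

Lemma colorable_induced_off (S : {set G25}) (R : seq nat) :
  (forall i, i \in S -> val i \notin R) -> colorable_off R -> colorable (induced S) 5.
Proof.
move=> SR [c c_ok]; apply/colorable_induced; exists (fun i => c (val i)) => i iS.
have lt27 (j : G25) : val j < 27 by apply: ltn_trans (ltn_ord j) _.
have [lt_c c_e] := c_ok _ (lt27 i) (SR i iS).
by split=> // j jS ij; apply: c_e => //; apply: SR.
Qed.

(** Deleting a vertex [w] leaves a subgraph of the lines without a disjoint pair, [w] with a_0 or
    b_1, or without the triangle a_0 b_1 c_01. Both have been 5-coloured. *)
Lemma G25_critical : vertex_critical 6 G25.
Proof.
have lt27 (i : G25) : val i < 27 by apply: ltn_trans (ltn_ord i) _.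
have ne25 (i : G25) : (val i == a0) = false by apply/ltn_eqF/ltn_ord.
have ne26 (i : G25) : (val i == b1) = false by apply/ltn_eqF/(ltn_trans (ltn_ord i)).
apply/vertex_criticalP; split; first exact: G25_not_5colorable.
  have [c c_ok] := colorable_off_a0b1c01; apply/colorableP.
  have out (i : G25) : val i != c01 -> val i \notin [:: a0; b1; c01].
    by rewrite !inE ne25 ne26.
  (* A 5-colouring off the triangle leaves c_01 as the only uncoloured vertex, and it gets the sixth
     colour. *)
  exists (fun i : G25 => if val i == c01 then 5 else c (val i)) => [i|i j ij].
    by case: ifPn => // /out/(c_ok _ (lt27 i))[lt_c _]; apply: ltn_trans lt_c _.
  case: ifPn => [/eqP ei|/out ei]; case: ifPn => [/eqP ej|/out ej].
  - by move: ij; rewrite /= ei ej line_adj_irr.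
  - by rewrite neq_ltn orbC; have [-> _] := c_ok _ (lt27 j) ej.
  - by rewrite neq_ltn; have [-> _] := c_ok _ (lt27 i) ei.
  - by have [_] := c_ok _ (lt27 i) ei; apply.
move=> S /properP[_ [w _ wS]].
have neS i : i \in S -> (val i == val w) = false.
  by move=> iS; apply/eqP => /val_inj eq_i; rewrite -eq_i iS in wS.
have /or3P[/eqP ew|w25|w26] := line_adj_a0_b1 w.
- apply: colorable_induced_off colorable_off_a0b1c01 => i iS.
  by rewrite !inE ne25 ne26 -ew neS.
- apply: colorable_induced_off (colorable_off_nonadj (lt27 w) _ _ w25) => // [i iS|].
    by rewrite !inE ne25 neS.
  by rewrite ne25.
- apply: colorable_induced_off (colorable_off_nonadj (lt27 w) _ _ w26) => // [i iS|].
    by rewrite !inE ne26 neS.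
  by rewrite ne26.
Qed.

(** As [x] and [y] may also meet, this excludes the diamond and K4 at once. *)
Lemma lines_no_diamond u v x y : u < 27 -> v < 27 -> x < 27 -> y < 27 ->
  line_adj u v -> line_adj u x -> line_adj v x -> line_adj u y -> line_adj v y -> x != y -> False.
Proof.
move=> lt_u lt_v lt_x lt_y uv ux vx uy vy /eqP[].
exact: (third_uniq lt_u lt_v lt_x lt_y).
Qed.

Lemma rows_G25 (s : seq G25) : rows (@edge G25) s = rows line_adj (map val s).
Proof. by rewrite rows_map. Qed.

Lemma lines_no_path6 (s : seq nat) : all (gtn 27) s -> rows line_adj s <> path6.
Proof.
move=> lt_s eq_s; have sz : size s = 6 by rewrite -(size_rows line_adj) eq_s.
have adj_s i j : i < 6 -> j < 6 -> line_adj (nth 27 s i) (nth 27 s j) = adj path6 i j.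
  by move=> lt_i lt_j; rewrite -eq_s (adjE 27) ?sz //; [exact: line_adj_sym | exact: line_adj_irr].
have lt i : i < 6 -> nth 27 s i < 27 by move=> lt_i; apply: (allP lt_s); rewrite mem_nth ?sz.
(* The third vertex of the triangle on the first edge is adjacent to the last three vertices of the path. *)
have [w [lt_w w0 w1 ok]] := line_gq (lt 0 isT) (lt 1 isT) (adj_s 0 1 isT isT).
have w_adj i : 2 < i < 6 -> line_adj w (nth 27 s i).
  case/andP=> gt_i lt_i; have := ok _ (lt i lt_i).
  have [a0i a1i] : line_adj (nth 27 s i) (nth 27 s 0) = false /\
      line_adj (nth 27 s i) (nth 27 s 1) = false.
    by rewrite !adj_s //; case: i gt_i lt_i => [|[|[|[|[|[|]]]]]].
  rewrite a0i a1i !add0n eqb1 [line_adj _ w]line_adj_sym !inE => /orP[/or3P[]/eqP e|//].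
  - by rewrite e adj_s in a1i.
  - by rewrite e adj_s in a0i.
  - by rewrite e line_adj_sym w0 in a0i.
have n35 : nth 27 s 3 != nth 27 s 5.
  by apply/eqP => e; have := adj_s 2 3 isT isT; rewrite e adj_s.
apply: (@lines_no_diamond w (nth 27 s 4) (nth 27 s 3) (nth 27 s 5)); rewrite ?lt ?w_adj ?adj_s //.
Qed.

Lemma lines_no_diamond4 (s : seq nat) : uniq s -> all (gtn 27) s -> rows line_adj s <> diamond4.
Proof.
move=> us lt_s eq_s; have sz : size s = 4 by rewrite -(size_rows line_adj) eq_s.
have adj_s i j : i < 4 -> j < 4 -> line_adj (nth 27 s i) (nth 27 s j) = adj diamond4 i j.
  by move=> lt_i lt_j; rewrite -eq_s (adjE 27) ?sz //; [exact: line_adj_sym | exact: line_adj_irr].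
have lt i : i < 4 -> nth 27 s i < 27 by move=> lt_i; apply: (allP lt_s); rewrite mem_nth ?sz.
apply: (@lines_no_diamond (nth 27 s 1) (nth 27 s 2) (nth 27 s 0) (nth 27 s 3)); rewrite ?lt ?adj_s //.
by rewrite nth_uniq ?sz.
Qed.

Lemma lines_no_K4 (s : seq nat) : uniq s -> all (gtn 27) s -> rows line_adj s <> clique_code 4.
Proof.
move=> us lt_s eq_s; have sz : size s = 4 by rewrite -(size_rows line_adj) eq_s.
have adj_s i j : i < 4 -> j < 4 -> line_adj (nth 27 s i) (nth 27 s j) = adj (clique_code 4) i j.
  by move=> lt_i lt_j; rewrite -eq_s (adjE 27) ?sz //; [exact: line_adj_sym | exact: line_adj_irr].
have lt i : i < 4 -> nth 27 s i < 27 by move=> lt_i; apply: (allP lt_s); rewrite mem_nth ?sz.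
apply: (@lines_no_diamond (nth 27 s 1) (nth 27 s 2) (nth 27 s 0) (nth 27 s 3)); rewrite ?lt ?adj_s //.
by rewrite nth_uniq ?sz.
Qed.

Lemma rows_path6 : rows (@edge (path_graph 6)) (enum 'I_6) = path6.
Proof. by rewrite /path6 -val_enum_ord rows_map. Qed.

Lemma eq_set2 (T : finType) (x y u v : T) : x != y ->
  ([set x; y] == [set u; v]) = (x == u) && (y == v) || (x == v) && (y == u).
Proof.
move=> xy; apply/eqP/orP => [e|[]/andP[/eqP-> /eqP->] //]; last by rewrite setUC.
have := set21 x y; have := set22 x y; rewrite e !inE.
move=> /orP[]/eqP ey /orP[]/eqP ex; subst; rewrite ?eqxx in xy *; by [|left|right].
Qed.

Lemma rows_diamond4 : rows (@edge diamond) (enum 'I_4) = diamond4.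
Proof.
rewrite /diamond4 -val_enum_ord [RHS]rows_map; refine (@eq_rows 'I_4 _ _ _ _) => i j _ _ /=.
case: (eqVneq i j) => [->|ij] /=; first by rewrite eqxx.
by rewrite eq_set2 // negb_or [_ != _ :> nat]ij.
Qed.

Lemma rows_clique (T : eqType) (e : rel T) (s : seq T) : irreflexive e -> uniq s ->
  {in s &, forall x y, x != y -> e x y} -> rows e s = clique_code (size s).
Proof.
case: s => [//|x0 s0]; set s := _ :: s0 => e_irr us e_s.
rewrite -{1}(mkseq_nth x0 s) rows_map; apply: eq_rows => i j.
rewrite !mem_iota !add0n => lt_i lt_j; case: (eqVneq i j) => [->|ij]; first exact: e_irr.
by rewrite e_s ?mem_nth ?nth_uniq.
Qed.

Lemma clique_avoids (G : sgraph) k : clique_number G <= k -> avoids G (clique_code k.+1).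
Proof.
move=> le_k s us eq_s; have sz : size s = k.+1 by rewrite -(size_rows (@edge G)) eq_s size_rows size_iota.
suff : #|[set x in s]| <= k by rewrite cardsE (card_uniqP us) sz ltnn.
apply: leq_trans le_k; apply: (leq_bigmax_cond (F := fun S : {set G} => #|S|)).
apply/forallP => x; apply/implyP; rewrite inE => xs.
apply/forallP => y; apply/implyP; rewrite inE => ys; apply/implyP => xy.
rewrite -(nth_index x xs) -(nth_index x ys) -(adjE _ (@edge_sym G) (@edge_irr G)) ?index_mem //.
have [lt_x lt_y] : index x s < k.+1 /\ index y s < k.+1 by rewrite -sz !index_mem.
rewrite eq_s (adjE 0) ?size_iota //; first last.
- by move=> i; rewrite eqxx.
- by move=> i j; rewrite eq_sym.
rewrite !nth_iota ?add0n //; apply: contra xy => /eqP eq_i.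
by rewrite -(nth_index x xs) eq_i nth_index.
Qed.

Lemma clique_number_clique (G : sgraph) : exists s : seq G,
  [/\ uniq s, size s = clique_number G & {in s &, forall x y, x != y -> edge x y}].
Proof.
have cl0 : 0 < #|[pred S : {set G} | clique S]|.
  by apply/card_gt0P; exists set0; apply/forallP => x; rewrite inE.
have [S clS eS] := eq_bigmax_cond (fun S : {set G} => #|S|) cl0.
exists (enum S); split; [exact: enum_uniq | by rewrite /clique_number eS cardE|].
move=> x y; rewrite !mem_enum => xS yS xy.
by have /forallP/(_ x)/implyP/(_ xS)/forallP/(_ y)/implyP/(_ yS)/implyP := clS; apply.
Qed.

Lemma G25_lt27 (s : seq G25) : all (gtn 27) (map val s).
Proof. by apply/allP => _ /mapP[i _ ->]; apply: ltn_trans (ltn_ord i) _. Qed.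

Lemma G25_free : free_of [:: path_graph 6; diamond] G25.
Proof.
apply: List.Forall_cons => [cont|]; last apply: List.Forall_cons => [cont|//].
  have [s _] := contains_rows cont (enum_uniq 'I_6); rewrite rows_path6 rows_G25.
  exact: lines_no_path6 (G25_lt27 s).
have [s us] := contains_rows cont (enum_uniq 'I_4); rewrite rows_diamond4 rows_G25.
by apply: (lines_no_diamond4 _ (G25_lt27 s)); rewrite map_inj_uniq //; apply: val_inj.
Qed.

Lemma G25_clique_number : clique_number G25 = 3.
Proof.
apply/eqP; rewrite eqn_leq; apply/andP; split.
  rewrite leqNgt; apply/negP => gt3; have [s [us sz e_s]] := clique_number_clique G25.
  have sub x : x \in take 4 s -> x \in s by apply: mem_take.
  apply: (@lines_no_K4 (map val (take 4 s))); last 1 first.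
  - rewrite -rows_G25 rows_clique ?take_uniq //; last 2 first.
    + exact: edge_irr.
    + by move=> x y /sub xs /sub ys; apply: e_s.
    by rewrite size_takel // sz.
  - by rewrite map_inj_uniq ?take_uniq //; apply: val_inj.
  - exact: G25_lt27.
(* These are the numbers of c_01, c_23 and c_45, three lines in a plane. *)
pose t : seq G25 := [:: @Ordinal 25 0 isT; @Ordinal 25 11 isT; @Ordinal 25 20 isT].
have <- : #|[set x in t]| = 3 by rewrite cardsE; apply/card_uniqP.
apply: (leq_bigmax_cond (F := fun S : {set G25} => #|S|)).
apply/forallP => x; apply/implyP; rewrite !inE => xt.
apply/forallP => y; apply/implyP; rewrite !inE => yt.
by case/or3P: xt => /eqP->; case/or3P: yt => /eqP->; vm_compute.
Qed.

(** * Criticality and the uniqueness of the graph *)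

Lemma critical_irreducible (G : sgraph) :
  vertex_critical 6 G -> ~ isomorphic G25 G -> irreducible G.
Proof.
case/vertex_criticalP => ncol _ crit ne_G25.
have crit_col (S : {set G}) x : x \notin S -> exists c : G -> nat, forall x, x \in S ->
    c x < 5 /\ forall y, y \in S -> edge x y -> c x != c y.
  move=> xS; apply/colorable_induced/crit/properP; split; first exact: subsetT.
  by exists x; rewrite ?inE.
split.
- move=> x; rewrite leqNgt; apply/negP => le4; case/negP: ncol; apply/colorableP.
  have [|c c_ok] := crit_col [set~ x] x; first by rewrite !inE eqxx.
  (* At most four neighbours leave one of the five colours free for [x]. *)
  have /subsetPn[k _ k_N] : ~~ ([set: 'I_5] \subset [set inord (c y) | y in [set y | edge x y]]).
    apply: contraL le4 => /subset_leq_card; rewrite cardsT card_ord => le5; rewrite -leqNgt.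
    exact: leq_trans le5 (leq_imset_card _ _).
  have c5 y : y != x -> c y < 5 by move=> yx; case: (c_ok y); rewrite ?inE.
  have kN y : edge x y -> c y != k.
    move=> xy; apply: contra k_N => /eqP eq_k; apply/imsetP; exists y; rewrite ?inE //.
    by apply: val_inj; rewrite /= inordK // eq_k.
  exists (fun y => if y == x then val k else c y) => [y|y z yz].
    by case: ifPn => [_|yx]; [exact: ltn_ord | exact: c5].
  case: (eqVneq y x) yz => [->|yx]; case: (eqVneq z x) => [->|zx] yz.
  + by rewrite edge_irr in yz.
  + by rewrite eq_sym kN.
  + by rewrite kN // edge_sym.
  + by case: (c_ok y) => [|_]; rewrite ?inE //; apply; rewrite ?inE.
- move=> h hom z.
  have [/existsP[x /eqP hx]|/existsPn no_z] := boolP [exists x, h x == z]; first by exists x.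
  case/negP: ncol.
  have zS : z \notin [set~ z] by rewrite !inE eqxx.
  have hS x : h x \in [set~ z] by rewrite !inE no_z.
  (* An endomorphism that misses [z] pulls a 5-colouring of the graph without [z] back to all of
     [G]. *)
  have [c c_ok] := crit_col _ _ zS; apply/colorableP; exists (c \o h) => [x|x y xy] /=.
    by case: (c_ok _ (hS x)).
  by have [_] := c_ok _ (hS x); apply; rewrite ?hS ?hom.
- move=> B /set0Pn[b bB] /set0Pn[b' b'B].
  case: (boolP [exists x, exists y, [&& x \in B, y \notin B & edge x y]]) => [|no_e].
    by case/existsP => x /existsP[y /and3P[]]; exists x, y.
  have noE x y : x \in B -> y \notin B -> ~~ edge x y.
    move=> xB yB; apply/negP => xy; case/negP: no_e; apply/existsP; exists x; apply/existsP.
    by exists y; rewrite xB yB.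
  case/negP: ncol; apply/colorableP.
  (* With no edge between them, [B] and its complement can be coloured independently. *)
  have [|c c_ok] := crit_col B b'; first by rewrite inE in b'B.
  have [|d d_ok] := crit_col (~: B) b; first by rewrite inE bB.
  have dN x : x \notin B -> x \in ~: B by rewrite inE.
  exists (fun x => if x \in B then c x else d x) => [x|x y xy].
    by case: ifPn => [/c_ok[]|/dN/d_ok[]].
  case: ifPn => xB; case: ifPn => yB.
  + by have [_] := c_ok _ xB; apply.
  + by case/negP: (noE _ _ xB yB).
  + by case/negP: (noE _ _ yB xB); rewrite edge_sym.
  + by have [_] := d_ok _ (dN _ xB); apply; rewrite ?dN.
- move=> f lt_f inj_f f_e.
  (* The lines outside the image contain neither a disjoint pair nor a triangle, so they lie in an edge. *)
  pose R h := (h < 27) && [forall x, f x != h].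
  have colorable_off_R : ~ (exists2 Q, colorable_off Q & {subset Q <= R}).
    move=> [Q [c c_ok] QR]; case/negP: ncol; apply/colorableP.
    have fQ x : f x \notin Q.
      by apply/negP => /QR/andP[_ /forallP/(_ x)]; rewrite eqxx.
    exists (c \o f) => [x|x y] /=; first by case: (c_ok _ (lt_f x) (fQ x)).
    by rewrite f_e => xy; have [_] := c_ok _ (lt_f x) (fQ x); apply.
  have adjR u v : R u -> R v -> u != v -> line_adj u v.
    move=> Ru Rv uv; apply/negPn/negP => /(colorable_off_nonadj _ _ uv) col_uv; apply: colorable_off_R.
    exists [:: u; v]; first by apply: col_uv; [case/andP: Ru | case/andP: Rv].
    by move=> x; rewrite !inE => /orP[]/eqP->.
  have [u [v [lt_u lt_v uv Ruv]]] : exists u v, [/\ u < 27, v < 27, line_adj u v &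
      forall h, R h -> h \in [:: u; v]].
    have inr h : (h \in [seq h <- all_lines | R h]) = R h.
      by rewrite mem_filter mem_iota /R; case: (h < 27); rewrite ?andbF ?andbT.
    have : uniq [seq h <- all_lines | R h] by rewrite filter_uniq // iota_uniq.
    (* With no line missing any edge will do, and with one missing any edge through it. Two missing
       lines meet, and three would form a triangle. *)
    case def_r: [seq h <- all_lines | R h] => [|u [|v [|w r]]] /= ur.
    - have [ab _ _] := line_adj_a0b1c01.
      by exists a0, b1; split=> // h; rewrite -inr def_r.
    - have Ru : R u by rewrite -inr def_r inE.
      have lt_u : u < 27 by case/andP: Ru.
      have [v lt_v uv] := line_adj_neighbour lt_u.
      by exists u, v; split=> // h; rewrite -inr def_r !inE => ->.
    - have [Ru Rv] : R u /\ R v by rewrite -!inr def_r !inE !eqxx orbT.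
      exists u, v; split; [by case/andP: Ru | by case/andP: Rv | |].
        by apply: adjR => //; move: ur; rewrite inE; case/andP.
      by move=> h; rewrite -inr def_r.
    - have [Ru Rv Rw] : [/\ R u, R v & R w] by rewrite -!inr def_r !inE !eqxx !orbT.
      case: colorable_off_R; exists [:: u; v; w].
        move: ur; rewrite !inE !negb_or -!andbA => /and5P[uv uw _ vw _].
        by apply: colorable_off_triangle; rewrite ?adjR //; [case/andP: Ru | case/andP: Rv | case/andP: Rw].
      by move=> x; rewrite !inE => /or3P[]/eqP->.
  have [F [okF eq_uv]] := edge_aut lt_u lt_v uv.
  have okFF := okF; have /and4P[/eqP sF /allP ltF uF _] := okFF.
  have lt27 (i : G25) : val i < 27 by apply: ltn_trans (ltn_ord i) _.
  (* The automorphism takes the numbers 25 and 26 to [u] and [v], hence the first 25 lines into the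
     image of [f]. This embeds [G25] into [G]. *)
  have in_f (i : G25) : exists x, f x == nth 27 F (val i).
    have [/existsP//|/existsPn no_x] := boolP [exists x, f x == nth 27 F (val i)].
    have : R (nth 27 F (val i)).
      by apply/andP; split; [apply/ltF/mem_nth; rewrite sF | apply/forallP].
    move/Ruv; rewrite eq_uv !inE !nth_uniq ?sF // => /orP[]/eqP ei.
      by have := ltn_ord i; rewrite -[X in X < _]/(val i) ei.
    by have := ltn_ord i; rewrite -[X in X < _]/(val i) ei.
  pose g i := xchoose (in_f i).
  have fg i : f (g i) = nth 27 F (val i) by apply/eqP/(xchooseP (in_f i)).
  have g_e i j : edge (g i) (g j) = edge i j by rewrite f_e !fg (autoP okF).
  have g_inj : injective g.
    move=> i j eq_g; apply: val_inj; apply/eqP.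
    by rewrite -(nth_uniq 27 _ _ uF) ?sF // -!fg eq_g.
  apply: ne_G25; exists g => //; apply: inj_card_bij => //.
  (* If the embedding were not onto, its image would be a proper induced subgraph of [G] and so
     5-colourable. *)
  rewrite leqNgt; apply/negP => lt_G; case/negP: G25_not_5colorable.
  have /crit/colorable_induced[c c_ok] : [set g i | i in G25] \proper [set: G].
    by rewrite properEcard subsetT cardsT card_imset.
  apply/colorableP; exists (c \o g) => [i|i j ij] /=.
    by case: (c_ok (g i)); rewrite ?imset_f.
  by case: (c_ok (g i)) => [|_]; rewrite ?imset_f //; apply; rewrite ?imset_f ?g_e.
Qed.

Lemma avoids_base (G : sgraph) : free_of [:: path_graph 6; diamond] G -> clique_number G = 3 ->
  forall c, c \in base_codes -> avoids G c.
Proof.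
move=> /List.Forall_cons_iff[no_p /List.Forall_cons_iff[no_d _]] cl3 c.
rewrite !inE => /or3P[]/eqP->.
- move=> s us eq_s; apply: no_p; apply: (@rows_contains G (path_graph 6) s (enum 'I_6) ord0 us).
  + exact: enum_uniq.
  + by move=> x; rewrite mem_enum.
  + by rewrite rows_path6.
- move=> s us eq_s; apply: no_d; apply: (@rows_contains G diamond s (enum 'I_4) ord0 us).
  + exact: enum_uniq.
  + by move=> x; rewrite mem_enum.
  + by rewrite rows_diamond4.
- have le3 : clique_number G <= 3 by rewrite cl3.
  exact: (clique_avoids le3).
Qed.

Theorem theorem9 :
  exists G : sgraph,
    [/\ vertex_critical 6 G, free_of [:: path_graph 6; diamond] G
      & clique_number G = 3] /\
    forall H : sgraph,
      vertex_critical 6 H -> free_of [:: path_graph 6; diamond] H ->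
      clique_number H = 3 -> isomorphic G H.
Proof.
exists G25; split; first by split; [exact: G25_critical | exact: G25_free | exact: G25_clique_number].
move=> H crit freeH cl3.
(* Isomorphism is restated as a boolean over finite functions, so that the case distinction is
   constructive. *)
pose iso_b (f : {ffun G25 -> H}) := [&& injectiveb f, #|H| <= #|G25| &
  [forall x, forall y, edge (f x) (f y) == edge x y]].
have [/existsP[f /and3P[/injectiveP inj_f le_H /forallP f_e]]|no_iso] := boolP [exists f, iso_b f].
  exists f; first exact: inj_card_bij.
  by move=> x y; have /forallP/(_ y)/eqP := f_e x.
have irrH : irreducible H.
  apply: critical_irreducible => // -[f bij_f f_e]; case/existsP: no_iso.
  exists [ffun x => f x]; apply/and3P; split.
  - by apply/injectiveP => x y; rewrite !ffunE; apply: bij_inj.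
  - by rewrite (bij_eq_card bij_f).
  - by apply/forallP => x; apply/forallP => y; rewrite !ffunE f_e.
have av0 := avoids_base freeH cl3.
(* The order is forced: each certificate cites the graphs excluded before it by their place in the
   list. *)
have av1 : avoids H c5_cap := avoids_check irrH av0 c5_cap_refuted.
have av01 c : c \in base_codes ++ [:: c5_cap] -> avoids H c.
  by rewrite mem_cat mem_seq1 => /orP[/av0|/eqP->].
have av3 : avoids H c5_roof_ear := avoids_check irrH av01 c5_roof_ear_refuted.
have av13 c : c \in base_codes ++ [:: c5_cap; c5_roof_ear] -> avoids H c.
  by rewrite mem_cat mem_seq2 => /orP[/av0//|/orP[]/eqP->].
have av2 : avoids H c5_roof := avoids_check irrH av13 c5_roof_refuted.
have av132 c : c \in base_codes ++ [:: c5_cap; c5_roof_ear; c5_roof] -> avoids H c.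
  by rewrite mem_cat => /orP[/av0//|]; rewrite mem_seq3 => /or3P[]/eqP->.
(* A largest clique is a triangle, which the last certificate refutes. *)
have [s [us sz e_s]] := clique_number_clique H.
case: (avoids_check irrH av132 triangle_refuted us).
by rewrite rows_clique // ?sz ?cl3 //; apply: edge_irr.
Qed.
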